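(* Let $\alpha>-1$ and let $\phi(w)=w+b$ with $\operatorname{Re}(b)\ge 0$ (that is, $\phi$ is of parabolic type). Then the composition operator $C_\phi$ is cyclic on $\mathcal{A}^2_\alpha(\mathbb{C}_+)$ if and only if $\operatorname{Re}(b)>0$.
   Context: $\mathbb{C}_+=\{z\in\mathbb{C}:\operatorname{Re}(z)>0\}$ is the open right half-plane. For $\alpha>-1$, the weighted Bergman space $\mathcal{A}^2_\alpha(\mathbb{C}_+)$ is the Hilbert space of all holomorphic functions $f$ on $\mathbb{C}_+$ with finite norm $\|f\|=\left(\int_{\mathbb{C}_+}|f(x+iy)|^2x^\alpha\,dx\,dy\right)^{1/2}$. For $\phi(w)=aw+b$ with $a>0$ and $\operatorname{Re}(b)\ge 0$, the composition operator $C_\phi f=f\circ\phi$ is a bounded operator on $\mathcal{A}^2_\alpha(\mathbb{C}_+)$. A bounded linear operator $T$ on a separable Banach space $\mathcal{X}$ is cyclic if there is a non-zero $f\in\mathcal{X}$ such that $\operatorname{span}\{T^nf:n\in\mathbb{N}\}$ is dense in $\mathcal{X}$, where $\mathbb{N}$ is the set of non-negative integers. *)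

(* Defs.v *)
From HB Require Import structures.
From mathcomp Require Import all_boot all_order all_algebra.
From mathcomp Require Import complex.
From mathcomp Require Import all_classical all_reals all_analysis.

Set Implicit Arguments.
Unset Strict Implicit.
Unset Printing Implicit Defensive.

Import Order.TTheory GRing.Theory Num.Theory.
Import numFieldNormedType.Exports.

Local Open Scope classical_set_scope.
Local Open Scope ring_scope.

(* The modulus in R[i] is R[i]-valued; its real value is Normc.normc. *)
Definition cmod (R : realType) (z : R[i]) : R := ComplexField.Normc.normc z.

Definition right_half_plane (R : realType) : set R[i] :=
  [set z | 0 < complex.Re z].

(* Derivability is taken over the field R[i], that is, it is complex
   differentiability at every point of D. *)
Definition holomorphic_on (R : realType) (D : set R[i])
    (f : R[i] -> R[i]^o) : Prop :=
  forall z, D z -> derivable (f : R[i]^o -> R[i]^o) z 1.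

(* Functions on the right half-plane are represented by total functions on
   R[i] whose values outside the half-plane are irrelevant. *)
Definition bergman_norm (R : realType) (alpha : R) (f : R[i] -> R[i]^o) :
    \bar R :=
  ((\int[lebesgue_measure \x lebesgue_measure]_(p in
       [set p : R * R | (0 < p.1)%R])
     ((cmod (f (p.1 +i* p.2)%C)) ^+ 2 * p.1 `^ alpha)%:E) `^ 2^-1)%E.

Definition bergman (R : realType) (alpha : R) : set (R[i] -> R[i]^o) :=
  [set f | holomorphic_on (@right_half_plane R) f /\
           (bergman_norm alpha f < +oo)%E].

Definition composition_operator (R : realType) (phi : R[i] -> R[i])
    (f : R[i] -> R[i]^o) : R[i] -> R[i]^o := f \o phi.

Definition orbit_span (K : nzRingType) (V : lmodType K) (T : V -> V) (f : V) :
    set V :=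
  [set h | exists (n : nat) (c : 'I_n -> K), h = \sum_(k < n) c k *: iter k T f].

(* T should map functions that agree on the half-plane to functions that agree
   there. A vector is non-zero when it takes a non-zero value on the
   half-plane. *)
Definition bergman_cyclic (R : realType) (alpha : R)
    (T : (R[i] -> R[i]^o) -> (R[i] -> R[i]^o)) : Prop :=
  exists f : R[i] -> R[i]^o,
    [/\ bergman alpha f,
        exists2 z, @right_half_plane R z & f z != 0 &
        forall g, bergman alpha g -> forall e : R, 0 < e ->
          exists2 h, orbit_span T f h & (bergman_norm alpha (g - h)%R < e%:E)%E].

(* Main.v *)
(* If Re b > 0, then f(z) = \prod_(j <= M) 1 / (z + 1 + j b) is a cyclic vector
   for large M. By partial fractions, the translates f(z + k b) span the
   Takenaka-Malmquist functions u(z) B_k(z) / (z + p_k), where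
   u(z) = \prod_(j < M) 1 / (z + 1 + j b), p_k = 1 + (M + k) b and B_k is the
   Blaschke product with zeros conj p_0, ..., conj p_(k-1). Every g in the
   Bergman space is approximated by g(z + s) D(z) = u(z) P(z + s), with s > 0
   small and D a rational damping factor that makes P integrable over a
   vertical line Re = r with r < s. Cauchy's formula on this line writes
   P(z + s) as an average of the kernels 1 / (z + w), Re w = s - r. Expanding
   u(z) / (z + w) in Malmquist functions leaves a remainder that is at most
   |u(z)| times the modulus of a Blaschke product at w, and the latter tends to
   0 because \sum_k Re p_k / |p_k|^2 diverges.

   If Re b = 0, choose tau > 0 such that E(z) = exp(- tau z) has period b. For
   a cyclic f, the functional taking h to the integral of
   Im (h(z) f(conj z)) Im E(z) x^alpha kills each c f(z + k b), because the
   reflection y |-> - y - k Im b exchanges f(z + k b) and f(conj z) and negates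
   Im E. By density it kills h(z) = conj (f(conj z)) E(z), for which it is the
   integral of |f(conj z)|^2 (Im E(z))^2 x^alpha, and this is positive. *)

Require Import Defs.
From mathcomp Require Import all_boot all_order all_algebra.
From mathcomp Require Import complex.
From mathcomp Require Import all_classical all_reals all_analysis measurable_realfun zify.
From mathcomp Require Import ring lra.

Set Implicit Arguments.
Unset Strict Implicit.
Unset Printing Implicit Defensive.

Import Order.TTheory GRing.Theory Num.Theory.
Import numFieldNormedType.Exports.
Import ComplexField.

Local Open Scope classical_set_scope.
Local Open Scope ring_scope.

(** * Complex differentiability *)

(** Expanding the kernel rather than the function makes the approximation uniform: the remainder is
    [u(z)] times a factor that is small independently of [z], so norm convergence follows once [u]
    lies in the Bergman space. This and the integrability of [P] fix [M = K + 2] with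
    [K >= |alpha|]: one factor of [u] gives decay in [y], the other [K + 1] beat the weight in [x].
    Since [1/u] is a polynomial of degree [M], the damping has order [2 M]. For [alpha < 0] real
    translations need not be contractions, so convergence is shown only along well chosen shifts. Of
    [P] only an area integral is known, without pointwise decay; hence the vertical line and the
    edges of the rectangles behind Cauchy's formula are all found by averaging.

    If [Re b = 0], the reflection [y |-> - y - k Im b] leaves [f(z + k b) f(conj z)] invariant. A
    weight is odd under all these reflections exactly when it is odd in [y] with period [Im b];
    hence the sine in [Im E]. Holomorphy and boundedness of [E] keep the test function in the
    Bergman space. *)

Section ComplexModulus.
Context {R : realType}.
Implicit Types (z w : R[i]) (x y : R).

Lemma normr_cmod z : `|z| = (cmod z)%:C%C.
Proof. by case: z => a b; rewrite normc_def. Qed.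

Lemma cmodE z : cmod z ^+ 2 = complex.Re z ^+ 2 + complex.Im z ^+ 2.
Proof. by case: z => a b; rewrite /cmod /= sqr_sqrtr// addr_ge0// sqr_ge0. Qed.

Lemma cmod_ge0 z : 0 <= cmod z.
Proof. by case: z => a b; rewrite /cmod /= sqrtr_ge0. Qed.

Lemma cmodM z w : cmod (z * w) = cmod z * cmod w.
Proof. exact: Normc.normcM. Qed.

Lemma cmodD z w : cmod (z + w) <= cmod z + cmod w.
Proof. exact: le_normcD. Qed.

Lemma cmodN z : cmod (- z) = cmod z.
Proof. exact: normcN. Qed.

Lemma cmodV z : cmod z^-1 = (cmod z)^-1.
Proof. exact: Normc.normcV. Qed.

Lemma cmod0 : cmod (0 : R[i]) = 0.
Proof. exact: Normc.normc0. Qed.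

Lemma cmod1 : cmod (1 : R[i]) = 1.
Proof. exact: Normc.normc1. Qed.

Lemma cmodX z n : cmod (z ^+ n) = cmod z ^+ n.
Proof. by elim: n => [|n IH]; rewrite ?cmod1// !exprS cmodM IH. Qed.

Lemma cmodB z w : cmod (z - w) = cmod (w - z).
Proof. by rewrite -cmodN opprB. Qed.

Lemma cmod_eq0 z : (cmod z == 0) = (z == 0).
Proof.
apply/eqP/eqP => [|->]; last exact: cmod0.
exact: Normc.eq0_normc.
Qed.

Lemma cmod_gt0 z : (0 < cmod z) = (z != 0).
Proof. by rewrite lt_def cmod_ge0 andbT cmod_eq0. Qed.

Lemma cmod_real x : cmod (x%:C)%C = `|x|.
Proof. by rewrite /cmod /= expr0n addr0 sqrtr_sqr. Qed.

Lemma cmod_conj z : cmod (conjc z) = cmod z.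
Proof. by case: z => a b; rewrite /cmod /= sqrrN. Qed.

Lemma normr_Re_le z : `|complex.Re z| <= cmod z.
Proof.
by rewrite -(@ler_pXn2r _ 2)// ?nnegrE ?cmod_ge0// cmodE real_normK ?num_real// lerDl sqr_ge0.
Qed.

Lemma normr_Im_le z : `|complex.Im z| <= cmod z.
Proof.
by rewrite -(@ler_pXn2r _ 2)// ?nnegrE ?cmod_ge0// cmodE real_normK ?num_real// lerDr sqr_ge0.
Qed.

Lemma cmod_le_ReIm z : cmod z <= `|complex.Re z| + `|complex.Im z|.
Proof.
rewrite -(@ler_pXn2r _ 2)// ?nnegrE ?cmod_ge0// ?addr_ge0// cmodE sqrrD !real_normK ?num_real//.
by rewrite lerD2r lerDl mulrn_wge0// mulr_ge0.
Qed.

Lemma ReD z w : complex.Re (z + w) = complex.Re z + complex.Re w.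
Proof. by case: z w => [a b] [c d]. Qed.

Lemma ImD z w : complex.Im (z + w) = complex.Im z + complex.Im w.
Proof. by case: z w => [a b] [c d]. Qed.

Lemma ReN z : complex.Re (- z) = - complex.Re z.
Proof. by case: z. Qed.

Lemma ImN z : complex.Im (- z) = - complex.Im z.
Proof. by case: z. Qed.

Lemma ReB z w : complex.Re (z - w) = complex.Re z - complex.Re w.
Proof. by rewrite ReD ReN. Qed.

Lemma ImB z w : complex.Im (z - w) = complex.Im z - complex.Im w.
Proof. by rewrite ImD ImN. Qed.

Lemma ReM z w : complex.Re (z * w) =
  complex.Re z * complex.Re w - complex.Im z * complex.Im w.
Proof. by case: z w => [a b] [c d]. Qed.

Lemma ImM z w : complex.Im (z * w) =
  complex.Re z * complex.Im w + complex.Im z * complex.Re w.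
Proof. by case: z w => [a b] [c d]. Qed.

Lemma complex_ext z w :
  complex.Re z = complex.Re w -> complex.Im z = complex.Im w -> z = w.
Proof. by case: z w => [a b] [c d] /= -> ->. Qed.

End ComplexModulus.

(** An epsilon-delta form with real radii: the filters behind [derivable] on [R[i]] take their radii
    in [R[i]], whereas all estimates below compare real moduli. *)
Definition cdiff {R : realType} (f : R[i] -> R[i]) (z d : R[i]) : Prop :=
  forall e : R, 0 < e -> exists2 del : R, 0 < del &
    forall w, cmod (w - z) < del ->
      cmod (f w - f z - d * (w - z)) <= e * cmod (w - z).

Definition ccont {R : realType} (f : R[i] -> R[i]) (z : R[i]) : Prop :=
  forall e : R, 0 < e -> exists2 del : R, 0 < del &
    forall w, cmod (w - z) < del -> cmod (f w - f z) < e.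

Section ComplexDerivative.
Context {R : realType}.
Implicit Types (f g : R[i] -> R[i]) (z w d : R[i]).

Lemma cdiff_derivable f z d :
  cdiff f z d -> derivable (f : R[i]^o -> R[i]^o) z 1.
Proof.
move=> fd; apply/cvg_ex; exists d; apply/cvgrPdist_le => e e0.
(* A positive element of [R[i]] is real, so the tolerance descends to [R]. *)
have [e' ee' e'0] : exists2 e' : R, e = e'%:C%C & 0 < e'.
  exists (complex.Re e); last by move: e0; rewrite ltcE /= => /andP[].
  by rewrite RRe_real// gtr0_real.
have [del del0 H] := fd _ e'0.
exists del%:C%C => /=; first by rewrite ltcR.
move=> h /=; rewrite sub0r normrN normr_cmod ltcR => hdel h0.
rewrite normr_cmod ee' lecR.
have := H (h + z); rewrite addrK => /(_ hdel).
rewrite -(ler_pM2l (_ : 0 < cmod h^-1)); last by rewrite cmod_gt0 invr_eq0.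
rewrite -cmodM mulrCA -cmodM mulVf// cmod1 mulr1; apply: le_trans.
by rewrite cmodB mulrBr (mulrC d) mulKf// [_ *: 1]mulr1 /GRing.scale /=.
Qed.

Lemma derivable_cdiff f z :
  derivable (f : R[i]^o -> R[i]^o) z 1 -> exists d, cdiff f z d.
Proof.
move=> /cvg_ex[d] /cvgrPdist_le fd; exists d => e e0.
have /fd[del /= del0 H] : 0 < e%:C%C :> R[i] by rewrite ltcR.
have [del' dE del'0] : exists2 e' : R, del = e'%:C%C & 0 < e'.
  exists (complex.Re del); last by move: del0; rewrite ltcE /= => /andP[].
  by rewrite RRe_real// gtr0_real.
exists del' => // w wz.
have [->|wz0] := eqVneq w z; first by rewrite !subrr mulr0 subr0 cmod0 mulr0.
have h0 : w - z != 0 by rewrite subr_eq0.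
have := H (w - z); rewrite /= sub0r normrN normr_cmod dE ltcR => /(_ wz h0).
rewrite normr_cmod lecR [_ *: 1]mulr1 subrK /GRing.scale /= => H1.
rewrite -(ler_pM2l (_ : 0 < cmod (w - z)^-1)); last by rewrite cmod_gt0 invr_eq0.
rewrite -cmodM mulrCA -cmodM mulVf// cmod1 mulr1; apply: le_trans H1.
by rewrite cmodB [leRHS]cmodB mulrBr (mulrC d) mulKf// cmodB.
Qed.

Lemma cdiff_ccont f z d : cdiff f z d -> ccont f z.
Proof.
move=> fd e e0; have [del del0 H] := fd 1 ltr01.
exists (Num.min del (e / (cmod d + 1 + 1))).
  by rewrite lt_min del0 divr_gt0// ltr_wpDl ?ltr01// addr_ge0 ?cmod_ge0.
move=> w; rewrite lt_min => /andP[/H H1 H2].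
have -> : f w - f z = (f w - f z - d * (w - z)) + d * (w - z) by rewrite subrK.
apply: le_lt_trans (cmodD _ _) _; rewrite cmodM.
apply: (@le_lt_trans _ _ ((cmod d + 1) * cmod (w - z))).
  by rewrite mulrDl addrC lerD2l.
have D : 0 < cmod d + 1 by rewrite ltr_pwDr ?ltr01 ?cmod_ge0.
move: H2; rewrite ltr_pdivlMr; last exact: addr_gt0.
move=> H2.
by apply: le_lt_trans H2; rewrite mulrC ler_wpM2l ?cmod_ge0// lerDl.
Qed.

Lemma cdiff_lin d k z : cdiff (fun w => d * w + k) z d.
Proof.
move=> e e0; exists 1 => // w _.
rewrite (_ : _ - _ - _ = 0); last by ring.
by rewrite cmod0 mulr_ge0 ?cmod_ge0// ltW.
Qed.

Lemma cdiff_comp_shift f z k d :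
  cdiff f (z + k) d -> cdiff (fun w => f (w + k)) z d.
Proof.
move=> fd e /fd[del del0 H]; exists del => // w wz.
have := H (w + k); rewrite (_ : w + k - (z + k) = w - z); last by ring.
exact.
Qed.

Lemma cdiff_conj f z d :
  cdiff f (conjc z) d -> cdiff (fun w => conjc (f (conjc w))) z (conjc d).
Proof.
move=> fd e /fd[del del0 H]; exists del => // w.
rewrite -cmod_conj rmorphB /= => /H.
by rewrite -(rmorphB (@conjc R)) cmod_conj -[cmod (_ - _ - _)]cmod_conj !rmorphB rmorphM /= rmorphB /= !conjcK.
Qed.

End ComplexDerivative.

Section ComplexContinuity.
Context {R : realType}.
Implicit Types (f : R[i] -> R[i]) (z : R[i]).

Lemma derivable_ccont f z : derivable (f : R[i]^o -> R[i]^o) z 1 -> ccont f z.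
Proof. by move=> /derivable_cdiff[d]; exact: cdiff_ccont. Qed.

Lemma ccont_Re f z : ccont f z -> forall e : R, 0 < e -> exists2 del : R, 0 < del &
  forall w, cmod (w - z) < del -> `|complex.Re (f w) - complex.Re (f z)| < e.
Proof.
move=> fz e /fz[del del0 H]; exists del => // w /H; apply: le_lt_trans.
by rewrite -ReB normr_Re_le.
Qed.

Lemma ccont_Im f z : ccont f z -> forall e : R, 0 < e -> exists2 del : R, 0 < del &
  forall w, cmod (w - z) < del -> `|complex.Im (f w) - complex.Im (f z)| < e.
Proof.
move=> fz e /fz[del del0 H]; exists del => // w /H; apply: le_lt_trans.
by rewrite -ImB normr_Im_le.
Qed.

End ComplexContinuity.

Local Notation leb := (@lebesgue_measure _).
Local Notation leb2 := (leb \x leb)%E.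

Definition rhp2 {R : realType} (r : R) : set (R * R) := [set p | r < p.1].

(** * Measurability of continuous functions on half-planes *)

Section PlaneMeasurability.
Context {R : realType}.
Implicit Types (S : set (R * R)) (k : R * R -> R).

Definition open2 S := forall p, S p -> exists2 del : R, 0 < del &
  forall q : R * R, `|q.1 - p.1| < del -> `|q.2 - p.2| < del -> S q.

(** [S] is the union of the countably many squares with rational centre and half-side [1/(n+1)] that
    it contains; each of them is a measurable rectangle. *)
Lemma open2_measurable S : open2 S -> measurable S.
Proof.
move=> oS.
pose rect (t : rat * rat * nat) : set (R * R) :=
  ball (ratr t.1.1 : R) (t.2.+1%:R^-1) `*` ball (ratr t.1.2 : R) (t.2.+1%:R^-1).
pose F t := if `[< rect t `<=` S >] then rect t else set0.
have -> : S = \bigcup_t F t.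
  apply/seteqP; split => [p Sp|p [t _]]; last first.
    by rewrite /F; case: asboolP => // tS /tS.
  have [del del0 H] := oS _ Sp.
  pose n := Num.truncn (2 / del).
  have nd : n.+1%:R^-1 < del / 2.
    rewrite -[ltRHS]invrK ltf_pV2 ?posrE// ?invr_gt0 ?divr_gt0// invf_div.
    exact: truncnS_gt.
  have n0 : 0 < n.+1%:R^-1 :> R by [].
  have aux (x r : R) : 0 < r -> x - r < x + r by lra.
  have [a] := @rat_in_itvoo R (p.1 - n.+1%:R^-1) (p.1 + n.+1%:R^-1) (aux _ _ n0).
  have [b] := @rat_in_itvoo R (p.2 - n.+1%:R^-1) (p.2 + n.+1%:R^-1) (aux _ _ n0).
  rewrite !in_itv /= => /andP[b1 b2] /andP[a1 a2].
  exists (a, b, n) => //; rewrite /F /rect /=.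
  move: (n.+1%:R^-1 : R) n0 nd a1 a2 b1 b2 => r r0 rd a1 a2 b1 b2.
  rewrite asboolT.
    by split; rewrite /ball /= ltr_norml; apply/andP; split; lra.
  move=> q [] /=; rewrite /ball /= !ltr_norml => /andP[q1 q2] /andP[q3 q4].
  by apply: H; rewrite ltr_norml; apply/andP; split; lra.
apply: countable_bigcupT_measurable => // t; rewrite /F; case: asboolP => // _.
by apply: measurableX; exact: measurable_ball.
Qed.

Definition cont2 k p := forall e : R, 0 < e -> exists2 del : R, 0 < del &
  forall q : R * R, `|q.1 - p.1| < del -> `|q.2 - p.2| < del -> `|k q - k p| < e.

Lemma cont2_measurable_fun S k :
  open2 S -> (forall p, S p -> cont2 k p) -> measurable_fun S k.
Proof.
move=> oS kc; apply: (measurability _ (RGenOInfty.measurableE R)).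
move=> _ [_ [a ->] <-]; apply: open2_measurable => p [Sp].
rewrite /= in_itv /= andbT => akp.
have [d1 d10 H1] := oS _ Sp.
have [d2 d20 H2] := kc _ Sp (k p - a) ltac:(lra).
exists (Num.min d1 d2); first by rewrite lt_min d10.
move=> q; rewrite !lt_min => /andP[q1 q2] /andP[q3 q4]; split; first exact: H1.
have := H2 _ q2 q4; rewrite /= in_itv /= andbT ltr_norml => /andP[? _]; lra.
Qed.

Lemma open2_rhp2 (r : R) : open2 (rhp2 r).
Proof.
move=> p; rewrite /rhp2 /= => rp; exists (p.1 - r); first lra.
by move=> q; rewrite /= ltr_norml => /andP[? _] _; lra.
Qed.

Lemma measurable_rhp2 (r : R) : measurable (rhp2 r).
Proof. by apply: open2_measurable; exact: open2_rhp2. Qed.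

Lemma near_complex (z : R[i]) (del : R) : 0 < del -> forall q : R * R,
  `|q.1 - complex.Re z| < del / 2 -> `|q.2 - complex.Im z| < del / 2 ->
  cmod ((q.1 +i* q.2)%C - z) < del.
Proof.
move=> del0 q q1 q2; apply: le_lt_trans (cmod_le_ReIm _) _.
by case: z q1 q2 => a b /= q1 q2; lra.
Qed.

Lemma ccont_cont2 (F : R[i] -> R[i]) (p : R * R) : ccont F (p.1 +i* p.2)%C ->
  cont2 (fun p => complex.Re (F (p.1 +i* p.2)%C)) p /\
  cont2 (fun p => complex.Im (F (p.1 +i* p.2)%C)) p.
Proof.
move=> cF; split => e e0.
  have [del del0 H] := ccont_Re cF e0; exists (del / 2); first lra.
  by move=> q q1 q2; apply: H; exact: near_complex.
have [del del0 H] := ccont_Im cF e0; exists (del / 2); first lra.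
by move=> q q1 q2; apply: H; exact: near_complex.
Qed.

Lemma measurable_Re (r : R) (F : R[i] -> R[i]) :
  (forall z, r < complex.Re z -> ccont F z) ->
  measurable_fun (rhp2 r) (fun p => complex.Re (F (p.1 +i* p.2)%C)).
Proof.
move=> cF; apply: cont2_measurable_fun; first exact: open2_rhp2.
by move=> p rp; apply: (ccont_cont2 _).1; exact: cF.
Qed.

Lemma measurable_Im (r : R) (F : R[i] -> R[i]) :
  (forall z, r < complex.Re z -> ccont F z) ->
  measurable_fun (rhp2 r) (fun p => complex.Im (F (p.1 +i* p.2)%C)).
Proof.
move=> cF; apply: cont2_measurable_fun; first exact: open2_rhp2.
by move=> p rp; apply: (ccont_cont2 _).2; exact: cF.
Qed.

Lemma measurable_cmod2 (r : R) (F : R[i] -> R[i]) :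
  (forall z, r < complex.Re z -> ccont F z) ->
  measurable_fun (rhp2 r) (fun p => cmod (F (p.1 +i* p.2)%C) ^+ 2).
Proof.
move=> cF; rewrite (_ : (fun _ => _) = (fun p => complex.Re (F (p.1 +i* p.2)%C) ^+ 2 +
  complex.Im (F (p.1 +i* p.2)%C) ^+ 2)); last by apply/funext => p; rewrite cmodE.
by apply: measurable_funD; apply: measurable_funX; [exact: measurable_Re|exact: measurable_Im].
Qed.

Lemma measurable_cmod (r : R) (F : R[i] -> R[i]) :
  (forall z, r < complex.Re z -> ccont F z) ->
  measurable_fun (rhp2 r) (fun p => cmod (F (p.1 +i* p.2)%C)).
Proof.
move=> cF; apply: cont2_measurable_fun; first exact: open2_rhp2.
move=> p rp e e0; have /(_ _ e0)[del del0 H] : ccont F (p.1 +i* p.2)%C by exact: cF.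
exists (del / 2); first lra.
move=> q q1 q2; have := H (q.1 +i* q.2)%C; move=> /(_ (@near_complex (p.1 +i* p.2)%C _ del0 _ q1 q2)).
set u := F _; set v := F _; apply: le_lt_trans.
rewrite ler_norml; apply/andP; split.
  by have := cmodD (v - u) u; rewrite subrK cmodB; lra.
by have := cmodD (u - v) v; rewrite subrK; lra.
Qed.

Lemma measurable_powR_fst (r a : R) (D : set (R * R)) :
  measurable_fun D (fun p : R * R => (p.1 + r) `^ a).
Proof.
apply: measurable_funTS; apply: (measurableT_comp (measurable_powR _)).
by apply: measurable_funD => //; exact: measurable_fst.
Qed.

End PlaneMeasurability.

(** * Goursat's theorem on rectangles *)

Section Bisection.
Context {R : realType}.
Variable Phi : R * R * R * R -> R.

(** The wildcard branch is index 3. Indexing by ['I_4] makes the choice of the best quarter an arg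
    max and additivity a big sum. *)
Definition quarters (q : R * R * R * R) : {ffun 'I_4 -> R * R * R * R} :=
  let: (a, b, c, d) := q in let m := (a + b) / 2 in let n := (c + d) / 2 in
  [ffun i : 'I_4 => match nat_of_ord i with
    | 0 => (a, m, c, n) | 1 => (m, b, c, n) | 2 => (a, m, n, d) | _ => (m, b, n, d)
    end].

Definition best_quarter (q : R * R * R * R) :=
  quarters q [arg max_(i > ord0) `|Phi (quarters q i)|]%O.

Definition subrect (p q : R * R * R * R) :=
  let: (a, b, c, d) := p in let: (a', b', c', d') := q in
  [/\ a' <= a, a <= b, b <= b', c' <= c & c <= d /\ d <= d'].

(** Goursat's argument for any function of rectangles that is additive under quartering and locally
    [o] of the squared perimeter. Iterating the best quarter gives [|Phi q| <= 4 ^ n * |Phi (s n)|];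
    the nested rectangles shrink to a point, where [|Phi (s n)| <= e' * (S / 2 ^ n) ^ 2], and the
    powers of four cancel. *)
Lemma bisection (q : R * R * R * R) (S : R) : subrect q q ->
  S = (q.1.1.2 - q.1.1.1) + (q.2 - q.1.2) ->
  (forall p, subrect p q -> Phi p = \sum_(i < 4) Phi (quarters p i)) ->
  (forall x y, q.1.1.1 <= x <= q.1.1.2 -> q.1.2 <= y <= q.2 ->
    forall e, 0 < e -> exists2 del, 0 < del & forall a b c d,
     subrect (a, b, c, d) q -> a <= x <= b -> c <= y <= d ->
     b - a < del -> d - c < del -> `|Phi (a, b, c, d)| <= e * ((b - a) + (d - c)) ^+ 2) ->
  Phi q = 0.
Proof.
move=> qq SE split loc.
pose s n := iter n best_quarter q.
have sub_step p : subrect p q -> subrect (best_quarter p) q.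
  move: p q {qq SE split loc s} => [[[a b] c] d] [[[a' b'] c'] d'] /= [h1 h2 h3 h4 [h5 h6]].
  by rewrite /best_quarter ffunE; case: (nat_of_ord _) => [|[|[|?]]] /=; split; try split; lra.
have sub n : subrect (s n) q by elim: n => // n; exact: sub_step.
have sub_step2 p : subrect p p -> subrect (best_quarter p) p.
  move: p {qq SE split loc s sub sub_step} => [[[a b] c] d] /= [h1 h2 h3 h4 [h5 h6]].
  by rewrite /best_quarter ffunE; case: (nat_of_ord _) => [|[|[|?]]] /=; split; try split; lra.
have refl n : subrect (s n) (s n).
  have := sub n; case: (s n) => [[[a b] c] d]; case: (q) => [[[a' b'] c'] d'] /= [? ? ? ? [? ?]].
  by split=> //; split.
have trans p1 p2 p3 : subrect p1 p2 -> subrect p2 p3 -> subrect p1 p3.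
  move: p1 p2 p3 => [[[a b] c] d] [[[a' b'] c'] d'] [[[a2 b2] c2] d2] /= [? ? ? ? [? ?]] [? ? ? ? [? ?]].
  by split; try split; lra.
have mono m n : subrect (s (m + n)%N) (s m).
  elim: n => [|n IH]; first by rewrite addn0.
  by rewrite addnS; apply: trans IH; apply: sub_step2; exact: refl.
have size n : (s n).1.1.2 - (s n).1.1.1 = (q.1.1.2 - q.1.1.1) / 2 ^+ n /\
    (s n).2 - (s n).1.2 = (q.2 - q.1.2) / 2 ^+ n.
  elim: n => [|n [IH1 IH2]]; first by rewrite expr0 !divr1.
  rewrite exprSr invfM !mulrA -IH1 -IH2 /s iterS -/(s n).
  case: (s n) => [[[a b] c] d] /=; rewrite /best_quarter ffunE.
  by case: (nat_of_ord _) => [|[|[|?]]] /=; split; lra.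
have big n : `|Phi q| <= 4 ^+ n * `|Phi (s n)|.
  elim: n => [|n IH]; first by rewrite expr0 mul1r.
  apply: le_trans IH _; rewrite exprSr -mulrA ler_pM2l ?exprn_gt0//.
  rewrite (split _ (sub n)) /s iterS -/(s n) /best_quarter.
  case: arg_maxP => // i _ imax.
  apply: le_trans (ler_norm_sum _ _ _) _.
  apply: le_trans (ler_sum _ (fun j _ => imax j isT)) _.
  by rewrite sumr_const card_ord mulr_natl.
pose x := sup (range (fun n => (s n).1.1.1)); pose y := sup (range (fun n => (s n).1.2)).
have leab m n : (s m).1.1.1 <= (s n).1.1.2 /\ (s m).1.2 <= (s n).2.
  have [mn|nm] := leqP m n.
    have := mono m (n - m)%N; rewrite subnKC//.
    by case: (s m) (s n) => [[[a b] c] d] [[[a' b'] c'] d'] /= [? ? ? ? [? ?]]; lra.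
  have := mono n (m - n)%N; rewrite subnKC ?(ltnW nm)//.
  by case: (s m) (s n) => [[[a b] c] d] [[[a' b'] c'] d'] /= [? ? ? ? [? ?]]; lra.
have xs n : (s n).1.1.1 <= x <= (s n).1.1.2.
  apply/andP; split.
    apply: ub_le_sup; last by exists n.
    by exists (s 0%N).1.1.2 => _ [m _ <-]; exact: (leab m 0%N).1.
  by apply: ge_sup; [exists (s 0%N).1.1.1; exists 0%N|move=> _ [m _ <-]; exact: (leab m n).1].
have ys n : (s n).1.2 <= y <= (s n).2.
  apply/andP; split.
    apply: ub_le_sup; last by exists n.
    by exists (s 0%N).2 => _ [m _ <-]; exact: (leab m 0%N).2.
  by apply: ge_sup; [exists (s 0%N).1.2; exists 0%N|move=> _ [m _ <-]; exact: (leab m n).2].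
apply/eqP; rewrite -normr_le0; apply/ler_addgt0Pr => e e0; rewrite add0r.
(* The [+ 1] covers the degenerate rectangle, for which [S = 0]. *)
have e'0 : 0 < e / (S ^+ 2 + 1) by rewrite divr_gt0// ltr_wpDl// sqr_ge0.
have [del del0 H] := loc x y (xs 0%N) (ys 0%N) _ e'0.
have [w0 h0] : 0 <= q.1.1.2 - q.1.1.1 /\ 0 <= q.2 - q.1.2.
  by move: qq; case: (q) => [[[a b] c] d] /= [? ? ? ? [? ?]]; lra.
have S0 : 0 <= S by rewrite SE addr_ge0.
(* With this choice [S / del < n + 1 <= 2 ^ n]. *)
pose n := Num.truncn (S / del).
have nlt : S / 2 ^+ n < del.
  rewrite ltr_pdivrMr ?exprn_gt0// mulrC -ltr_pdivrMr//.
  apply: lt_le_trans (truncnS_gt _) _; rewrite -natrX ler_nat.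
  by rewrite ltn_expl.
have [sz1 sz2] := size n.
have p2 : 0 < 2 ^+ n :> R by rewrite exprn_gt0.
have l1 : (s n).1.1.2 - (s n).1.1.1 < del.
  rewrite sz1; apply: le_lt_trans nlt; rewrite ler_pM2r ?invr_gt0// SE; lra.
have l2 : (s n).2 - (s n).1.2 < del.
  rewrite sz2; apply: le_lt_trans nlt; rewrite ler_pM2r ?invr_gt0// SE; lra.
have := big n; have := sub n; have := xs n; have := ys n.
case: (s n) sz1 sz2 l1 l2 => [[[a b] c] d] /= sz1 sz2 l1 l2 yy xx sb bg.
have := H _ _ _ _ sb xx yy l1 l2.
rewrite sz1 sz2 -mulrDl -SE => K.
apply: le_trans bg _.
apply: (@le_trans _ _ (4 ^+ n * (e / (S ^+ 2 + 1) * (S / 2 ^+ n) ^+ 2))).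
  by rewrite ler_pM2l ?exprn_gt0.
rewrite expr_div_n -exprM mulnC exprM (_ : 2 ^+ 2 = 4); last by rewrite expr2; lra.
have q4 : 4 ^+ n != 0 :> R by rewrite gt_eqF// exprn_gt0.
have -> : 4 ^+ n * (e / (S ^+ 2 + 1) * (S ^+ 2 / 4 ^+ n)) = e * (S ^+ 2 / (S ^+ 2 + 1)).
  by field; rewrite q4 gt_eqF// ltr_wpDl ?sqr_ge0.
rewrite ger_pMr// ler_pdivrMr ?mul1r ?lerDl//.
by rewrite ltr_wpDl ?sqr_ge0.
Qed.

End Bisection.

Definition cont1 {R : realType} (f : R -> R) (x : R) := forall e : R, 0 < e ->
  exists2 del : R, 0 < del & forall y, `|y - x| < del -> `|f y - f x| < e.

(** This integral is unoriented: it is 0 when [b < a], which is why splitting asks for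
    [a <= m <= b]. *)
Definition segint {R : realType} (f : R -> R) (a b : R) : R :=
  \int[leb]_(x in `[a, b]) f x.

Section SegmentIntegral.
Context {R : realType}.
Implicit Types (f g : R -> R) (a b : R).

Lemma cont1P f x : cont1 f x <-> {for x, continuous f}.
Proof.
split=> [fx|/cvgrPdist_lt fx].
  apply/cvgrPdist_lt => e /fx[del del0 H]; exists del => //= y /=.
  by rewrite distrC => /H; rewrite distrC.
move=> e /fx[del /= del0 H]; exists del => // y yx.
by have := H y; rewrite /= distrC => /(_ yx); rewrite distrC.
Qed.

Lemma seg_integrable f a b : (forall x, a <= x <= b -> cont1 f x) ->
  leb.-integrable `[a, b] (EFin \o f).
Proof.
move=> fc; apply: continuous_compact_integrable; first exact: segment_compact.
apply: continuous_in_subspaceT => x; rewrite inE /= in_itv /= => /fc.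
by move=> /cont1P.
Qed.

Lemma segint_split f a b m : a <= m <= b -> leb.-integrable `[a, b] (EFin \o f) ->
  segint f a b = segint f a m + segint f m b.
Proof.
move=> /andP[am mb] fi; have mi : leb.-integrable `[m, b] (EFin \o f).
  by apply: integrableS fi => //; apply: subset_itvr; rewrite bnd_simp.
rewrite /segint -[X in _ = _ + X]Rintegral_itv_obnd_cbnd; last first.
  by apply: integrableS mi => //; apply: subset_itvr; rewrite bnd_simp.
by rewrite -(Rintegral_itvB fi) ?bnd_simp// addrC subrK.
Qed.

Lemma segintB f g a b : leb.-integrable `[a, b] (EFin \o f) ->
  leb.-integrable `[a, b] (EFin \o g) ->
  segint f a b - segint g a b = segint (fun x => f x - g x) a b.
Proof. by move=> fi gi; rewrite /segint RintegralB. Qed.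

Lemma segint_approx f a b K M : a <= b -> leb.-integrable `[a, b] (EFin \o f) ->
  (forall x, a <= x <= b -> `|f x - K| <= M) ->
  `|segint f a b - K * (b - a)| <= M * (b - a).
Proof.
move=> ab fi fM.
have cstE r : \int[leb]_(x in `[a, b]) (cst r : R -> R) x = r * (b - a).
  rewrite Rintegral_cst//= lebesgue_measure_itv /= lte_fin.
  by case: ltgtP ab => //= -> _; rewrite subrr.
have cint r : leb.-integrable `[a, b] (EFin \o (cst r : R -> R)).
  by apply: seg_integrable => x _ e e0; exists 1 => // y _; rewrite subrr normr0.
have lo : (K - M) * (b - a) <= segint f a b.
  rewrite -cstE; apply: le_Rintegral => // x /=; rewrite in_itv /= => /fM.
  rewrite ler_norml => /andP[? ?]; lra.
have hi : segint f a b <= (K + M) * (b - a).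
  rewrite -cstE; apply: le_Rintegral => // x /=; rewrite in_itv /= => /fM.
  rewrite ler_norml => /andP[? ?]; lra.
rewrite ler_norml; apply/andP; split; lra.
Qed.

Lemma segint_bound f a b M : a <= b -> leb.-integrable `[a, b] (EFin \o f) ->
  (forall x, a <= x <= b -> `|f x| <= M) -> `|segint f a b| <= M * (b - a).
Proof.
move=> ab fi fM; have := @segint_approx f a b 0 M ab fi.
by rewrite mul0r subr0; apply => x /fM; rewrite subr0.
Qed.

End SegmentIntegral.

Section ClosedForms.
Context {R : realType}.
Variables P Q : R -> R -> R.

(** The boundary of [[a, b] x [c, d]] is run through counterclockwise. *)
Definition circulation (q : R * R * R * R) : R :=
  let: (a, b, c, d) := q in
  segint (P^~ c) a b - segint (P^~ d) a b + (segint (Q b) c d - segint (Q a) c d).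

(* [P dx + Q dy] is differentiable at [(x0, y0)] and closed there: [B] is both dP/dy and dQ/dx. *)
Definition closed_form_at (x0 y0 : R) := exists A B D : R,
  forall e : R, 0 < e -> exists2 del : R, 0 < del &
  forall x y, `|x - x0| < del -> `|y - y0| < del ->
    `|P x y - P x0 y0 - A * (x - x0) - B * (y - y0)| <= e * (`|x - x0| + `|y - y0|) /\
    `|Q x y - Q x0 y0 - B * (x - x0) - D * (y - y0)| <= e * (`|x - x0| + `|y - y0|).

Lemma affine_cont1 (f : R -> R) A x0 : (forall e : R, 0 < e -> exists2 del : R, 0 < del &
    forall x, `|x - x0| < del -> `|f x - f x0 - A * (x - x0)| <= e * `|x - x0|) ->
  cont1 f x0.
Proof.
move=> fA e e0; have [del del0 H] := fA 1 ltr01.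
have A0 : 0 < `|A| + 1 by rewrite ltr_wpDl.
exists (Num.min del (e / (`|A| + 1))); first by rewrite lt_min del0 divr_gt0.
move=> x; rewrite lt_min => /andP[/H H1]; rewrite ltr_pdivlMr// => H2.
apply: le_lt_trans H2; rewrite -[f x - f x0](subrK (A * (x - x0))).
by apply: le_trans (ler_normD _ _) _; rewrite normrM; lra.
Qed.

Lemma closed_form_cont1 x0 y0 : closed_form_at x0 y0 ->
  [/\ cont1 (P^~ y0) x0, cont1 (P x0) y0, cont1 (Q^~ y0) x0 & cont1 (Q x0) y0].
Proof.
move=> [A [B [D H]]]; split.
- apply: (@affine_cont1 _ A) => e /H[del del0 H1]; exists del => // x xd.
  have := H1 x y0 xd; rewrite subrr normr0 !mulr0 !subr0 addr0 => /(_ del0)[]//.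
- apply: (@affine_cont1 _ B) => e /H[del del0 H1]; exists del => // y yd.
  have := H1 x0 y; rewrite subrr normr0 !mulr0 !subr0 add0r => /(_ del0 yd)[]//.
- apply: (@affine_cont1 _ B) => e /H[del del0 H1]; exists del => // x xd.
  have := H1 x y0 xd; rewrite subrr normr0 !mulr0 !subr0 addr0 => /(_ del0)[]//.
- apply: (@affine_cont1 _ D) => e /H[del del0 H1]; exists del => // y yd.
  have := H1 x0 y; rewrite subrr normr0 !mulr0 !subr0 add0r => /(_ del0 yd)[]//.
Qed.

Lemma closed_form_integrable a b c d :
  (forall x y, a <= x <= b -> c <= y <= d -> closed_form_at x y) ->
  (forall y, c <= y <= d -> leb.-integrable `[a, b] (EFin \o P^~ y)) /\
  (forall x, a <= x <= b -> leb.-integrable `[c, d] (EFin \o Q x)).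
Proof.
move=> H; split => [y yy|x xx]; apply: seg_integrable.
  by move=> x xx; have [] := closed_form_cont1 (H _ _ xx yy).
by move=> y yy; have [] := closed_form_cont1 (H _ _ xx yy).
Qed.

Lemma segment_left (a b : R) : a <= b -> a <= a <= b.
Proof. by rewrite lexx. Qed.

Lemma segment_right (a b : R) : a <= b -> a <= b <= b.
Proof. by rewrite lexx andbT. Qed.

Lemma dist_in_segment (a b x y : R) :
  a <= x <= b -> a <= y <= b -> `|x - y| <= b - a.
Proof.
by move=> /andP[? ?] /andP[? ?]; rewrite ler_norml; apply/andP; split; lra.
Qed.

(** The terms in [A] cancel between the two opposite edges, which leaves the constant [B * (c - d)]
    and two errors of size [e * (b - a + h)]. *)
Lemma strip_bound (F : R -> R -> R) x0 y0 A B e a b c d h : a <= x0 <= b ->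
  leb.-integrable `[a, b] (EFin \o F^~ c) -> leb.-integrable `[a, b] (EFin \o F^~ d) ->
  0 <= e -> `|c - y0| <= h -> `|d - y0| <= h ->
  (forall x, a <= x <= b ->
    `|F x c - F x0 y0 - A * (x - x0) - B * (c - y0)| <= e * (`|x - x0| + `|c - y0|) /\
    `|F x d - F x0 y0 - A * (x - x0) - B * (d - y0)| <= e * (`|x - x0| + `|d - y0|)) ->
  `|segint (fun x => F x c - F x d) a b - B * (c - d) * (b - a)| <=
    2 * e * ((b - a) + h) * (b - a).
Proof.
move=> xx ic id e0 ch dh H; apply: segint_approx.
- by case/andP: xx; exact: le_trans.
- exact: (@integrableB _ _ _ leb `[a, b] _ _ _ ic id).
move=> x ax; have [] := H _ ax; have w1 := dist_in_segment ax xx.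
have L (t : R) : `|t| <= h -> e * (`|x - x0| + `|t|) <= e * (b - a + h).
  by move=> th; rewrite ler_wpM2l// lerD.
move=> /le_trans - /(_ _ (L _ ch)) + /le_trans - /(_ _ (L _ dh)).
move: (F x c) (F x d) (F x0 y0) (e * (b - a + h)) (mulrA 2 e (b - a + h)) => u v p K <-.
clear; rewrite !ler_norml => /andP[? ?] /andP[? ?].
by apply/andP; split; lra.
Qed.

(** The main terms of the two pairs of opposite edges are [B * (c - d) * (b - a)] and
    [B * (b - a) * (d - c)]. They cancel because closedness provides the same [B] for [P] and
    [Q]. *)
Lemma goursat a b c d : a <= b -> c <= d ->
  (forall x y, a <= x <= b -> c <= y <= d -> closed_form_at x y) ->
  circulation (a, b, c, d) = 0.
Proof.
move=> ab cd H.
have int_sub a' b' c' d' : subrect (a', b', c', d') (a, b, c, d) ->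
  (forall y, c' <= y <= d' -> leb.-integrable `[a', b'] (EFin \o P^~ y)) /\
  (forall x, a' <= x <= b' -> leb.-integrable `[c', d'] (EFin \o Q x)).
  move=> [? ? ? ? [? ?]]; apply: closed_form_integrable => x y /andP[? ?] /andP[? ?].
  by apply: H; apply/andP; split; lra.
apply: (@bisection _ circulation _ _ _ erefl).
- by split => //; split.
- move=> [[[a' b'] c'] d'] sb; have [iP iQ] := int_sub _ _ _ _ sb.
  move: sb => [? ? ? ? [? ?]].
  rewrite !big_ord_recl big_ord0 /= !ffunE /= /circulation.
  rewrite !(@segint_split _ _ a' b' ((a' + b') / 2)); try lra.
  2-3: by apply: iP; lra.
  rewrite !(@segint_split _ _ c' d' ((c' + d') / 2)); try lra.
  by apply: iQ; lra.
  by apply: iQ; lra.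
- move=> x0 y0 /= xx yy e e0; have [A [B [D HH]]] := H _ _ xx yy.
  (* Each pair of opposite edges errs by [2 * (e / 2)] times the half-perimeter times its own side,
     and the two sides add up to the half-perimeter. *)
  have [del del0 K] := HH (e / 2) ltac:(lra).
  exists del => // a' b' c' d' sb /andP[x1 x2] /andP[y1 y2] bd dd.
  have [iP iQ] := int_sub _ _ _ _ sb; move: sb => [? ? ? ? [? ?]].
  rewrite /circulation segintB; [|by apply: iP; lra..].
  rewrite segintB; [|by apply: iQ; lra..].
  have n1 : c' <= y0 <= d' by rewrite y1.
  have n2 : a' <= x0 <= b' by rewrite x1.
  have a'b' : a' <= b' by exact: le_trans x2.
  have c'd' : c' <= d' by exact: le_trans y2.
  have near (x y z t : R) : x <= y <= z -> x <= t <= z -> z - x < del -> `|y - t| < del.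
    by move=> h1 h2; apply: le_lt_trans; exact: dist_in_segment.
  have [aa bb] := (segment_left a'b', segment_right a'b').
  have [cc dd'] := (segment_left c'd', segment_right c'd').
  have E1 : `|segint (fun x => P x c' - P x d') a' b' - B * (c' - d') * (b' - a')| <=
      2 * (e / 2) * ((b' - a') + (d' - c')) * (b' - a').
    apply: (strip_bound (A := A) n2 (iP _ cc) (iP _ dd')) => //.
    - by rewrite divr_ge0 ?(ltW e0).
    - exact: dist_in_segment cc n1.
    - exact: dist_in_segment dd' n1.
    - move=> x x' /=; split; apply: (K _ _ (near _ _ _ _ x' n2 bd) (near _ _ _ _ _ n1 dd)).1 => //.
  have E2 : `|segint (fun y => Q b' y - Q a' y) c' d' - B * (b' - a') * (d' - c')| <=
      2 * (e / 2) * ((d' - c') + (b' - a')) * (d' - c').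
    apply: (strip_bound (F := fun y x => Q x y) (A := D) n1 (iQ _ bb) (iQ _ aa)) => //.
    - by rewrite divr_ge0 ?(ltW e0).
    - exact: dist_in_segment bb n2.
    - exact: dist_in_segment aa n2.
    - move=> y y' /=; split; rewrite (addrAC _ (- _)) [`|y - y0| + _]addrC.
        by apply: (K _ _ (near _ _ _ _ _ n2 bd) (near _ _ _ _ y' n1 dd)).2.
      by apply: (K _ _ (near _ _ _ _ _ n2 bd) (near _ _ _ _ y' n1 dd)).2.
  move: E1 E2; rewrite (mulrC 2) divfK// (addrC (d' - c')).
  move: (segint _ _ _) (segint _ _ _) => I1 I2.
  rewrite expr2 !ler_norml; clear => /andP[? ?] /andP[? ?].
  by apply/andP; split; lra.
Qed.

End ClosedForms.

(** Two strips of full height and two pieces below and above the point avoid it, so [goursat]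
    applies to them. What remains is the boundary of a square of half-side [h], on which boundedness
    gives at most [8 * M * h]. *)
Lemma circulation_removable {R : realType} (P Q : R -> R -> R) (a b c d x0 y0 M del : R) :
  a < x0 < b -> c < y0 < d -> 0 < del ->
  (forall x y, a <= x <= b -> c <= y <= d -> (x != x0) || (y != y0) ->
    closed_form_at P Q x y) ->
  (forall x y, `|x - x0| < del -> `|y - y0| < del -> (x != x0) || (y != y0) ->
    `|P x y| <= M /\ `|Q x y| <= M) ->
  circulation P Q (a, b, c, d) = 0.
Proof.
move=> /andP[ax xb] /andP[cy yd] del0 cf bd.
have small (h : R) : 0 < h -> h < del -> a <= x0 - h -> x0 + h <= b ->
  c <= y0 - h -> y0 + h <= d -> `|circulation P Q (a, b, c, d)| <= 8 * M * h.
  move=> h0 hdel a1 b1 c1 d1.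
  have iP y s t : a <= s -> t <= b -> c <= y <= d -> y != y0 ->
      leb.-integrable `[s, t] (EFin \o P^~ y).
    move=> as_ tb yy ny; apply: seg_integrable => x /andP[sx xt].
    have xx : a <= x <= b by rewrite (le_trans as_) ?(le_trans xt).
    by have [] := closed_form_cont1 (cf _ _ xx yy ltac:(by rewrite ny orbT)).
  have iQ x s t : c <= s -> t <= d -> a <= x <= b -> x != x0 ->
      leb.-integrable `[s, t] (EFin \o Q x).
    move=> cs td xx nx; apply: seg_integrable => y /andP[sy yt].
    have yy : c <= y <= d by rewrite (le_trans cs) ?(le_trans yt).
    by have [] := closed_form_cont1 (cf _ _ xx yy ltac:(by rewrite nx)).
  have x1 : a <= x0 - h <= b by rewrite a1 ltW//; lra.
  have x2 : a <= x0 + h <= b by rewrite b1 andbT ltW//; lra.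
  have y1 : c <= y0 - h <= d by rewrite c1 ltW//; lra.
  have y2 : c <= y0 + h <= d by rewrite d1 andbT ltW//; lra.
  have n1 (x : R) : x - h != x by rewrite lt_eqF// gtrBl.
  have n2 (x : R) : x + h != x by rewrite gt_eqF// ltrDl.
  have cc : c <= c <= d by rewrite lexx ltW// (lt_trans cy).
  have dd : c <= d <= d by rewrite lexx ltW// (lt_trans cy).
  have aa : a <= a <= b by rewrite lexx ltW// (lt_trans ax).
  have bb : a <= b <= b by rewrite lexx ltW// (lt_trans ax).
  have nc : c != y0 by rewrite lt_eqF.
  have nd : d != y0 by rewrite gt_eqF.
  have na : a != x0 by rewrite lt_eqF.
  have nb : b != x0 by rewrite gt_eqF.
  have hh (x : R) : x - h <= x + h by rewrite lerD2l ge0_cp// ltW.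
  have G1 : circulation P Q (a, x0 - h, c, d) = 0.
    apply: goursat => //; first by rewrite ltW// (lt_trans cy).
    move=> x y /andP[? xl] yy; apply: cf => //; first by apply/andP; split => //; lra.
    by rewrite lt_eqF// (le_lt_trans xl)// gtrBl.
  have G2 : circulation P Q (x0 + h, b, c, d) = 0.
    apply: goursat => //; first by rewrite ltW// (lt_trans cy).
    move=> x y /andP[xl ?] yy; apply: cf => //; first by apply/andP; split => //; lra.
    by rewrite gt_eqF// (lt_le_trans _ xl)// ltrDl.
  have G3 : circulation P Q (x0 - h, x0 + h, c, y0 - h) = 0.
    apply: goursat => // x y /andP[? ?] /andP[? yl].
    apply: cf; [by apply/andP; split; lra|by apply/andP; split => //; lra|].
    by rewrite orbC lt_eqF// (le_lt_trans yl)// gtrBl.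
  have G4 : circulation P Q (x0 - h, x0 + h, y0 + h, d) = 0.
    apply: goursat => // x y /andP[? ?] /andP[yl ?].
    apply: cf; [by apply/andP; split; lra|by apply/andP; split => //; lra|].
    by rewrite orbC gt_eqF// (lt_le_trans _ yl)// ltrDl.
  have -> : circulation P Q (a, b, c, d) =
      circulation P Q (x0 - h, x0 + h, y0 - h, y0 + h).
    move: G1 G2 G3 G4; rewrite /circulation.
    rewrite (@segint_split _ (P^~ c) a b (x0 - h)) ?x1//; last exact: iP.
    rewrite (@segint_split _ (P^~ c) (x0 - h) b (x0 + h)) ?hh//; last exact: iP.
    rewrite (@segint_split _ (P^~ d) a b (x0 - h)) ?x1//; last exact: iP.
    rewrite (@segint_split _ (P^~ d) (x0 - h) b (x0 + h)) ?hh//; last exact: iP.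
    rewrite (@segint_split _ (Q (x0 - h)) c d (y0 - h)) ?y1//; last exact: iQ.
    rewrite (@segint_split _ (Q (x0 - h)) (y0 - h) d (y0 + h)) ?hh//; last exact: iQ.
    rewrite (@segint_split _ (Q (x0 + h)) c d (y0 - h)) ?y1//; last exact: iQ.
    rewrite (@segint_split _ (Q (x0 + h)) (y0 - h) d (y0 + h)) ?hh//; last exact: iQ.
    clear; do ![move: (segint _ _ _) => ?]; lra.
  have near (x u v : R) : v <= u -> u <= x + h -> x - h <= v -> `|u - x| < del.
    by move=> *; apply: le_lt_trans hdel; rewrite ler_norml; apply/andP; split; lra.
  have B1 y : `|y - y0| < del -> y != y0 -> c <= y <= d ->
      `|segint (P^~ y) (x0 - h) (x0 + h)| <= M * (h + h).
    move=> ydel ny yy; rewrite (_ : h + h = x0 + h - (x0 - h)); last by ring.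
    apply: segint_bound => //; first by apply: iP.
    by move=> x /andP[xl xr]; apply: (bd _ _ _ ydel _).1; rewrite ?ny ?orbT//; apply: (near _ _ x).
  have B2 x : `|x - x0| < del -> x != x0 -> a <= x <= b ->
      `|segint (Q x) (y0 - h) (y0 + h)| <= M * (h + h).
    move=> xdel nx xx; rewrite (_ : h + h = y0 + h - (y0 - h)); last by ring.
    apply: segint_bound => //; first by apply: iQ.
    by move=> y /andP[yl yr]; apply: (bd _ _ xdel _ _).2; rewrite ?nx//; apply: (near _ _ y).
  have d1' (x : R) : `|x - h - x| < del by rewrite addrAC subrr add0r normrN gtr0_norm.
  have d2' (x : R) : `|x + h - x| < del by rewrite addrAC subrr add0r gtr0_norm.
  have := B1 _ (d1' y0) (n1 y0) y1; have := B1 _ (d2' y0) (n2 y0) y2.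
  have := B2 _ (d1' x0) (n1 x0) x1; have := B2 _ (d2' x0) (n2 x0) x2.
  rewrite /circulation; do 4!move: (segint _ _ _) => ?.
  clear; rewrite !ler_norml => /andP[? ?] /andP[? ?] /andP[? ?] /andP[? ?].
  by apply/andP; split; lra.
apply/eqP; rewrite -normr_le0; apply/ler_addgt0Pr => e e0; rewrite add0r.
pose m := Num.min (Num.min (x0 - a) (b - x0)) (Num.min (y0 - c) (d - y0)).
have m0 : 0 < m by rewrite !lt_min !subr_gt0 ax xb cy yd.
have [[m1 m2] [m3 m4]] : (m <= x0 - a /\ m <= b - x0) /\ (m <= y0 - c /\ m <= d - y0).
  by have := lexx m; rewrite {2}/m !le_min => /andP[/andP[-> ->] /andP[-> ->]].
clearbody m.
have M0 : 0 < 8 * `|M| + 1 by rewrite ltr_wpDl// mulr_ge0.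
pose h := Num.min (Num.min (del / 2) m) (e / (8 * `|M| + 1)).
have h0 : 0 < h by rewrite lt_min divr_gt0// andbT lt_min m0 andbT divr_gt0.
have hd : h <= del / 2 by rewrite /h !ge_min lexx.
have hm : h <= m by rewrite /h !ge_min lexx !orbT.
have he : h <= e / (8 * `|M| + 1) by rewrite /h !ge_min lexx !orbT.
apply: le_trans (small h _ _ _ _ _ _) _ => //; try lra.
move: he; rewrite ler_pdivlMr//; apply: le_trans; rewrite mulrC ler_wpM2l//; first exact: ltW.
by have := ler_norm M; lra.
Qed.

(** * Invariance of Lebesgue measure, and averaging *)

Section LebesgueInvariance.
Context {R : realType}.
Local Open Scope ereal_scope.
Implicit Types (f : R -> \bar R) (c : R).

(** The image of Lebesgue measure under the translation gives every []a, b]] its length, and this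
    determines the measure. *)
Lemma ge0_integral_shift f c : measurable_fun setT f -> (forall x, 0 <= f x) ->
  \int[leb]_x f (x + c)%R = \int[leb]_x f x.
Proof.
move=> mf f0; pose phi (x : measurableTypeR R) : measurableTypeR R := (x + c)%R.
have mphi : measurable_fun setT phi by exact: measurable_funD.
have -> : \int[leb]_x f x = \int[pushforward leb phi]_x f x.
  apply: eq_measure_integral => A mA _.
  apply: lebesgue_measure_unique => //= _ [[a b]] _ <-.
  rewrite /pushforward (_ : phi @^-1` _ = `](a - c)%R, (b - c)%R]%classic).
    rewrite !lebesgue_measure_itv/= !lte_fin ltrD2r -!EFinD.
    by rewrite (_ : b - c - (a - c) = b - a)%R//; ring.
  by apply/seteqP; split => x /=; rewrite !in_itv/= ltrBlDr lerBrDr.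
by rewrite ge0_integral_pushforward.
Qed.

Lemma ge0_integral_opp f : measurable_fun setT f -> (forall x, 0 <= f x) ->
  \int[leb]_x f (- x)%R = \int[leb]_x f x.
Proof.
move=> mf f0; pose phi (x : measurableTypeR R) : measurableTypeR R := (- x)%R.
have mphi : measurable_fun setT phi by exact: oppr_measurable.
have -> : \int[leb]_x f x = \int[pushforward leb phi]_x f x.
  apply: eq_measure_integral => A mA _; exact/esym/lebesgue_measureN.
by rewrite ge0_integral_pushforward.
Qed.

Lemma ge0_integral_reflect (f : R * R -> \bar R) c : measurable_fun setT f ->
  (forall p, 0 <= f p) ->
  \int[leb2]_p f (p.1, (- p.2 + c)%R) = \int[leb2]_p f p.
Proof.
move=> mf f0.
have mf' : measurable_fun setT (fun p : R * R => f (p.1, (- p.2 + c)%R)).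
  apply: (measurableT_comp mf); apply: measurable_fun_pair => /=.
    exact: measurable_fst.
  apply: measurable_funD => //.
  exact: (measurableT_comp (@oppr_measurable R setT) (@measurable_snd _ _ _ _)).
rewrite fubini_tonelli1// [RHS]fubini_tonelli1//.
apply: eq_integral => x _; rewrite /fubini_F /=.
have mfx : measurable_fun setT (fun y => f (x, y)).
  exact: measurable_fun_pair2.
rewrite (ge0_integral_opp (f := fun y => f (x, (y + c)%R)))//.
  by rewrite (ge0_integral_shift (f := fun y => f (x, y))).
by apply: (measurableT_comp mfx); exact: measurable_funD.
Qed.

End LebesgueInvariance.

Section Pigeonhole.
Context {R : realType}.

Lemma pigeonhole (k : R -> \bar R) (a b : R) (M N : \bar R) : a < b -> (0 < N)%E ->
  measurable_fun setT k -> (forall x, 0 <= k x)%E ->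
  (\int[leb]_(x in `[a, b]) k x <= M)%E -> (M < N * (b - a)%:E)%E ->
  exists2 x, a <= x <= b & (k x <= N)%E.
Proof.
move=> ab N0 mk k0 kM MN; apply: contrapT => H.
have kN x : a <= x <= b -> (N <= k x)%E.
  by move=> xx; rewrite leNgt; apply/negP => /ltW kx; apply: H; exists x.
have : (N * (b - a)%:E <= M)%E; last by rewrite leNgt MN.
apply: le_trans kM.
have -> : (N * (b - a)%:E)%E = (\int[leb]_(x in `[a, b]) cst N x)%E.
  by rewrite integral_cst//= lebesgue_measure_itv /= lte_fin ab.
apply: ge0_le_integral => //; [by move=> x _; exact: ltW|exact: measurable_funTS].
Qed.

End Pigeonhole.

(** * Integrals over growing segments and the mass of the Poisson kernel *)

Section ExhaustingSegments.
Context {R : realType}.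

(** The two endpoints are independent, because the upper and lower edges of the rectangles are later
    chosen separately by averaging. *)
Lemma segint_cvgT (g : R -> R) (a b : R^nat) : leb.-integrable setT (EFin \o g) ->
  (forall n, a n <= - n%:R) -> (forall n, n%:R <= b n) ->
  segint g (a n) (b n) @[n --> \oo] --> \int[leb]_x g x.
Proof.
move=> ig an bn; pose f_ n : R -> \bar R := (EFin \o g) \_ `[a n, b n].
have mg : measurable_fun setT (EFin \o g) := measurable_int _ ig.
have [] := @dominated_convergence _ _ _ leb setT measurableT f_ (EFin \o g)
    (abse \o (EFin \o g)).
- move=> n; rewrite /f_; apply/measurable_restrict => //.
  by rewrite setTI; exact: measurable_funS mg.
- exact: mg.
- apply: aeW => x _; apply: (@cvg_near_cst _ _ _ _ _) => /=.
  exists (Num.truncn `|x|).+1 => // n /= xn.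
  rewrite /f_ patchE mem_set//= in_itv/=.
  have {}xn : `|x| <= n%:R.
    by apply: le_trans (ltW (truncnS_gt _)) _; rewrite ler_nat.
  move: xn; rewrite ler_norml => /andP[x1 x2].
  by rewrite (le_trans (an n))// (le_trans x2).
- by apply: integrable_abse.
- apply: aeW => x n _; rewrite /f_ patchE; case: ifP => //.
  by move=> _; rewrite [X in (`|X| <= _)%E](_ : _ = 0%E)// abse0 abse_ge0.
move=> _ _ H; rewrite /Rintegral.
have -> : (fun n => segint g (a n) (b n)) =
    fine \o (fun n => \int[leb]_x f_ n x)%E.
  by apply/funext => n; rewrite /segint /Rintegral/= [in LHS]integral_mkcond.
by apply: fine_cvg; rewrite fineK//; exact: integrable_fin_num.
Qed.

Lemma segint_FTC (F f : R -> R) (a b : R) : a < b ->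
  (forall x, a <= x <= b -> is_derive x 1 F (f x)) ->
  (forall x, a <= x <= b -> {for x, continuous f}) ->
  segint f a b = F b - F a.
Proof.
move=> ab dF cf; rewrite /segint /Rintegral (@continuous_FTC2 _ _ F)//.
- by apply: continuous_in_subspaceT => x; rewrite inE /= in_itv /=; exact: cf.
- have cF x : a <= x <= b -> {for x, continuous F}.
    move=> /dF dFx; apply: differentiable_continuous; apply/derivable1_diffP.
    exact: ex_derive.
  split.
  + move=> x; rewrite in_itv/= => /andP[ax xb].
    by have dFx := dF x ltac:(by rewrite !ltW); exact: ex_derive.
  + by apply: cvg_at_right_filter; apply: cF; rewrite lexx ltW.
  + by apply: cvg_at_left_filter; apply: cF; rewrite lexx ltW.
- move=> x; rewrite in_itv/= => /andP[ax xb].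
  have dFx := dF x ltac:(by rewrite !ltW).
  by rewrite derive1E derive_val.
Qed.

Lemma poisson_gt0 (h t : R) : 0 < h -> 0 < h ^+ 2 + t ^+ 2.
Proof. by move=> h0; rewrite ltr_pwDl ?exprn_gt0 ?sqr_ge0. Qed.

Lemma continuous_poisson (y0 h : R) : 0 < h ->
  continuous (fun y => 2 * h / (h ^+ 2 + (y - y0) ^+ 2)).
Proof.
move=> h0 y; apply: cvgM; first exact: cvg_cst.
apply: cvgV; first by rewrite gt_eqF// poisson_gt0.
apply: cvgD; first exact: cvg_cst.
by apply: cvgM; (apply: cvgB; [exact: cvg_id|exact: cvg_cst]).
Qed.

Lemma segint_poisson (y0 h a b : R) : 0 < h -> a < b ->
  segint (fun y => 2 * h / (h ^+ 2 + (y - y0) ^+ 2)) a b =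
  2 * (atan ((b - y0) / h) - atan ((a - y0) / h)).
Proof.
move=> h0 ab; pose F y := 2 * atan ((y - y0) / h).
transitivity (F b - F a); last by rewrite /F mulrBr.
apply: (@segint_FTC F) => //.
- move=> y _.
  have D1 : is_derive y 1 (fun y => (y - y0) * h^-1) h^-1.
    by apply: is_derive_eq; rewrite /GRing.scale /=; ring.
  have D2 : is_derive y 1 (fun y => atan ((y - y0) * h^-1))
      ((1 + ((y - y0) / h) ^+ 2)^-1 * h^-1).
    exact: (@is_derive1_comp R atan (fun y => (y - y0) * h^-1)).
  rewrite /F; apply: is_derive_eq.
  rewrite /GRing.scale /=; field.
  by rewrite gt_eqF ?poisson_gt0//= gt_eqF.
- by move=> y _; exact: continuous_poisson.
Qed.

Lemma segint_poisson_cvg (y0 h : R) (a b : R^nat) : 0 < h ->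
  (forall n, a n <= - n.+1%:R) -> (forall n, n.+1%:R <= b n) ->
  segint (fun y => 2 * h / (h ^+ 2 + (y - y0) ^+ 2)) (a n) (b n)
    @[n --> \oo] --> 2 * pi.
Proof.
move=> h0 an bn.
have -> : (fun n => segint (fun y => 2 * h / (h ^+ 2 + (y - y0) ^+ 2)) (a n) (b n)) =
    (fun n => 2 * (atan ((b n - y0) / h) + atan ((y0 - a n) / h))).
  apply/funext => n; rewrite segint_poisson//.
    by rewrite -[y0 - _]opprB mulNr atanN.
  apply: lt_le_trans (bn n); apply: le_lt_trans (an n) _.
  by rewrite -subr_gt0 opprK addr_gt0.
have lim (c : R^nat) (k : R) : (forall n, n.+1%:R <= c n) ->
    atan ((c n - k) / h) @[n --> \oo] --> pi / 2.
  move=> cn; apply: ((cvg_pinftyP _ _).1 (@cvgy_atan R)).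
  apply/cvgryPge => A; exists (Num.truncn `|A * h + k|) => // n /= xn.
  rewrite ler_pdivlMr// lerBrDr; apply: le_trans (cn n).
  apply: le_trans (ler_norm _) _; apply: le_trans (ltW (truncnS_gt _)) _.
  by rewrite ler_nat.
rewrite (_ : 2 * pi = 2 * (pi / 2 + pi / 2)); last by rewrite -splitr.
apply: cvgM; first exact: cvg_cst.
apply: cvgD; first exact: lim.
rewrite (_ : (fun n => _) = (fun n => atan ((- a n - - y0) / h))).
  by apply: lim => n; rewrite lerNr.
by apply/funext => n; rewrite opprK addrC.
Qed.

End ExhaustingSegments.

(** * Cauchy's formula on a vertical line *)

Section HolomorphicForms.
Context {R : realType}.
Implicit Types (H f g : R[i] -> R[i]) (z w : R[i]).

(* [Im (H dz) = imf H dx + ref H dy]. *)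
Definition imf H (x y : R) : R := complex.Im (H (x +i* y)%C).
Definition ref H (x y : R) : R := complex.Re (H (x +i* y)%C).

Lemma cdiff_closed_form H (x y : R) d : cdiff H (x +i* y)%C d ->
  closed_form_at (imf H) (ref H) x y.
Proof.
move=> Hd; exists (complex.Im d), (complex.Re d), (- complex.Im d) => e e0.
have [del del0 K] := Hd _ e0; exists (del / 2); first by rewrite divr_gt0.
move=> x' y' x'x y'y; rewrite /imf /ref.
have := K (x' +i* y')%C (@near_complex _ (x +i* y)%C _ del0 (x', y') x'x y'y).
have -> : ((x' +i* y') - (x +i* y))%C = ((x' - x) +i* (y' - y))%C by [].
move=> L; have {}L := le_trans L (ler_wpM2l (ltW e0) (cmod_le_ReIm _)).
split; apply: le_trans L.
  apply: le_trans (normr_Im_le _); rewrite !ImB ImM /=.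
  by rewrite opprD addrA addrAC.
apply: le_trans (normr_Re_le _); rewrite !ReB ReM /=.
by rewrite opprD opprK addrA mulNr opprK.
Qed.

Lemma cdiffM f g z d d' : cdiff f z d -> cdiff g z d' ->
  exists d2, cdiff (fun w => f w * g w) z d2.
Proof.
move=> /cdiff_derivable df /cdiff_derivable dg.
apply: derivable_cdiff; exact (@derivableM R[i] R[i]^o f g z 1 df dg).
Qed.

Lemma cdiffB f g z d d' : cdiff f z d -> cdiff g z d' ->
  exists d2, cdiff (fun w => f w - g w) z d2.
Proof.
move=> /cdiff_derivable df /cdiff_derivable dg.
apply: derivable_cdiff; exact (@derivableB R[i] R[i]^o R[i]^o f g z 1 df dg).
Qed.

Lemma cdiffV f z d : cdiff f z d -> f z != 0 ->
  exists d2, cdiff (fun w => (f w)^-1) z d2.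
Proof.
move=> /cdiff_derivable df fz.
apply: derivable_cdiff; exact (@derivableV R[i] R[i]^o f z 1 fz df).
Qed.

End HolomorphicForms.

Definition cint {R : realType} (F : R -> R[i]) : R[i] :=
  ((\int[leb]_t complex.Re (F t)) +i* (\int[leb]_t complex.Im (F t)))%C.

Section CauchyLine.
Context {R : realType}.
Variables (f : R[i] -> R[i]) (r : R) (z0 : R[i]).
Hypothesis rz0 : r < complex.Re z0.
Hypothesis hol : forall z, r <= complex.Re z -> exists d, cdiff f z d.

Let x0 := complex.Re z0.
Let y0 := complex.Im z0.
Let a := x0 - r.
Let c := conjc z0 - (2 * r)%:C%C.

(* [- c] is the reflection of [z0] in the line Re w = r, so the kernel
   [1 / (z0 - w) + 1 / (w + c)] restricts to the Poisson kernel on this line;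
   subtracting it removes the pole of [f w / (z0 - w)] at [z0]. *)
Definition cauchy_kernel (w : R[i]) : R[i] := (z0 + c) / ((z0 - w) * (w + c)).

Definition cauchy_diff (w : R[i]) : R[i] := f w / (z0 - w) - f z0 * cauchy_kernel w.

Let a0 : 0 < a. Proof. by rewrite subr_gt0. Qed.

Lemma Re_reflect (w : R[i]) : r <= complex.Re w -> a <= complex.Re (w + c).
Proof.
move=> rw; rewrite ReD /c ReB /a /x0.
by case: (z0) => u v /=; lra.
Qed.

Lemma reflect_neq0 (w : R[i]) : r <= complex.Re w -> w + c != 0.
Proof.
by move=> /Re_reflect aw; apply: contraTneq aw => ->; rewrite -ltNge.
Qed.

Lemma cmod_reflect (w : R[i]) : r <= complex.Re w -> a <= cmod (w + c).
Proof.
move=> /Re_reflect aw; apply: le_trans (normr_Re_le _).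
by apply: le_trans aw _; exact: ler_norm.
Qed.

Lemma cauchy_kernel_line (y : R) :
  cauchy_kernel (r +i* y)%C = (2 * a / (a ^+ 2 + (y - y0) ^+ 2))%:C%C.
Proof.
have := poisson_gt0 (y - y0) a0; rewrite lt0r => /andP[n0 _].
rewrite /cauchy_kernel /c /a /x0 /y0.
move: n0; rewrite /a /x0 /y0; case: (z0) => u v /= n0.
apply: (mulIf (_ : ((u +i* v) - (r +i* y)) * ((r +i* y) + ((u -i* v) - (2 * r)%:C)) != 0)%C).
  move: n0; rewrite !eq_complex /=; apply: contraNN => /andP[/eqP e1 _].
  by apply/eqP; move: e1; apply: etrans; ring.
rewrite divfK; last first.
  move: n0; rewrite !eq_complex /=; apply: contraNN => /andP[/eqP e1 _].
  by apply/eqP; move: e1; apply: etrans; ring.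
by apply: complex_ext => /=; field.
Qed.

Lemma cauchy_diff_hol (w : R[i]) : r <= complex.Re w -> w != z0 ->
  exists d, cdiff (cauchy_diff) w d.
Proof.
move=> rw wz.
have [d1 D1] := hol rw.
have L1 : cdiff (fun w => z0 - w) w (-1).
  by rewrite (_ : (fun w => z0 - w) = (fun w => -1 * w + z0)); [exact: cdiff_lin|apply/funext => v; ring].
have L2 : cdiff (fun w => w + c) w 1.
  by rewrite (_ : (fun w => w + c) = (fun w => 1 * w + c)); [exact: cdiff_lin|apply/funext => v; ring].
have L0 (k : R[i]) : cdiff (fun _ => k) w 0.
  by rewrite (_ : (fun _ => k) = (fun w => 0 * w + k)); [exact: cdiff_lin|apply/funext => v; ring].
have nz : z0 - w != 0 by rewrite subr_eq0 eq_sym.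
have [d2 V1] := cdiffV L1 nz.
have [d3 M1] := cdiffM D1 V1.
have [d4 M2] := cdiffM L1 L2.
have [|d5 V2] := cdiffV M2; first by rewrite mulf_neq0// reflect_neq0.
have [d6 M3] := cdiffM (L0 (z0 + c)) V2.
have [d7 M4] := cdiffM (L0 (f z0)) M3.
exact: cdiffB M1 M4.
Qed.

(** The poles at [z0] cancel: there remain a difference quotient of [f] and [f z0 / (w + c)], whose
    pole [- c] is at distance at least [a] from the half-plane [Re w >= r]. *)
Lemma cauchy_diff_bounded : exists M del, 0 < del /\
  forall w, r <= complex.Re w -> w != z0 -> cmod (w - z0) < del ->
    cmod (cauchy_diff w) <= M.
Proof.
have [d D] := hol (ltW rz0); have [del del0 K] := D 1 ltr01.
exists (1 + cmod d + cmod (f z0) / a), del; split => // w rw wz /K {}K.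
have nz : z0 - w != 0 by rewrite subr_eq0 eq_sym.
have nw := reflect_neq0 rw.
have -> : cauchy_diff w = - ((f w - f z0 - d * (w - z0)) / (w - z0)) - d - f z0 / (w + c).
  rewrite /cauchy_diff /cauchy_kernel; field.
  by rewrite nw nz andbT subr_eq0.
apply: le_trans (cmodD _ _) _; rewrite cmodN.
apply: lerD.
  apply: le_trans (cmodD _ _) _; rewrite !cmodN lerD2r.
  by rewrite cmodM cmodV ler_pdivrMr// cmod_gt0 -opprB oppr_eq0.
rewrite cmodM cmodV ler_wpM2l ?cmod_ge0// lef_pV2 ?posrE//; first exact: cmod_reflect.
by apply: lt_le_trans (cmod_reflect rw).
Qed.

Lemma cauchy_circulation (X Y Y' : R) : x0 < X -> - Y' < y0 < Y ->
  circulation (imf cauchy_diff) (ref cauchy_diff) (r, X, - Y', Y) = 0.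
Proof.
move=> xX yY; have [M [del [del0 K]]] := cauchy_diff_bounded.
have z0E : z0 = (x0 +i* y0)%C by case: (z0) @x0 @y0.
have neq x y : (x != x0) || (y != y0) -> (x +i* y)%C != z0.
  by rewrite z0E eq_complex /= negb_and.
apply: (@circulation_removable _ _ _ _ _ _ _ x0 y0 M (Num.min (del / 2) a)) => //.
- by rewrite rz0.
- by rewrite lt_min divr_gt0.
- move=> x y /andP[rx _] _ /neq xy.
  by have [d D] := @cauchy_diff_hol (x +i* y)%C rx xy; exact: (cdiff_closed_form D).
- move=> x y; rewrite !lt_min => /andP[xd xa] /andP[yd _] /neq xy.
  have rx : r <= complex.Re (x +i* y)%C.
    by move: xa; rewrite /= /a ltr_norml => /andP[? ?]; lra.
  have := K _ rx xy (@near_complex _ z0 _ del0 (x, y) xd yd).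
  by move=> HM; split; apply: le_trans HM; [exact: normr_Im_le|exact: normr_Re_le].
Qed.

End CauchyLine.

(** The arithmetic of [left_edge_cvg], with [v] for [1 / N] and [s4] for the left edge: [6 = 3 * 2]
    and [40 = 2 * 12 + 16]. *)
Lemma four_edges_bound {R : realType} (s1 s2 s3 s4 v K A1 A2 : R) :
  A1 <= 3 * (4 * K * v) -> A2 <= 4 * (4 * K * v) -> s1 - s2 + (s3 - s4) = 0 ->
  `|s2| <= 2 * v + A1 -> `|s1| <= 2 * v + A1 -> `|s3| <= 2 * v + A2 ->
  `|s4| <= (6 + 40 * K) * v.
Proof.
rewrite !ler_norml => ? ? ? /andP[? ?] /andP[? ?] /andP[? ?].
by apply/andP; split; lra.
Qed.

Section CauchyLineFormula.
Context {R : realType}.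
Variables (f : R[i] -> R[i]) (r : R) (z0 : R[i]).
Hypothesis rz0 : r < complex.Re z0.
Hypothesis hol : forall z, r <= complex.Re z -> exists d, cdiff f z d.
Hypothesis area : (\int[leb2]_(p in rhp2 r) (cmod (f (p.1 +i* p.2)%C))%:E < +oo)%E.
Hypothesis line : leb.-integrable setT (fun y => (cmod (f (r +i* y)%C))%:E).

Let x0 := complex.Re z0.
Let y0 := complex.Im z0.
Let a := x0 - r.
Let c := conjc z0 - (2 * r)%:C%C.
Let H := cauchy_diff f r z0.
Let K0 := cmod (f z0) * cmod (z0 + c).
Let a0 : 0 < a. Proof. by rewrite subr_gt0. Qed.

Lemma cauchy_diff_le (w : R[i]) (m : R) : 0 < m -> m <= cmod (z0 - w) ->
  m <= cmod (w + c) -> cmod (H w) <= cmod (f w) / m + K0 / m ^+ 2.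
Proof.
move=> m0 m1 m2; rewrite /H /cauchy_diff /cauchy_kernel -/c.
have p1 : 0 < cmod (z0 - w) by exact: lt_le_trans m1.
have p2 : 0 < cmod (w + c) by exact: lt_le_trans m2.
apply: le_trans (cmodD _ _) _; rewrite cmodN !cmodM !cmodV cmodM.
apply: lerD; first by rewrite ler_wpM2l ?cmod_ge0// lef_pV2.
rewrite /K0 -mulrA ler_wpM2l ?cmod_ge0// ler_wpM2l ?cmod_ge0//.
by rewrite lef_pV2 ?posrE ?mulr_gt0 ?exprn_gt0// expr2 ler_pM// ltW.
Qed.

Let F (p : R * R) : \bar R :=
  ((fun p => (cmod (f (p.1 +i* p.2)%C))%:E) \_ (rhp2 r)) p.

Let F_ge0 p : (0 <= F p)%E.
Proof. by rewrite /F patchE; case: ifP => // _; rewrite lee_fin cmod_ge0. Qed.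

Let cf (w : R[i]) : r <= complex.Re w -> ccont f w.
Proof. by move=> /hol[d]; exact: cdiff_ccont. Qed.

Let mF : measurable_fun setT F.
Proof.
apply/(measurable_restrict _ (measurable_rhp2 r) measurableT).
rewrite setTI; apply/measurable_EFinP; apply: measurable_cmod => w rw.
by apply: cf; exact: ltW.
Qed.

Let k1 y := (\int[leb]_x F (x, y))%E.
Let k2 x := (\int[leb]_y F (x, y))%E.
Let I := (\int[leb2]_p F p)%E.

Let I_lty : (I < +oo)%E.
Proof. by move: area; rewrite integral_mkcond. Qed.

Let I_ge0 : (0 <= I)%E. Proof. exact: integral_ge0. Qed.

Let I_fin : I \is a fin_num. Proof. by rewrite ge0_fin_numE. Qed.

Let k1_ge0 y : (0 <= k1 y)%E. Proof. exact: integral_ge0. Qed.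
Let k2_ge0 x : (0 <= k2 x)%E. Proof. exact: integral_ge0. Qed.

Let mk1 : measurable_fun setT k1.
Proof. exact: measurable_fun_fubini_tonelli_G. Qed.

Let mk2 : measurable_fun setT k2.
Proof. exact: measurable_fun_fubini_tonelli_F. Qed.

(** Finite area gives no pointwise decay of [f], so horizontal edges are placed at heights where
    [|f|] has integral at most 1; any interval longer than the area integral contains one. *)
Lemma pigeonhole1 (s t : R) : (I < (t - s)%:E)%E -> s < t ->
  exists2 y, s <= y <= t & (k1 y <= 1)%E.
Proof.
move=> It st; apply: (@pigeonhole _ _ _ _ I) => //; last by rewrite mul1e.
apply: (@le_trans _ _ (\int[leb]_y k1 y)%E).
  by apply: ge0_subset_integral => //; exact: measurable_funTS.
by rewrite /k1 /I fubini_tonelli2.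
Qed.

Lemma pigeonhole2 (s t : R) : (I < (t - s)%:E)%E -> s < t ->
  exists2 y, s <= y <= t & (k2 y <= 1)%E.
Proof.
move=> It st; apply: (@pigeonhole _ _ _ _ I) => //; last by rewrite mul1e.
apply: (@le_trans _ _ (\int[leb]_x k2 x)%E).
  by apply: ge0_subset_integral => //; exact: measurable_funTS.
by rewrite /k2 /I fubini_tonelli1.
Qed.

Lemma segint_le_fin (g : R -> R) (s t : R) (B : R) :
  leb.-integrable `[s, t] (EFin \o g) ->
  (\int[leb]_(x in `[s, t]) (g x)%:E <= B%:E)%E -> segint g s t <= B.
Proof.
move=> ig gB; rewrite -lee_fin /segint /Rintegral fineK//.
exact: integrable_fin_num.
Qed.

Lemma segint_le_abs (g h : R -> R) (s t : R) :
  leb.-integrable `[s, t] (EFin \o g) -> leb.-integrable `[s, t] (EFin \o h) ->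
  (forall x, s <= x <= t -> `|g x| <= h x) -> `|segint g s t| <= segint h s t.
Proof.
move=> ig ih gh; apply: le_trans (le_normr_Rintegral _ ig) _ => //.
apply: le_Rintegral => //; first exact: integrable_norm.
Qed.

Lemma cmod_cont1 (g : R -> R[i]) (x : R) :
  (forall e : R, 0 < e -> exists2 del : R, 0 < del &
    forall y, `|y - x| < del -> cmod (g y - g x) < e) ->
  cont1 (fun y => cmod (g y)) x.
Proof.
move=> H0 e /H0[del del0 H1]; exists del => // y /H1; apply: le_lt_trans.
rewrite ler_norml; apply/andP; split.
  by have := cmodD (g x - g y) (g y); rewrite subrK cmodB; lra.
by have := cmodD (g y - g x) (g x); rewrite subrK; lra.
Qed.

Lemma ccont_hline (g : R[i] -> R[i]) (x y : R) : ccont g (x +i* y)%C ->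
  [/\ cont1 (fun x => cmod (g (x +i* y)%C)) x,
      cont1 (fun x => complex.Re (g (x +i* y)%C)) x &
      cont1 (fun x => complex.Im (g (x +i* y)%C)) x].
Proof.
move=> cg; have D (u : R) : cmod ((u +i* y)%C - (x +i* y)%C) = `|u - x|.
  by rewrite -cmod_real; congr cmod; apply: complex_ext => //=; rewrite subrr.
split.
- apply: cmod_cont1 => e /cg[del del0 K]; exists del => // u ux.
  by apply: K; rewrite D.
- by move=> e /(ccont_Re cg)[del del0 K]; exists del => // u ux; apply: K; rewrite D.
- by move=> e /(ccont_Im cg)[del del0 K]; exists del => // u ux; apply: K; rewrite D.
Qed.

Lemma ccont_vline (g : R[i] -> R[i]) (x y : R) : ccont g (x +i* y)%C ->
  [/\ cont1 (fun y => cmod (g (x +i* y)%C)) y,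
      cont1 (fun y => complex.Re (g (x +i* y)%C)) y &
      cont1 (fun y => complex.Im (g (x +i* y)%C)) y].
Proof.
move=> cg; have D (u : R) : cmod ((x +i* u)%C - (x +i* y)%C) = `|u - y|.
  have -> : ((x +i* u)%C - (x +i* y)%C) = ('i * (u - y)%:C)%C.
    by apply: complex_ext => /=; ring.
  by rewrite cmodM cmod_real /cmod /= expr0n add0r expr1n sqrtr1 mul1r.
split.
- apply: cmod_cont1 => e /cg[del del0 K]; exists del => // u ux.
  by apply: K; rewrite D.
- by move=> e /(ccont_Re cg)[del del0 K]; exists del => // u ux; apply: K; rewrite D.
- by move=> e /(ccont_Im cg)[del del0 K]; exists del => // u ux; apply: K; rewrite D.
Qed.

Let cH (w : R[i]) : r <= complex.Re w -> w != z0 -> ccont H w.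
Proof. by move=> rw wz; have [d D] := cauchy_diff_hol rz0 hol rw wz; exact: (cdiff_ccont D). Qed.

Lemma segint_affine_bound (g u : R -> R) (s t A B : R) : s <= t -> 0 <= A ->
  leb.-integrable `[s, t] (EFin \o g) -> leb.-integrable `[s, t] (EFin \o u) ->
  (forall x, s <= x <= t -> `|g x| <= u x * A + B) -> segint u s t <= 1 ->
  `|segint g s t| <= A + B * (t - s).
Proof.
move=> st A0 ig iu gu u1.
have iA : leb.-integrable `[s, t] (EFin \o (fun x => u x * A)).
  by have := @integrableZr _ _ _ leb `[s, t] (measurable_itv _) A _ iu.
have iB : leb.-integrable `[s, t] (EFin \o (fun=> B)).
  by apply: seg_integrable => x _ e e0; exists 1 => // y _; rewrite subrr normr0.
have iAB : leb.-integrable `[s, t] (EFin \o (fun x => u x * A + B)).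
  by have := @integrableD _ _ _ leb `[s, t] (measurable_itv _) _ _ iA iB.
apply: le_trans (segint_le_abs ig iAB gu) _.
rewrite /segint RintegralD// RintegralZr//; apply: lerD.
  by rewrite -[leRHS]mul1r ler_wpM2r.
have := @segint_approx _ (fun=> B) s t B 0 st iB.
have {}K x : s <= x <= t -> `|B - B| <= 0 by rewrite subrr normr0.
by move=> /(_ K); rewrite mul0r normr_le0 subr_eq0 /segint => /eqP ->.
Qed.

Lemma top_edge (X y m : R) : r < X -> 0 < m -> m <= `|y - y0| ->
  (k1 y <= 1)%E -> `|segint ((imf H)^~ y) r X| <= m^-1 + K0 / m ^+ 2 * (X - r).
Proof.
move=> rX m0 my ky.
have yz (x : R) : (x +i* y)%C != z0.
  apply: contraTneq my => E; rewrite /y0 -E /= subrr normr0 -ltNge//.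
have i1 : leb.-integrable `[r, X] (EFin \o (fun x => cmod (f (x +i* y)%C))).
  apply: seg_integrable => x /andP[rx _].
  by have [] := @ccont_hline f x y (cf (w := (x +i* y)%C) rx).
have i2 : leb.-integrable `[r, X] (EFin \o (imf H)^~ y).
  apply: seg_integrable => x /andP[rx _].
  by have [] := @ccont_hline H x y (@cH (x +i* y)%C rx (yz x)).
apply: (segint_affine_bound (ltW rX) _ i2 i1); first by rewrite invr_ge0 ltW.
  move=> x /andP[rx _]; apply: le_trans (normr_Im_le _) _.
  (* Both poles [z0] and [- c] have imaginary part [y0], so [|y - y0|] bounds the distance to either
     from below. *)
  apply: cauchy_diff_le => //.
    apply: le_trans (normr_Im_le _); rewrite ImB /= distrC.
    by move: my; rewrite /y0.
  apply: le_trans (normr_Im_le _); rewrite /c ImD ImB /=.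
  by move: my; rewrite /y0; case: (z0) => u v /=; rewrite subr0.
apply: segint_le_fin => //; apply: le_trans ky.
rewrite /k1 -integral_itv_obnd_cbnd; last first.
  by apply: measurable_funS (measurable_int _ i1) => //; apply: subset_itvr; rewrite bnd_simp.
rewrite integral_mkcond; apply: ge0_le_integral => //.
- by move=> x _; rewrite patchE; case: ifP => // _; rewrite lee_fin cmod_ge0.
- apply/(measurable_restrict _ (measurable_itv _) measurableT); rewrite setTI.
  by apply: measurable_funS (measurable_int _ i1) => //; apply: subset_itvr; rewrite bnd_simp.
- exact: measurableT_comp.
- move=> x _; rewrite /F !patchE; case: ifPn; last by move=> _; exact: F_ge0.
  rewrite inE /= in_itv /= => /andP[rx _].
  by rewrite (mem_set (_ : rhp2 r (x, y)))//.
Qed.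

Lemma right_edge (X m Y Y' : R) : - Y' <= Y -> 0 < m -> m <= X - x0 ->
  (k2 X <= 1)%E -> `|segint (ref H X) (- Y') Y| <= m^-1 + K0 / m ^+ 2 * (Y + Y').
Proof.
move=> YY m0 mX kX; rewrite (_ : Y + Y' = Y - - Y'); last by rewrite opprK.
have rX : r < X by move: mX m0 rz0; rewrite /x0; lra.
have Xz (y : R) : (X +i* y)%C != z0.
  by apply: contraTneq mX => E; rewrite /x0 -E /= subrr -ltNge.
have i1 : leb.-integrable `[- Y', Y] (EFin \o (fun y => cmod (f (X +i* y)%C))).
  apply: seg_integrable => y _.
  by have [] := @ccont_vline f X y (cf (w := (X +i* y)%C) (ltW rX)).
have i2 : leb.-integrable `[- Y', Y] (EFin \o ref H X).
  apply: seg_integrable => y _.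
  by have [] := @ccont_vline H X y (@cH (X +i* y)%C (ltW rX) (Xz y)).
apply: (segint_affine_bound YY _ i2 i1); first by rewrite invr_ge0 ltW.
  move=> y _; apply: le_trans (normr_Re_le _) _.
  apply: cauchy_diff_le => //.
    rewrite cmodB; apply: le_trans (normr_Re_le _); rewrite ReB /=.
    by apply: le_trans mX _; exact: ler_norm.
  apply: le_trans (normr_Re_le _); rewrite /c ReD ReB /=.
  apply: le_trans (ler_norm _); move: mX m0 rz0; rewrite /x0.
  by case: (z0) => u v /=; lra.
apply: segint_le_fin => //; apply: le_trans kX.
rewrite /k2 integral_mkcond; apply: ge0_le_integral => //.
- by move=> y _; rewrite patchE; case: ifP => // _; rewrite lee_fin cmod_ge0.
- apply/(measurable_restrict _ (measurable_itv _) measurableT); rewrite setTI.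
  exact: measurable_int i1.
- exact: measurableT_comp.
- move=> y _; rewrite /F !patchE; case: ifPn; last by move=> _; exact: F_ge0.
  by rewrite (mem_set (_ : rhp2 r (X, y))).
Qed.

(** With the other three edges at distance of order [N], the term in [f] is an integral at most 1
    divided by [m = N / 2], and the kernel term is [K0 / m ^ 2] times a length of order [N]. These
    edges are thus [O(1 / N)], and the vanishing circulation passes the bound on to the left
    edge. *)
Lemma left_edge_cvg : exists Y Y' : R^nat, exists D : R,
  [/\ (forall n, n.+1%:R <= Y n), (forall n, n.+1%:R <= Y' n) &
  forall n, `|segint (ref H r) (- Y' n) (Y n)| <= D / n.+1%:R].
Proof.
(* For [N > 2 * B], an interval of length [N] is longer than the area integral, and coordinates of
   size at least [N] are at distance at least [N / 2] from those of [z0]. *)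
pose B := `|x0| + `|y0| + `|r| + fine I.
have [n0 n0E] : exists n0 : nat, 2 * B < n0%:R.
  by exists (Num.truncn (2 * B)).+1; exact: truncnS_gt.
have P n : exists YY : R * R, [/\ n.+1%:R <= YY.1, n.+1%:R <= YY.2 &
    `|segint (ref H r) (- YY.2) YY.1| <= (6 + 40 * K0) / n.+1%:R].
  pose N : R := (n0 + n.+1)%:R.
  have I0 : 0 <= fine I by rewrite fine_ge0.
  have nN : n.+1%:R <= N by rewrite ler_nat leq_addl.
  have n1 : 0 < n.+1%:R :> R by [].
  have NB : 2 * B < N by apply: lt_le_trans n0E _; rewrite ler_nat leq_addr.
  have N0 : 0 < N by exact: lt_le_trans nN.
  clearbody N.
  have B1 : 2 * (`|x0| + `|y0| + `|r| + fine I) < N by [].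
  have IN (s t : R) : t - s = N -> (I < (t - s)%:E)%E.
    move=> ->; rewrite -(fineK I_fin) lte_fin.
    have := normr_ge0 x0; have := normr_ge0 y0; have := normr_ge0 r; lra.
  have [X /andP[X1 X2] kX] := pigeonhole2 (IN N (2 * N) ltac:(lra)) ltac:(lra).
  have [Y /andP[Y1 Y2] kY] := pigeonhole1 (IN N (2 * N) ltac:(lra)) ltac:(lra).
  have [Y' /andP[Y'1 Y'2] kY'] := pigeonhole1 (IN (- (2 * N)) (- N) ltac:(lra)) ltac:(lra).
  exists (Y, - Y') => /=; split; [lra|lra|].
  have := ler_norm x0; have := ler_norm y0; have := ler_norm r.
  have := ler_norm (- y0); have := ler_norm (- r); rewrite !normrN => r1 y1 r2 y2 x1.
  have nx := normr_ge0 x0; have ny := normr_ge0 y0; have nr := normr_ge0 r.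
  pose m := N / 2.
  have m0 : 0 < m by rewrite divr_gt0.
  have mN : m = N / 2 by [].
  clearbody m.
  have rX : r < X by lra.
  have T1 := @top_edge X Y m rX m0 ltac:(by apply: le_trans (ler_norm _); lra) kY.
  have T2 := @top_edge X Y' m rX m0 ltac:(by rewrite distrC; apply: le_trans (ler_norm _); lra) kY'.
  have T3 := @right_edge X m Y (- Y') ltac:(lra) m0 ltac:(lra) kX.
  have C0 := @cauchy_circulation _ f r z0 rz0 hol X Y (- Y') ltac:(rewrite -/x0; lra)
     ltac:(rewrite -/y0 opprK; apply/andP; split; lra).
  have K00 : 0 <= K0 by rewrite mulr_ge0 ?cmod_ge0.
  have mV : m^-1 = 2 * N^-1 by rewrite mN invf_div.
  have E (t k : R) : t <= k * N -> K0 / m ^+ 2 * t <= k * (4 * K0 * N^-1).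
    move=> tk; apply: (@le_trans _ _ (K0 / m ^+ 2 * (k * N))).
      by rewrite ler_wpM2l// divr_ge0// sqr_ge0.
    by rewrite mN le_eqVlt; apply/orP; left; apply/eqP; field; rewrite gt_eqF.
  have E1 := E (X - r) 3 ltac:(lra).
  have E2 := E (Y + - Y') 4 ltac:(lra).
  apply: (@le_trans _ _ ((6 + 40 * K0) * N^-1)); last first.
    apply: ler_wpM2l; first by rewrite addr_ge0// mulr_ge0.
    by rewrite lef_pV2 ?posrE.
  move: C0 T1 T2 T3; rewrite /circulation -/H mV !opprK.
  set s1 := segint ((imf H)^~ Y') _ _; set s2 := segint ((imf H)^~ Y) _ _.
  set s3 := segint (ref H X) _ _; set s4 := segint (ref H r) _ _.
  clearbody s1 s2 s3 s4; move: E1 E2.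
  exact: four_edges_bound.
have [YY HY] := choice P; exists (fun n => (YY n).1), (fun n => (YY n).2), (6 + 40 * K0).
by split => n; have [] := HY n.
Qed.

Let g (y : R) : R := complex.Re (f (r +i* y)%C / (z0 - (r +i* y)%C)).

Lemma zline_neq (y : R) : (r +i* y)%C != z0.
Proof. by apply: contraTneq rz0 => <- /=; rewrite ltxx. Qed.

Lemma ref_lineE (y : R) :
  g y = ref H r y + complex.Re (f z0) * (2 * a / (a ^+ 2 + (y - y0) ^+ 2)).
Proof.
rewrite /ref /H /cauchy_diff cauchy_kernel_line// ReB -/(g y) ReM /=.
by rewrite mulr0 subr0 subrK.
Qed.

Lemma ref_cont1 (y : R) : cont1 (ref H r) y.
Proof. by have [] := @ccont_vline H r y (@cH (r +i* y)%C (lexx _) (zline_neq y)). Qed.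

Lemma poisson_cont1 (y : R) : cont1 (fun y => 2 * a / (a ^+ 2 + (y - y0) ^+ 2)) y.
Proof. by apply/cont1P; exact: continuous_poisson. Qed.

Lemma g_continuous : continuous g.
Proof.
move=> y; rewrite (_ : g = fun y => ref H r y + complex.Re (f z0) * (2 * a / (a ^+ 2 + (y - y0) ^+ 2))); last exact/funext/ref_lineE.
apply: cvgD; first by apply/cont1P; exact: ref_cont1.
by apply: cvgM; [exact: cvg_cst|exact: continuous_poisson].
Qed.

Lemma g_integrable : leb.-integrable setT (EFin \o g).
Proof.
have il := @integrableZr _ _ _ leb setT measurableT a^-1 _ line.
apply: (le_integrable _ _ _ il) => //.
  by apply/measurable_EFinP; exact: continuous_measurable_fun g_continuous.
move=> y _ /=; rewrite lee_fin; apply: le_trans (normr_Re_le _) _.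
rewrite cmodM cmodV ger0_norm ?mulr_ge0 ?cmod_ge0 ?invr_ge0 ?(ltW a0)//.
rewrite ler_wpM2l ?cmod_ge0// lef_pV2 ?posrE//.
  by apply: le_trans (normr_Re_le _); rewrite ReB /=; exact: ler_norm.
by rewrite cmod_gt0 subr_eq0 eq_sym zline_neq.
Qed.

(** On the line, [g] is [ref H r] plus [Re (f z0)] times the Poisson kernel. Over the segments of
    [left_edge_cvg] the first part tends to 0 and the kernel to its total mass [2 * pi]. *)
Lemma cauchy_line_Re :
  \int[leb]_y complex.Re (f (r +i* y)%C / (z0 - (r +i* y)%C)) =
  2 * pi * complex.Re (f z0).
Proof.
have [Y [Y' [D [hY hY' hD]]]] := left_edge_cvg.
have hnY n : - Y' n <= - n.+1%:R by rewrite lerN2.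
have L1 : segint g (- Y' n) (Y n) @[n --> \oo] --> \int[leb]_y g y.
  apply: segint_cvgT; first exact: g_integrable.
    by move=> n; apply: le_trans (hnY n) _; rewrite lerN2 ler_nat.
  by move=> n; apply: le_trans (hY n); rewrite ler_nat.
have L2 := @segint_poisson_cvg _ y0 a _ _ a0 hnY hY.
have L3 : segint (ref H r) (- Y' n) (Y n) @[n --> \oo] --> 0.
  apply/cvgr0Pnorm_le => e e0; exists (Num.truncn (D / e)) => // n /= ne.
  apply: le_trans (hD n) _; rewrite ler_pdivrMr// mulrC -ler_pdivrMr//.
  by apply: le_trans (ltW (truncnS_gt _)) _; rewrite ler_nat.
have E n : segint g (- Y' n) (Y n) = segint (ref H r) (- Y' n) (Y n) +
    complex.Re (f z0) * segint (fun y => 2 * a / (a ^+ 2 + (y - y0) ^+ 2)) (- Y' n) (Y n).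
  have i1 : leb.-integrable `[- Y' n, Y n] (EFin \o ref H r).
    by apply: seg_integrable => y _; exact: ref_cont1.
  have i2 : leb.-integrable `[- Y' n, Y n] (EFin \o (fun y => 2 * a / (a ^+ 2 + (y - y0) ^+ 2))).
    by apply: seg_integrable => y _; exact: poisson_cont1.
  have i3 : leb.-integrable `[- Y' n, Y n] (EFin \o (fun y => complex.Re (f z0) * (2 * a / (a ^+ 2 + (y - y0) ^+ 2)))).
    by have := @integrableZl _ _ _ leb `[- Y' n, Y n] (measurable_itv _) (complex.Re (f z0)) _ i2.
  rewrite /segint -RintegralZl// -RintegralD//.
  by apply: eq_Rintegral => y _; exact: ref_lineE.
have L4 : segint g (- Y' n) (Y n) @[n --> \oo] --> 0 + complex.Re (f z0) * (2 * pi).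
  rewrite (_ : (fun n => _) = (fun n => segint (ref H r) (- Y' n) (Y n) +
    complex.Re (f z0) * segint (fun y => 2 * a / (a ^+ 2 + (y - y0) ^+ 2)) (- Y' n) (Y n))); last exact/funext.
  by apply: cvgD => //; apply: cvgM => //; exact: cvg_cst.
have := cvg_unique _ L1 L4 => /(_ (@Rhausdorff R)) ->.
by rewrite add0r mulrC.
Qed.

End CauchyLineFormula.

Lemma cauchy_line {R : realType} (f : R[i] -> R[i]) (r : R) (z0 : R[i]) :
  r < complex.Re z0 ->
  (forall z, r <= complex.Re z -> exists d, cdiff f z d) ->
  (\int[leb2]_(p in rhp2 r) (cmod (f (p.1 +i* p.2)%C))%:E < +oo)%E ->
  leb.-integrable setT (fun y => (cmod (f (r +i* y)%C))%:E) ->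
  cint (fun y => f (r +i* y)%C / (z0 - (r +i* y)%C)) = (2 * pi)%:C%C * f z0.
Proof.
move=> rz0 hol area line; apply: complex_ext.
  by rewrite /cint /= cauchy_line_Re// ReM /= mul0r subr0.
(* The imaginary part of [f] is the real part of [- i f], to which the real formula applies
   again. *)
pose f' w := - 'i%C * f w.
have cf' w : cmod (f' w) = cmod (f w).
  by rewrite cmodM cmodN /cmod /= expr0n add0r expr1n sqrtr1 mul1r.
rewrite /cint /= ImM /= mul0r addr0.
have ReE w : complex.Re (- 'i%C * w) = complex.Im w :> R.
  by case: w => u v /=; ring.
rewrite -(ReE (f z0)) -[- 'i%C * f z0]/(f' z0) -(@cauchy_line_Re _ f' r z0) //.
- by congr Rintegral; apply/funext => y; rewrite /f' -mulrA ReE.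
- move=> z rz; have [d D] := hol z rz; apply: (cdiffM _ D).
  by rewrite (_ : (fun _ => _) = (fun w => 0 * w + - 'i%C)); [exact: cdiff_lin|apply/funext => v; ring].
- by under eq_integral do rewrite cf'.
- by rewrite (_ : (fun _ => _) = (fun y => (cmod (f (r +i* y)%C))%:E))//; apply/funext => y; rewrite cf'.
Qed.

(** * The Bergman norm *)

Definition hcont {R : realType} (F : R[i] -> R[i]) :=
  forall z, 0 < complex.Re z -> ccont F z.

Definition nsq {R : realType} (alpha : R) (F : R[i] -> R[i]) : \bar R :=
  (\int[leb2]_(p in rhp2 0)
    (cmod (F (p.1 +i* p.2)%C) ^+ 2 * p.1 `^ alpha)%:E)%E.

Section BergmanNorm.
Context {R : realType}.
Variable alpha : R.
Implicit Types (F G : R[i] -> R[i]).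

Lemma nsq_ge0 F : (0 <= nsq alpha F)%E.
Proof.
by apply: integral_ge0 => p _; rewrite lee_fin mulr_ge0 ?powR_ge0// sqr_ge0.
Qed.

Lemma bergman_normE F : bergman_norm alpha F = (nsq alpha F `^ 2^-1)%E.
Proof. by []. Qed.

Lemma bergman_norm_lty F : (bergman_norm alpha F < +oo)%E <-> (nsq alpha F < +oo)%E.
Proof.
rewrite bergman_normE; split; last exact: poweR_lty.
by apply: lty_poweRy; rewrite invr_eq0.
Qed.

Lemma bergman_norm_lt F (e : R) : 0 < e ->
  (bergman_norm alpha F < e%:E)%E <-> (nsq alpha F < (e ^+ 2)%:E)%E.
Proof.
move=> e0; rewrite bergman_normE; have := nsq_ge0 F.
case: (nsq alpha F) => [v||] //.
- rewrite lee_fin => v0; rewrite poweR_EFin !lte_fin powR12_sqrt//.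
  by rewrite -[X in _ < X](@ger0_norm _ e) ?(ltW e0)// -sqrtr_sqr ltr_sqrt ?exprn_gt0.
- by move=> _; rewrite poweRyr ?invr_eq0// !ltNge !leey.
Qed.

Lemma measurable_nsq F : hcont F -> measurable_fun (rhp2 0)
  (fun p : R * R => (cmod (F (p.1 +i* p.2)%C) ^+ 2 * p.1 `^ alpha)%:E).
Proof.
move=> cF; apply/measurable_EFinP; apply: measurable_funM; first exact: measurable_cmod2.
have := @measurable_powR_fst R 0 alpha (rhp2 0).
by apply: eq_measurable_fun => p _; rewrite addr0.
Qed.

Lemma le_nsq F G : hcont F -> hcont G ->
  (forall z, 0 < complex.Re z -> cmod (F z) <= cmod (G z)) ->
  (nsq alpha F <= nsq alpha G)%E.
Proof.
move=> cF cG FG; apply: ge0_le_integral.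
- exact: measurable_rhp2.
- by move=> p _; rewrite lee_fin mulr_ge0 ?powR_ge0// sqr_ge0.
- exact: measurable_nsq.
- exact: measurable_nsq.
- move=> p p0; rewrite lee_fin ler_wpM2r ?powR_ge0// ler_pXn2r ?nnegrE ?cmod_ge0//.
  exact: FG.
Qed.

Lemma eq_nsq F G : (forall z, 0 < complex.Re z -> F z = G z) ->
  nsq alpha F = nsq alpha G.
Proof.
by move=> FG; apply: eq_integral => p; rewrite inE => p0; rewrite FG.
Qed.

Lemma holomorphic_hcont F : holomorphic_on (@right_half_plane R) F -> hcont F.
Proof. by move=> hF z z0; apply: derivable_ccont; exact: hF. Qed.

Lemma hcontD F G : hcont F -> hcont G -> hcont (fun z => F z + G z).
Proof.
move=> cF cG z z0 e e0; have e20 : 0 < e / 2 by rewrite divr_gt0.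
have [d1 d10 H1] := cF z z0 _ e20; have [d2 d20 H2] := cG z z0 _ e20.
exists (Num.min d1 d2); first by rewrite lt_min d10.
move=> w; rewrite lt_min => /andP[/H1 {}H1 /H2 {}H2].
rewrite (_ : _ - _ = (F w - F z) + (G w - G z)); last by ring.
by apply: le_lt_trans (cmodD _ _) _; rewrite (splitr e) ltrD.
Qed.

Lemma hcontN F : hcont F -> hcont (fun z => - F z).
Proof.
move=> cF z z0 e e0; have [d1 d10 H1] := cF z z0 _ e0.
by exists d1 => // w /H1; rewrite -opprD cmodN.
Qed.

Lemma hcontB F G : hcont F -> hcont G -> hcont (fun z => F z - G z).
Proof. by move=> cF cG; apply: hcontD => //; exact: hcontN. Qed.

(** For squared norms this replaces the triangle inequality; it accounts for the tolerances [e / 4]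
    in [nsqD_lt]. *)
Lemma nsqD F G : hcont F -> hcont G ->
  (nsq alpha (fun z => F z + G z)%R <= 2%:E * nsq alpha F + 2%:E * nsq alpha G)%E.
Proof.
move=> cF cG.
have nn (H : R[i] -> R[i]) (p : R * R) : rhp2 0 p ->
    (0 <= (cmod (H (p.1 +i* p.2)%C) ^+ 2 * p.1 `^ alpha)%:E)%E.
  by move=> _; rewrite lee_fin mulr_ge0 ?powR_ge0// sqr_ge0.
have mD := measurable_rhp2 (0 : R).
have [mF mG] := (measurable_nsq cF, measurable_nsq cG).
have m2 H : hcont H -> measurable_fun (rhp2 0)
    (fun p : R * R => 2%:E * (cmod (H (p.1 +i* p.2)%C) ^+ 2 * p.1 `^ alpha)%:E)%E.
  by move=> cH; apply: measurable_funeM; exact: measurable_nsq.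
have n2 H (p : R * R) : rhp2 0 p ->
    (0 <= 2%:E * (cmod (H (p.1 +i* p.2)%C) ^+ 2 * p.1 `^ alpha)%:E)%E.
  by move=> /(nn H); exact: mule_ge0.
rewrite /nsq -(ge0_integralZl_EFin leb2 mD (nn F) mF (ler0n _ 2)).
rewrite -(ge0_integralZl_EFin leb2 mD (nn G) mG (ler0n _ 2)).
rewrite -(ge0_integralD leb2 mD (n2 F) (m2 _ cF) (n2 G) (m2 _ cG)).
apply: ge0_le_integral => //.
- exact: (nn (fun z => F z + G z)%R).
- exact: (measurable_nsq (hcontD cF cG)).
- by apply: emeasurable_funD; exact: m2.
move=> p p0; rewrite -!EFinM -EFinD lee_fin !mulrA -mulrDl ler_wpM2r ?powR_ge0//.
set u := F _; set v := G _.
have H : cmod (u + v) ^+ 2 <= (cmod u + cmod v) ^+ 2.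
  by rewrite ler_pXn2r// ?nnegrE ?addr_ge0 ?cmod_ge0// cmodD.
apply: le_trans H _.
by rewrite -subr_ge0 (_ : _ - _ = (cmod u - cmod v) ^+ 2) ?sqr_ge0//; ring.
Qed.

Lemma nsqD_lt F G (e : R) : hcont F -> hcont G ->
  (nsq alpha F < (e / 4)%:E)%E -> (nsq alpha G < (e / 4)%:E)%E ->
  (nsq alpha (fun z => F z + G z)%R < e%:E)%E.
Proof.
move=> cF cG Fe Ge; apply: le_lt_trans (nsqD cF cG) _.
have := nsq_ge0 F; have := nsq_ge0 G; move: Fe Ge.
case: (nsq alpha F) (nsq alpha G) => [u||] [v||] //.
rewrite !lte_fin; lra.
Qed.

End BergmanNorm.

(** * Newton and Takenaka-Malmquist functions *)

Section NewtonBasis.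
Context {R : realType}.
Variables (b : R[i]) (M : nat).
Hypothesis b0 : 0 < complex.Re b.
Implicit Types (z w : R[i]) (i k m n : nat).

Definition node j : R[i] := 1 + j%:R * b.

Definition base_fun z : R[i] := \prod_(j < M) (z + node j)^-1.

(** [newton_fun 0] is the cyclic vector. It has one factor more than [base_fun], which provides the
    pole of the first Malmquist function. *)
Definition newton_fun i z : R[i] := \prod_(j < M.+1) (z + node (i + j))^-1.

Lemma Re_node j : complex.Re (node j) = 1 + j%:R * complex.Re b.
Proof.
rewrite /node; have -> : (j%:R : R[i]) = (j%:R : R)%:C%C by rewrite rmorph_nat.
by rewrite ReD ReM /= mul0r subr0.
Qed.

Lemma Re_node_ge1 j : 1 <= complex.Re (node j).
Proof. by rewrite Re_node lerDl mulr_ge0// ltW. Qed.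

Lemma node_neq0 z j : 0 <= complex.Re z -> z + node j != 0.
Proof.
move=> z0; have : 0 < complex.Re (z + node j).
  by rewrite ReD ltr_wpDl// (lt_le_trans ltr01)// Re_node_ge1.
by apply: contraTneq => ->; rewrite ltxx.
Qed.

Lemma b_neq0 : b != 0.
Proof. by apply: contraTneq b0 => ->; rewrite ltxx. Qed.

Lemma node_shift z i m : (i <= m)%N ->
  z + node i = z + node m - (m - i)%:R * b.
Proof. by move=> im; rewrite /node natrB//; ring. Qed.

Lemma newton_fun_shift i z : newton_fun i z = newton_fun 0 (z + i%:R * b).
Proof.
rewrite /newton_fun; apply: eq_bigr => j _; congr (_^-1).
by rewrite /node add0n natrD; ring.
Qed.

(** Both sides are the product over the nodes [i + 1, ..., i + M] shared by the two functions. *)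
Lemma newton_fun_rec i z : 0 <= complex.Re z ->
  newton_fun i z * (z + node i) = newton_fun i.+1 z * (z + node (i + M.+1)).
Proof.
move=> z0; rewrite /newton_fun big_ord_recl big_ord_recr /= addn0.
rewrite mulrC mulVKf ?node_neq0// -addSnnS mulfVK ?node_neq0//.
by apply: eq_bigr => j _; rewrite /bump /= add1n addSnnS.
Qed.

Definition newton_span n (e : R[i] -> R[i]) := exists c : nat -> R[i],
  forall z, 0 < complex.Re z -> e z = \sum_(k < n) c k * newton_fun k z.

Lemma newton_spanD n e e' : newton_span n e -> newton_span n e' ->
  newton_span n (fun z => e z + e' z).
Proof.
move=> [c Hc] [c' Hc']; exists (fun k => c k + c' k) => z z0.
by rewrite Hc// Hc'// -big_split; apply: eq_bigr => k _; rewrite /= mulrDl.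
Qed.

Lemma newton_spanZ n e a : newton_span n e -> newton_span n (fun z => a * e z).
Proof.
move=> [c Hc]; exists (fun k => a * c k) => z z0.
by rewrite Hc// mulr_sumr; apply: eq_bigr => k _; rewrite mulrA.
Qed.

Lemma newton_span0 n : newton_span n (fun=> 0).
Proof. by exists (fun=> 0) => z _; rewrite big1// => k _; rewrite mul0r. Qed.

Lemma newton_span_sum n p (e : nat -> R[i] -> R[i]) :
  (forall k, (k < p)%N -> newton_span n (e k)) ->
  newton_span n (fun z => \sum_(k < p) e k z).
Proof.
elim: p => [|p IH] H.
  have [c Hc] := newton_span0 n; exists c => z z0.
  by rewrite big_ord0; exact: Hc.
have [c Hc] := newton_spanD (IH (fun k kp => H k (ltnW kp))) (H p (ltnSn p)).
by exists c => z z0; rewrite big_ord_recr /=; exact: Hc.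
Qed.

Lemma newton_span_leq n n' e : (n <= n')%N -> newton_span n e -> newton_span n' e.
Proof.
move=> nn [c Hc]; exists (fun k => if (k < n)%N then c k else 0) => z z0.
rewrite Hc// (big_ord_widen n' (fun k => c k * newton_fun k z))// big_mkcond /=.
by apply: eq_bigr => k _; case: ifP => // _; rewrite mul0r.
Qed.

Lemma newton_fun_span i n : (i < n)%N -> newton_span n (newton_fun i).
Proof.
move=> ni; exists (fun k => (k == i)%:R) => z z0.
rewrite (bigD1 (Ordinal ni))//= eqxx mul1r big1 ?addr0// => k ki.
by rewrite (_ : (k == i :> nat) = false) ?mul0r//; apply: negbTE.
Qed.

(** Put [D = z + node m] with [m = i + M + 1 + d]. Then [newton_fun_rec] reads
    [x * (D - p) = x' * (D - q)] with [p = (m - i) b] and [q = d b], so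
    [x / D = (x - x' + q * (x' / D)) / p]. The quotient [x' / D] has the same pole but starts one
    node later, so [d] drops by one; for [d = 0] it disappears. *)
Lemma newton_fun_div i d :
  newton_span (i + d).+2 (fun z => newton_fun i z / (z + node (i + M.+1 + d))).
Proof.
have alg (D x x' p q : R[i]) : D != 0 -> p != 0 -> x * (D - p) = x' * (D - q) ->
    x / D = p^-1 * (x + -1 * x' + q * (x' / D)).
  move=> D0 p0 E; have E' : p * x = x * D - x' * (D - q) by rewrite -E; ring.
  have -> : x / D = p^-1 * (p * x / D) by field; rewrite D0 p0.
  by rewrite E'; field; rewrite D0 p0.
elim: d i => [|d IH] i; set m := (i + M.+1 + _)%N.
  have [c Hc] := newton_spanZ (M.+1%:R * b)^-1
    (newton_spanD (newton_fun_span (ltnW (ltnSn i.+1)))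
                  (newton_spanZ (-1) (newton_fun_span (ltnSn i.+1)))).
  exists c => z z0; rewrite addn0 -Hc//=.
  have := newton_fun_rec i (ltW z0); rewrite /m addn0.
  rewrite (@node_shift z i (i + M.+1)) ?leq_addr// addKn => E.
  rewrite (alg _ _ (newton_fun i.+1 z) (M.+1%:R * b) 0) ?mul0r ?addr0 ?subr0//.
    by rewrite node_neq0 ?ltW.
  by rewrite mulf_neq0 ?b_neq0// pnatr_eq0.
have n1 : (i < (i + d.+1).+2)%N by rewrite ltnS leqW ?leq_addr.
have n2 : (i.+1 < (i + d.+1).+2)%N by rewrite !ltnS leq_addr.
have := IH i.+1; rewrite addSnnS => S1.
have [c Hc] := newton_spanZ ((M.+1 + d.+1)%:R * b)^-1
   (newton_spanD (newton_spanD (newton_fun_span n1)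
                               (newton_spanZ (-1) (newton_fun_span n2)))
                 (newton_spanZ (d.+1%:R * b) S1)).
exists c => z z0; rewrite -Hc//=.
have -> : (i.+1 + M.+1 + d = m)%N.
  by rewrite /m; lia.
apply: alg; first by rewrite node_neq0 ?ltW.
  by rewrite mulf_neq0 ?b_neq0// pnatr_eq0.
have := newton_fun_rec i (ltW z0).
rewrite (@node_shift z i m) ?(@node_shift z (i + M.+1) m) /m.
- by rewrite addKn -addnA addKn.
- by rewrite leq_addr.
- by rewrite -addnA leq_addr.
Qed.

(** With [p] the new node, [(z - c) / (z + p) = 1 - (p + c) / (z + p)], so only division by [z + p]
    matters. *)
Lemma newton_span_step n e (c : R[i]) : newton_span n.+1 e ->
  newton_span n.+2 (fun z => e z * ((z - c) / (z + node (n + M.+1)))).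
Proof.
move=> [a Ha].
have S1 : newton_span n.+2 (fun z => \sum_(k < n.+1)
    a k * (newton_fun k z / (z + node (n + M.+1)))).
  apply: (@newton_span_sum _ _ (fun k z => a k * (newton_fun k z / (z + node (n + M.+1))))).
  move=> k kn; apply: newton_spanZ.
  have := newton_fun_div k (n - k); rewrite addnAC subnKC//.
have S2 : newton_span n.+2 e.
  by apply: (newton_span_leq (leqnSn _)); exists a.
have [a' Ha'] := newton_spanD S2 (newton_spanZ (- (node (n + M.+1) + c)) S1).
exists a' => z z0; rewrite -Ha'//=.
have n0 : z + node (n + M.+1) != 0 by rewrite node_neq0 ?ltW.
have -> : \sum_(k < n.+1) a k * (newton_fun k z / (z + node (n + M.+1))) =
    e z / (z + node (n + M.+1)).
  by rewrite Ha// mulr_suml; apply: eq_bigr => k _; rewrite mulrA.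
by field.
Qed.

(** [base_fun] uses up the nodes below [M]; the poles are those that follow. *)
Definition pole k : R[i] := node (M + k).

Definition blaschke n z : R[i] := \prod_(j < n) ((z - conjc (pole j)) / (z + pole j)).

Definition malmquist k z : R[i] := base_fun z * blaschke k z / (z + pole k).

(** Regrouping denominators, [malmquist k.+1] is [malmquist k] times
    [(z - conj p_k) / (z + p_(k+1))], which is one [newton_span_step]. *)
Lemma malmquist_span k : newton_span k.+1 (malmquist k).
Proof.
elim: k => [|k IH].
  have [c Hc] := newton_fun_span (ltnSn 0); exists c => z z0; rewrite -Hc//.
  rewrite /malmquist /blaschke big_ord0 mulr1 /newton_fun big_ord_recr /=.
  by rewrite /pole addn0 add0n; congr (_ * _).
have [c Hc] := newton_span_step (conjc (pole k)) IH.
exists c => z z0; rewrite -Hc// /malmquist /blaschke big_ord_recr /=.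
rewrite /pole [(k + M.+1)%N]addnC addSnnS.
have n1 : z + node (M + k) != 0 by rewrite node_neq0 ?ltW.
have n2 : z + node (M + k.+1) != 0 by rewrite node_neq0 ?ltW.
by field; rewrite n1 n2.
Qed.

(** This is the conjugate of [blaschke n] at the conjugate of [w]: holomorphic in [w], with zeros at
    the poles themselves. *)
Definition dual_blaschke n w : R[i] := \prod_(j < n) ((w - pole j) / (w + conjc (pole j))).

Definition malmquist_coef k w : R[i] :=
  (2 * complex.Re (pole k))%:C%C / (w + conjc (pole k)) * dual_blaschke k w.

(* The Takenaka-Malmquist expansion of the Szegö kernel; the remainder is the product of the Blaschke products at [z] and [w]. *)
Lemma cauchy_expansion n z w : 0 < complex.Re z -> 0 < complex.Re w ->
  base_fun z / (z + w) = \sum_(k < n) malmquist_coef k w * malmquist k z +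
    base_fun z * blaschke n z * (dual_blaschke n w / (z + w)).
Proof.
move=> z0 w0; have zw : z + w != 0.
  have : 0 < complex.Re (z + w) by rewrite ReD addr_gt0.
  by apply: contraTneq => ->; rewrite ltxx.
elim: n => [|n IH].
  by rewrite big_ord0 add0r /blaschke /dual_blaschke !big_ord0 mulr1 mul1r.
rewrite big_ord_recr /= -addrA IH; congr (_ + _).
rewrite /malmquist_coef /malmquist /blaschke /dual_blaschke !big_ord_recr /=.
have -> : (2 * complex.Re (pole n))%:C%C = pole n + conjc (pole n).
  by apply: complex_ext => /=; case: (pole n) => u v /=; ring.
have n1 : z + pole n != 0 by rewrite node_neq0 ?ltW.
have n2 : w + conjc (pole n) != 0.
  have : 0 < complex.Re (w + conjc (pole n)).
    rewrite ReD; have := Re_node_ge1 (M + n); rewrite /pole.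
    by case: (node _) => u v /=; lra.
  by apply: contraTneq => ->; rewrite ltxx.
field; by rewrite n1 n2 zw.
Qed.

(** It amounts to [|w + conj a|^2 - |w - a|^2 = 4 Re a Re w]. *)
Lemma cmod_reflection_quotient (a w : R[i]) : 0 < complex.Re a -> 0 <= complex.Re w ->
  cmod ((w - a) / (w + conjc a)) ^+ 2 =
  1 - 4 * complex.Re a * complex.Re w / cmod (w + conjc a) ^+ 2.
Proof.
move=> a0 w0; have n0 : cmod (w + conjc a) ^+ 2 != 0.
  rewrite expf_neq0// gt_eqF//; apply: lt_le_trans (normr_Re_le _).
  apply: lt_le_trans (ler_norm _); rewrite ReD.
  by case: a a0 => u v /=; lra.
rewrite cmodM cmodV exprMn exprVn; apply: (mulIf n0); rewrite divfK//.
rewrite mulrBl divfK// mul1r !cmodE.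
by case: a w {a0 w0 n0} => u v [s t] /=; ring.
Qed.

Lemma cmod_reflection_le1 (a w : R[i]) : 0 < complex.Re a -> 0 <= complex.Re w ->
  cmod ((w - a) / (w + conjc a)) <= 1.
Proof.
move=> a0 w0; rewrite -(@ler_pXn2r _ 2) ?nnegrE ?cmod_ge0// expr1n.
rewrite cmod_reflection_quotient// gerBl divr_ge0 ?sqr_ge0// !mulr_ge0//.
exact: ltW.
Qed.

Lemma cmod_blaschke_le1 n z : 0 <= complex.Re z -> cmod (blaschke n z) <= 1.
Proof.
move=> z0; elim: n => [|n IH]; first by rewrite /blaschke big_ord0 cmod1.
rewrite /blaschke big_ord_recr /= cmodM -[leRHS]mulr1 ler_pM ?cmod_ge0//.
have := @cmod_reflection_le1 (conjc (pole n)) z; rewrite conjcK; apply => //.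
have := Re_node_ge1 (M + n); rewrite /pole.
by case: (node _) => u v /=; lra.
Qed.

Lemma cmod_dual_blaschke_le1 n w : 0 <= complex.Re w -> cmod (dual_blaschke n w) <= 1.
Proof.
move=> w0; elim: n => [|n IH]; first by rewrite /dual_blaschke big_ord0 cmod1.
rewrite /dual_blaschke big_ord_recr /= cmodM -[leRHS]mulr1 ler_pM ?cmod_ge0//.
by apply: cmod_reflection_le1 => //; rewrite (lt_le_trans ltr01)// Re_node_ge1.
Qed.

End NewtonBasis.

(** * Blaschke products tending to zero *)

Section BlaschkeDivergence.
Context {R : realType}.

(** The induction step is [(1 - t) * (1 + S + t) <= 1 + S]. The resulting bound [1 / (1 + S)] on the
    product is enough for a divergent sum and avoids logarithms. *)
Lemma prod_one_sub_le (s : nat -> R) (n : nat) : (forall k, 0 <= s k <= 1) ->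
  (\prod_(k < n) (1 - s k)) * (1 + \sum_(k < n) s k) <= 1.
Proof.
move=> s01; elim: n => [|n IH]; first by rewrite !big_ord0 addr0 mulr1.
rewrite !big_ord_recr /=; set p := \prod_(_ < _) _ in IH *; set S := \sum_(_ < _) _ in IH *.
have p0 : 0 <= p by apply: prodr_ge0 => k _; have := s01 k; lra.
have S0 : 0 <= S by apply: sumr_ge0 => k _; have := s01 k; lra.
apply: le_trans IH; rewrite -mulrA ler_wpM2l//.
by have /andP[t0 _] := s01 n; rewrite -subr_ge0; nra.
Qed.

Lemma harmonic_sum_unbounded (c A : R) : 0 < c ->
  exists n0, forall n, (n0 <= n)%N -> A <= \sum_(k < n) c / k.+1%:R.
Proof.
move=> c0; have nd : {homo series (@harmonic R) : n m / (n <= m)%N >-> n <= m}.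
  by apply: nondecreasing_series => k _ _; exact: harmonic_ge0.
have /cvgryPge/(_ (A / c))[n0 _ H] := nondecreasing_dvgn_lt nd (@dvg_harmonic R).
exists n0 => n nn0; have := H n nn0; rewrite /= ler_pdivrMr// mulrC.
by rewrite /series /= big_mkord mulr_sumr.
Qed.

(** The squared modulus is a product of [1 - s k]. As [Re b > 0], [Re p_k] grows at least linearly,
    while [|p_k|] grows at most linearly; hence [s k] is at least a multiple of [1 / (k + 1)] and
    the harmonic series takes over. *)
Lemma dual_blaschke_cvg0 (b w : R[i]) (M : nat) : 0 < complex.Re b ->
  0 < complex.Re w -> cmod (dual_blaschke b M n w) @[n --> \oo] --> 0.
Proof.
move=> b0 w0.
pose s k := 4 * complex.Re (pole b M k) * complex.Re w /
  cmod (w + conjc (pole b M k)) ^+ 2.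
have Rep k : 1 <= complex.Re (pole b M k) by exact: Re_node_ge1.
have Rep0 k : 0 < complex.Re (pole b M k) by exact: lt_le_trans (Rep k).
have sE k : cmod ((w - pole b M k) / (w + conjc (pole b M k))) ^+ 2 = 1 - s k.
  by apply: cmod_reflection_quotient => //; exact: ltW.
have s01 k : 0 <= s k <= 1.
  apply/andP; split.
    by rewrite divr_ge0 ?sqr_ge0// !mulr_ge0// ltW.
  by rewrite -subr_ge0 -sE sqr_ge0.
have D2 n : cmod (dual_blaschke b M n w) ^+ 2 = \prod_(k < n) (1 - s k).
  elim: n => [|n IH]; first by rewrite /dual_blaschke !big_ord0 cmod1 expr1n.
  by rewrite /dual_blaschke !big_ord_recr /= cmodM exprMn IH sE.
(* [L] is such that [|w + conj p_k| <= L * (k + 1)]. *)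
pose L := cmod w + 1 + M.+1%:R * cmod b.
have L0 : 0 < L.
  by rewrite ltr_wpDr ?mulr_ge0 ?cmod_ge0// ltr_wpDl ?cmod_ge0.
(* [kap] is such that [Re p_k = 1 + (M + k) Re b >= kap * (k + 1)]. *)
pose kap := Num.min 1 (complex.Re b).
have kap0 : 0 < kap by rewrite lt_min ltr01.
have kap1 : kap <= 1 by rewrite ge_min lexx.
have kapb : kap <= complex.Re b by rewrite ge_min lexx orbT.
have bnd k : cmod (w + conjc (pole b M k)) <= L * k.+1%:R.
  apply: le_trans (cmodD _ _) _; rewrite cmod_conj.
  have H1 : cmod (pole b M k) <= 1 + (M + k)%:R * cmod b.
    apply: le_trans (cmodD _ _) _; rewrite cmod1 lerD2l cmodM.
    have -> : ((M + k)%:R : R[i]) = ((M + k)%:R : R)%:C%C by rewrite rmorph_nat.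
    by rewrite cmod_real ger0_norm.
  apply: le_trans (lerD (lexx _) H1) _.
  have h1 : 1 <= k.+1%:R :> R by rewrite ler1n.
  have h2 : (M + k)%:R <= M.+1%:R * k.+1%:R :> R.
    by rewrite -natrM ler_nat; nia.
  have h3 := ler_wpM2r (cmod_ge0 b) h2.
  have h4 : cmod w <= cmod w * k.+1%:R by rewrite ler_peMr ?cmod_ge0.
  by rewrite /L; nra.
have sge k : (4 * complex.Re w * kap / L ^+ 2) / k.+1%:R <= s k.
  have kr : kap * k.+1%:R <= complex.Re (pole b M k).
    rewrite /pole Re_node -natr1.
    have h2 : k%:R <= (M + k)%:R :> R by rewrite ler_nat leq_addl.
    have := ler_pM (ler0n R k) (ltW kap0) h2 kapb; lra.
  have c0 : 0 < cmod (w + conjc (pole b M k)).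
    apply: lt_le_trans (normr_Re_le _); apply: lt_le_trans (ler_norm _).
    by rewrite ReD; move: (Rep k); case: (pole b M k) => u v /=; lra.
  have k0 : 0 < k.+1%:R :> R by [].
  rewrite /s ler_pdivlMr ?exprn_gt0//.
  have b2 : cmod (w + conjc (pole b M k)) ^+ 2 <= (L * k.+1%:R) ^+ 2.
    by rewrite ler_pXn2r ?nnegrE ?mulr_ge0 ?cmod_ge0// ltW.
  apply: (@le_trans _ _ (4 * complex.Re w * kap / L ^+ 2 / k.+1%:R * (L * k.+1%:R) ^+ 2)).
    by rewrite ler_wpM2l// !divr_ge0 ?sqr_ge0// !mulr_ge0// ltW.
  rewrite (_ : _ / _ / _ * _ = 4 * (kap * k.+1%:R) * complex.Re w); last first.
    by field; rewrite (gt_eqF L0) addrC natr1 gt_eqF.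
  by rewrite ler_pM2r// ler_pM2l.
apply/cvgr0Pnorm_le => e e0.
have c0 : 0 < 4 * complex.Re w * kap / L ^+ 2.
  by rewrite divr_gt0 ?exprn_gt0// !mulr_gt0.
have [n0 Hn0] := harmonic_sum_unbounded (e ^- 2) c0.
exists n0 => // n /= nn0; rewrite ger0_norm ?cmod_ge0//.
rewrite -(@ler_pXn2r _ 2) ?nnegrE ?cmod_ge0 ?(ltW e0)// D2.
have S1 : e ^- 2 <= \sum_(k < n) s k.
  by apply: le_trans (Hn0 n nn0) _; apply: ler_sum => k _; exact: sge.
have := prod_one_sub_le n s01; set p := \prod_(_ < _) _; set S := \sum_(_ < _) _ in S1 *.
have e20 : 0 < e ^- 2 by rewrite invr_gt0 exprn_gt0.
move=> H; have SS : 0 < 1 + S by lra.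
move: H; rewrite -ler_pdivlMr// div1r => /le_trans; apply.
by rewrite -[leRHS]invrK lef_pV2 ?posrE//; lra.
Qed.

End BlaschkeDivergence.

(** * Approximation by translation and damping *)

Section WeightIntegrals.
Context {R : realType}.

(** For [alpha < 0] the integrand is singular at 0, so the primitive is used on [[c / (n + 1), c]]
    and the set is exhausted by these intervals. *)
Lemma integral_powR_le (alpha c : R) : -1 < alpha -> 0 < c ->
  (\int[leb]_(x in `]0%R, c]) (x `^ alpha)%:E <= (c `^ (alpha + 1) / (alpha + 1))%:E)%E.
Proof.
move=> al c0; have al1 : 0 < alpha + 1 by lra.
pose F (n : nat) : set R := `[c / n.+1%:R, c]%classic.
have Fpos n : 0 < c / n.+1%:R by rewrite divr_gt0.
have FE : \bigcup_n F n = `]0%R, c]%classic.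
  apply/seteqP; split => [x [n _]|x]; rewrite /F /= !in_itv/=.
    by move=> /andP[cx ->]; rewrite andbT; exact: lt_le_trans cx.
  move=> /andP[x0 xc]; exists (Num.truncn (c / x)) => //=; rewrite in_itv/= xc andbT.
  rewrite ler_pdivrMr// mulrC -ler_pdivrMr//.
  exact/ltW/truncnS_gt.
have mf (D : set R) : measurable_fun D (fun x : R => (x `^ alpha)%:E).
  by apply/measurable_EFinP; apply: measurable_funTS; exact: measurable_powR.
have nF : nondecreasing_seq F.
  move=> m n mn; rewrite subsetEset => x; rewrite /F /= !in_itv/= => /andP[cx ->].
  rewrite andbT; apply: le_trans cx; rewrite ler_pM2l// lef_pV2 ?posrE//.
  by rewrite ler_nat.
have L := @ge0_nondecreasing_set_cvg_integral _ (measurableTypeR R) R F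
   (fun x : R => (x `^ alpha)%:E) lebesgue_measure
   nF (fun n => measurable_itv _) (fun n => mf (F n)) (fun n x _ => powR_ge0 _ _).
rewrite -FE -(cvg_lim _ L)//; apply: lime_le; first by apply/cvg_ex; eexists; exact: L.
apply: nearW => n.
(* For [n = 0] the interval is the single point [c]. *)
have [cn|cn] := eqVneq n 0%N.
  rewrite cn /F divr1 set_itv1 integral_set1 lee_fin divr_ge0 ?powR_ge0//.
  exact: ltW.
have lt : c / n.+1%:R < c by rewrite gtr_pMr// invf_lt1// ltr1n ltnS lt0n.
have pos x : c / n.+1%:R <= x <= c -> 0 < x by move=> /andP[h _]; exact: lt_le_trans h.
have cont x : c / n.+1%:R <= x <= c -> {for x, continuous (fun x : R => x `^ alpha)}.
  move=> /pos x0; apply: differentiable_continuous; apply/derivable1_diffP.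
  by have D := @is_derive1_powR R alpha x x0; exact: ex_derive.
have E : segint (fun x => x `^ alpha) (c / n.+1%:R) c =
    c `^ (alpha + 1) / (alpha + 1) - (c / n.+1%:R) `^ (alpha + 1) / (alpha + 1).
  apply: (@segint_FTC R (fun x => x `^ (alpha + 1) / (alpha + 1))) => // x /pos x0.
  have D := @is_derive1_powR R (alpha + 1) x x0.
  apply: is_derive_eq; rewrite /GRing.scale /= addrK.
  by field; rewrite gt_eqF.
rewrite /F -(@fineK _ (\int[leb]_(x in _) _)%E); last first.
  by apply: integrable_fin_num => //; apply: seg_integrable => x /cont /cont1P.
rewrite lee_fin [X in X <= _](_ : _ = segint (fun x => x `^ alpha) (c / n.+1%:R) c)// E.
by rewrite gerBl divr_ge0 ?powR_ge0// ltW.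
Qed.

Lemma integral_oneDsqr_lty : (\int[leb]_x ((1 + (x : R) ^+ 2)^-1)%:E < +oo)%E.
Proof.
have p0 (x : R) : 0 < 1 + x ^+ 2 by rewrite ltr_pwDl ?sqr_ge0.
rewrite ge0_symfun_integralT.
- rewrite -set_itvcy; have := @integral0y_oneDsqr R; rewrite /oneDsqr => ->.
  by rewrite ltry.
- by move=> x; rewrite invr_ge0 ltW.
- exact: continuous_oneDsqrV.
- by move=> x /=; rewrite sqrrN.
Qed.

Lemma integral_prod_lty (A B : R -> \bar R) :
  measurable_fun setT A -> measurable_fun setT B ->
  (forall x, 0 <= A x)%E -> (forall x, 0 <= B x)%E ->
  (\int[leb]_x A x < +oo)%E -> (\int[leb]_x B x < +oo)%E ->
  (\int[leb2]_p (A p.1 * B p.2)%E < +oo)%E.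
Proof.
move=> mA mB A0 B0 Af Bf.
have mAB : measurable_fun setT (fun p : R * R => A p.1 * B p.2)%E.
  apply: emeasurable_funM; first exact: (measurableT_comp mA measurable_fst).
  exact: (measurableT_comp mB measurable_snd).
rewrite fubini_tonelli1//; last by move=> p; rewrite mule_ge0.
rewrite /fubini_F /=.
under eq_integral do rewrite ge0_integralZl//.
rewrite ge0_integralZr//; last by apply: integral_ge0.
by rewrite lte_mul_pinfty ?integral_ge0// ge0_fin_numE ?integral_ge0.
Qed.

End WeightIntegrals.

Section Scheffe.
Local Open Scope ereal_scope.
Context d (T : measurableType d) (R : realType) (mu : {measure set T -> \bar R}).
Variables (D : set T) (mD : measurable D).

Lemma limn_einf_le (u v : (\bar R)^nat) (l : \bar R) :
  (forall n, u n <= v n) -> v n @[n --> \oo] --> l -> limn_einf u <= l.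
Proof.
move=> uv vl; rewrite limn_einf_lim -(cvg_lim _ vl)//; apply: lee_lim.
- exact: is_cvg_einfs.
- by apply/cvg_ex; exists l.
- apply: nearW => n; apply: le_trans (uv n).
  by apply: ereal_inf_lbound; exists n => /=.
Qed.

(* Apply Fatou's lemma to [2 A n + 2 A0 - E n >= 0]. *)
Lemma scheffe_dominated (A E : nat -> T -> R) (A0 : T -> R) :
  (forall n, measurable_fun D (A n)) -> measurable_fun D A0 ->
  (forall n, measurable_fun D (E n)) ->
  (forall n x, D x -> 0 <= A n x)%R -> (forall x, D x -> 0 <= A0 x)%R ->
  (forall n x, D x -> 0 <= E n x <= 2 * A n x + 2 * A0 x)%R ->
  (forall x, D x -> A n x @[n --> \oo] --> A0 x) ->
  (forall x, D x -> E n x @[n --> \oo] --> 0%R) ->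
  (forall n, \int[mu]_(x in D) (A n x)%:E < +oo) ->
  \int[mu]_(x in D) (A0 x)%:E < +oo ->
  \int[mu]_(x in D) (A n x)%:E @[n --> \oo] --> \int[mu]_(x in D) (A0 x)%:E ->
  forall e : R, (0 < e)%R -> exists n, \int[mu]_(x in D) (E n x)%:E < e%:E.
Proof.
move=> mA mA0 mE A_ge0 A0_ge0 E_le cA cE iA iA0 cI e e0.
apply: contrapT => /forallNP nE.
have {}nE n : e%:E <= \int[mu]_(x in D) (E n x)%:E by rewrite leNgt; exact/negP/nE.
pose F n x := ((2 * A n x + 2 * A0 x) - E n x)%R.
have F_ge0 n x : D x -> (0 <= F n x)%R.
  by move=> /(E_le n x)/andP[_ h]; rewrite subr_ge0.
have mF n : measurable_fun D (F n).
  by apply: measurable_funB => //; apply: measurable_funD; apply: measurable_funM.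
pose J := \int[mu]_(x in D) (A0 x)%:E.
have J0 : 0 <= J by apply: integral_ge0 => x Dx; rewrite lee_fin A0_ge0.
have Jfin : J \is a fin_num by rewrite ge0_fin_numE.
have mEF (f : T -> R) : measurable_fun D f -> measurable_fun D (fun x => (f x)%:E).
  by move=> mf; exact/measurable_EFinP.
have Z (f : T -> R) (k : R) : (0 <= k)%R -> measurable_fun D f -> (forall x, D x -> 0 <= f x)%R ->
    \int[mu]_(x in D) (k * f x)%:E = k%:E * \int[mu]_(x in D) (f x)%:E.
  move=> k0 mf f0; under eq_integral do rewrite EFinM.
  by rewrite ge0_integralZl_EFin//; exact: mEF.
have sumE n : \int[mu]_(x in D) (F n x)%:E + \int[mu]_(x in D) (E n x)%:E =
    2%:E * \int[mu]_(x in D) (A n x)%:E + 2%:E * J.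
  rewrite -ge0_integralD//; [|by move=> x /(F_ge0 n)|exact: mEF|
    by move=> x /(E_le n x)/andP[]|exact: mEF].
  rewrite /J -(Z _ _ (ler0n _ 2) (mA n) (A_ge0 n)) -(Z _ _ (ler0n _ 2) mA0 A0_ge0) -ge0_integralD//.
  - by apply: eq_integral => x _; rewrite -!EFinD subrK.
  - by move=> x Dx; rewrite lee_fin mulr_ge0// A_ge0.
  - by apply: mEF; exact: measurable_funM.
  - by move=> x Dx; rewrite lee_fin mulr_ge0// A0_ge0.
  - by apply: mEF; exact: measurable_funM.
pose v n := 2%:E * \int[mu]_(x in D) (A n x)%:E + 2%:E * J - e%:E.
have Fv n : \int[mu]_(x in D) (F n x)%:E <= v n.
  by rewrite /v leeBrDr// -sumE leeD2l.
have cv : v n @[n --> \oo] --> 2%:E * J + 2%:E * J - e%:E.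
  apply: cvgeB => //; last exact: cvg_cst.
    by rewrite fin_num_adde_defl.
  apply: cvgeD; [by rewrite fin_num_adde_defr// fin_numM| |exact: cvg_cst].
  by apply: cvgeZl.
have Finf x : D x -> limn_einf (fun n => (F n x)%:E) = (4 * A0 x)%:E.
  move=> Dx; apply: (cvg_limn_einf_sup _).1.
  apply: cvg_EFin; first exact: nearW.
  rewrite (_ : 4 * A0 x = 2 * A0 x + 2 * A0 x - 0)%R; last by ring.
  apply: cvgB; last exact: cE.
  apply: cvgD; last exact: cvg_cst.
  by apply: cvgM; [exact: cvg_cst|exact: cA].
have := @fatou _ _ _ mu D mD (fun n x => (F n x)%:E)
  (fun n => mEF _ (mF n)) (fun n x Dx => F_ge0 n x Dx).
rewrite [X in X <= _](_ : _ = \int[mu]_(x in D) (4 * A0 x)%:E); last first.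
  by apply: eq_integral => x; rewrite inE; exact: Finf.
rewrite (Z _ _ (ler0n _ 4) mA0 A0_ge0) => /le_trans /(_ (limn_einf_le Fv cv)).
rewrite -/J -(fineK Jfin) -!EFinM -!EFinD lee_fin; lra.
Qed.

End Scheffe.

Lemma ge0_integral_shift1 {R : realType} (f : R * R -> \bar R) (c : R) :
  measurable_fun setT f -> (forall p, 0 <= f p)%E ->
  (\int[leb2]_p f (p.1 + c, p.2)%R)%E = (\int[leb2]_p f p)%E.
Proof.
move=> mf f0.
have mf' : measurable_fun setT (fun p : R * R => f (p.1 + c, p.2)%R).
  apply: (measurableT_comp mf); apply: measurable_fun_pair => /=.
    by apply: measurable_funD => //; exact: measurable_fst.
  exact: measurable_snd.
rewrite fubini_tonelli2// [RHS]fubini_tonelli2//.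
apply: eq_integral => y _; rewrite /fubini_G /=.
rewrite (ge0_integral_shift (f := fun x => f (x, y)))//.
exact: measurable_fun_pair1.
Qed.

(** * Small translations to the right *)

Section ShiftHead.
Context {R : realType}.
Variables (alpha : R) (g : R[i] -> R[i]).
Hypothesis al : -1 < alpha.
Hypothesis cg : hcont g.
Hypothesis ng : (nsq alpha g < +oo)%E.
Local Open Scope ereal_scope.

Definition mass2 (p : R * R) : \bar R :=
  ((fun p => (cmod (g (p.1 +i* p.2)%C) ^+ 2)%:E) \_ (rhp2 0)) p.

Definition vweight (I : set R) (x : R) : \bar R := ((fun x => (x `^ alpha)%:E) \_ I) x.

(** Real shifts move only the first coordinate, so norms of translates become one-variable integrals
    of this function against the weight. *)
Definition slice_mass (x : R) : \bar R := \int[leb]_y mass2 (x, y).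

Lemma mass2_ge0 p : 0 <= mass2 p.
Proof. by rewrite /mass2 patchE; case: ifP => // _; rewrite lee_fin sqr_ge0. Qed.

Lemma vweight_ge0 I x : 0 <= vweight I x.
Proof. by rewrite /vweight patchE; case: ifP => // _; rewrite lee_fin powR_ge0. Qed.

Lemma measurable_mass2 : measurable_fun setT mass2.
Proof.
apply/(measurable_restrict _ (measurable_rhp2 _) measurableT); rewrite setTI.
by apply/measurable_EFinP; exact: measurable_cmod2.
Qed.

Lemma measurable_vweight I : measurable I -> measurable_fun setT (vweight I).
Proof.
move=> mI; apply/(measurable_restrict _ mI measurableT); rewrite setTI.
by apply/measurable_EFinP; apply: measurable_funTS; exact: measurable_powR.
Qed.

Lemma slice_mass_ge0 x : 0 <= slice_mass x.
Proof. by apply: integral_ge0 => y _; exact: mass2_ge0. Qed.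

Lemma measurable_slice_mass : measurable_fun setT slice_mass.
Proof.
apply: measurable_fun_fubini_tonelli_F; first exact: measurable_mass2.
exact: mass2_ge0.
Qed.

Lemma weighted_integralE (I : set R) (s : R) : measurable I ->
  (I `<=` `]0%R, +oo[)%classic -> (0 <= s)%R ->
  \int[leb2]_(p in [set p | I p.1])
    (cmod (g ((p.1 +i* p.2)%C + s%:C%C)) ^+ 2 * p.1 `^ alpha)%:E =
  \int[leb]_x (vweight I x * slice_mass (x + s)%R).
Proof.
move=> mI I0 s0.
have mS : measurable_fun setT (fun p : R * R => mass2 (p.1 + s, p.2)%R).
  apply: (measurableT_comp measurable_mass2); apply: measurable_fun_pair => /=.
    by apply: measurable_funD => //; exact: measurable_fst.
  exact: measurable_snd.
have mP : measurable_fun setT (fun p : R * R => vweight I p.1 * mass2 (p.1 + s, p.2)%R).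
  apply: emeasurable_funM => //.
  exact: (measurableT_comp (measurable_vweight mI) measurable_fst).
transitivity (\int[leb2]_p (vweight I p.1 * mass2 (p.1 + s, p.2)%R)).
  rewrite integral_mkcond; apply: eq_integral => p _.
  rewrite /vweight !patchE /=; have [Ip|Ip] := boolP (p.1 \in I); last first.
    rewrite mul0e ifF//; apply: contraNF Ip; rewrite !inE//.
  have p0 : (0 < p.1)%R by have := I0 _ (set_mem Ip); rewrite /= in_itv/= andbT.
  rewrite ifT; last by move: Ip; rewrite !inE.
  rewrite /mass2 patchE ifT; last by rewrite inE /rhp2 /= ltr_wpDr.
  rewrite -EFinM mulrC /=; congr ((_ * cmod (g _) ^+ 2)%:E).
  by apply: complex_ext => /=; rewrite ?addr0.
rewrite fubini_tonelli1//; last by move=> p; rewrite mule_ge0 ?vweight_ge0 ?mass2_ge0.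
apply: eq_integral => x _; rewrite /fubini_F /= ge0_integralZl//.
- exact: (measurable_fun_pair2 (f := fun p : R * R => mass2 (p.1 + s, p.2)%R)).
- by move=> y _; exact: mass2_ge0.
- exact: vweight_ge0.
Qed.

Let W := vweight `]0%R, +oo[.

Lemma nsq_slices : nsq alpha g = \int[leb]_x (W x * slice_mass x).
Proof.
have := @weighted_integralE `]0%R, +oo[ 0%R (measurable_itv _) (@subset_refl _ _) (lexx _).
have -> : [set p : R * R | `]0%R, +oo[%classic p.1] = rhp2 0%R.
  by apply/seteqP; split => p; rewrite /rhp2 /= in_itv /= andbT.
under [X in _ = X -> _]eq_integral do rewrite addr0.
move=> <-; apply: (@eq_nsq _ alpha g (fun z => g (z + 0%:C%C)%R)) => z _.
by rewrite (_ : 0%:C%C = 0)%R// addr0.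
Qed.

(** The window [[eps, 3 eps]] contains [x + s] whenever [0 < x <= eps <= s <= 2 eps]. *)
Definition near_mass (eps : R) := \int[leb]_(x in `[eps, (3 * eps)%R]) (W x * slice_mass x).

Lemma near_mass_ge0 eps : 0 <= near_mass eps.
Proof. by apply: integral_ge0 => x _; rewrite mule_ge0 ?vweight_ge0 ?slice_mass_ge0. Qed.

Lemma measurable_Wslice : measurable_fun setT (fun x => W x * slice_mass x).
Proof.
by apply: emeasurable_funM; [exact: measurable_vweight|exact: measurable_slice_mass].
Qed.

Lemma near_mass_lty eps : near_mass eps < +oo.
Proof.
apply: le_lt_trans ng; rewrite nsq_slices; apply: ge0_subset_integral => //.
- exact: measurable_Wslice.
- by move=> x _; rewrite mule_ge0 ?vweight_ge0 ?slice_mass_ge0.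
Qed.

(** Each fixed point is eventually outside the shrinking windows, and the full integrand, of
    integral [nsq alpha g], dominates. *)
Lemma near_mass_cvg0 (c : R) : (0 < c)%R ->
  near_mass (c / n.+1%:R)%R @[n --> \oo] --> 0.
Proof.
move=> c0; pose h x := W x * slice_mass x.
have h0 x : 0 <= h x by rewrite mule_ge0 ?vweight_ge0 ?slice_mass_ge0.
pose I n : set R := `[(c / n.+1%:R)%R, (3 * (c / n.+1%:R))%R]%classic.
have [] := @dominated_convergence _ _ _ leb setT measurableT (fun n => h \_ (I n)) (cst 0) h.
- move=> n; apply/(measurable_restrict _ (measurable_itv _) measurableT).
  by rewrite setTI; apply: measurable_funTS; exact: measurable_Wslice.
- exact: measurable_cst.
- apply: aeW => x _; apply: cvg_near_cst.
  have [x0|x0] := leP x 0%R.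
    apply: nearW => n; rewrite patchE ifF//; apply/negbTE.
    rewrite notin_setE /I /= in_itv /= => /andP[cx _].
    by have := lt_le_trans (divr_gt0 c0 (ltr0Sn R n)) cx; rewrite ltNge x0.
  exists (Num.truncn (3 * c / x)) => // n /= xn; rewrite patchE ifF//.
  apply/negbTE; rewrite notin_setE /I /= in_itv /= => /andP[_]; apply/negP.
  rewrite -ltNge mulrA ltr_pdivrMr// [X in (_ < X)%R]mulrC -ltr_pdivrMr//.
  by apply: lt_le_trans (truncnS_gt _) _; rewrite ler_nat.
- apply/integrableP; split; first exact: measurable_Wslice.
  by under eq_integral do rewrite gee0_abs//; rewrite -nsq_slices.
- apply: aeW => x n _; rewrite patchE; case: ifP => _; first by rewrite gee0_abs.
  by rewrite abse0.
move=> _ _; rewrite integral0; apply: cvg_trans; apply: near_eq_cvg; apply: nearW => n /=.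
by rewrite [RHS]integral_mkcond.
Qed.

End ShiftHead.

(** The ratio 3 serves two comparisons: [x] in [[eps, 3 eps]] with [eps], and [x - s] with [x] when
    [x > e + s] and [s <= 2 e]. *)
Lemma powR_comparable {R : realType} (alpha x y : R) : 0 < x -> 0 < y ->
  x <= 3 * y -> y <= 3 * x -> x `^ alpha <= 3 `^ `|alpha| * y `^ alpha.
Proof.
move=> x0 y0 xy yx; have [a0|a0] := leP 0 alpha.
  rewrite ger0_norm// -powRM ?(ltW y0)//.
  by apply: ge0_ler_powR => //; rewrite nnegrE; lra.
have h (z : R) : z `^ alpha = (z `^ (- alpha))^-1 by rewrite powRN invrK.
rewrite ltr0_norm// (h x) (h y).
rewrite ler_pdivlMr ?powR_gt0// mulrC ler_pdivrMr ?powR_gt0//.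
rewrite -powRM ?(ltW x0)//.
by apply: ge0_ler_powR => //; rewrite ?nnegrE; lra.
Qed.

Lemma cmod_dist {R : realType} (u v : R[i]) : `|cmod u - cmod v| <= cmod (u - v).
Proof.
rewrite ler_norml; apply/andP; split.
  by have := cmodD (v - u) u; rewrite subrK cmodB; lra.
by have := cmodD (u - v) v; rewrite subrK; lra.
Qed.

Section ShiftConvergence.
Context {R : realType}.
Variables (alpha : R) (g : R[i] -> R[i]).
Hypothesis al : -1 < alpha.
Hypothesis cg : hcont g.
Hypothesis ng : (nsq alpha g < +oo)%E.

Let C := 3 `^ `|alpha|.
Let m := slice_mass g.

Lemma slice_mass_near_le (eps : R) : 0 < eps ->
  ((eps `^ alpha)%:E * \int[leb]_(t in `[eps, (3 * eps)%R]) m t <=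
   C%:E * near_mass alpha g eps)%E.
Proof.
move=> e0; have mm (I : set R) : measurable_fun I m.
  by apply: measurable_funTS; exact: measurable_slice_mass.
have mW (I : set R) : measurable_fun I (fun x => vweight alpha `]0%R, +oo[ x * m x)%E.
  by apply: measurable_funTS; exact: measurable_Wslice.
rewrite /near_mass -(ge0_integralZl_EFin leb (measurable_itv _) _ (mm _) (powR_ge0 eps alpha)); last first.
  by move=> x _; exact: slice_mass_ge0.
rewrite -(ge0_integralZl_EFin leb (measurable_itv _) _ (mW _) (powR_ge0 3 `|alpha|)); last first.
  by move=> x _; rewrite mule_ge0 ?vweight_ge0 ?slice_mass_ge0.
apply: ge0_le_integral => //.
- by move=> x _; rewrite mule_ge0 ?lee_fin ?powR_ge0 ?slice_mass_ge0.
- by apply: measurable_funeM; exact: mm.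
- by apply: measurable_funeM; exact: mW.
move=> x /=; rewrite in_itv/= => /andP[ex x3]; rewrite muleA.
rewrite lee_wpmul2r ?slice_mass_ge0// /vweight patchE mem_set/=; last first.
  by rewrite in_itv/= andbT (lt_le_trans e0).
rewrite -EFinM lee_fin; apply: powR_comparable => //; [exact: lt_le_trans ex|lra].
Qed.

(* For negative [alpha] translation may increase the weighted mass near the
   boundary, so a good shift [s] is found by averaging over [eps, 2 eps]. *)
Lemma head_average (eps : R) : 0 < eps ->
  (\int[leb]_(s in `[eps, (2 * eps)%R])
     (\int[leb]_x (vweight alpha `]0%R, eps] x * m (x + s)%R)) <=
   (eps `^ (alpha + 1) / (alpha + 1))%:E * \int[leb]_(t in `[eps, (3 * eps)%R]) m t)%E.
Proof.
move=> e0; pose I : set R := `[eps, (2 * eps)%R]%classic.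
pose W := vweight alpha `]0%R, eps].
have mm : measurable_fun setT m by exact: measurable_slice_mass.
have mW : measurable_fun setT W by exact: measurable_vweight.
have W0 x : (0 <= W x)%E by exact: vweight_ge0.
have m0 x : (0 <= m x)%E by exact: slice_mass_ge0.
pose K0 (p : R * R) : \bar R := (W p.2 * m (p.2 + p.1)%R)%E.
pose II : set (R * R) := [set p | I p.1].
have mII : measurable II.
  rewrite -[II]setTI; apply: (@measurable_fst _ _ _ _) => //.
  exact: measurable_itv.
have mK0 : measurable_fun setT K0.
  apply: emeasurable_funM; first exact: (measurableT_comp mW measurable_snd).
  apply: (measurableT_comp mm); apply: measurable_funD.
    exact: measurable_snd.
  exact: measurable_fst.
pose K := K0 \_ II.
have mK : measurable_fun setT K.
  by apply/(measurable_restrict _ mII measurableT); rewrite setTI; exact: measurable_funTS.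
have K_ge0 p : (0 <= K p)%E.
  by rewrite /K patchE; case: ifP => // _; rewrite mule_ge0.
pose a := (m \_ `[eps, (3 * eps)%R])%E.
have ma : measurable_fun setT a.
  apply/(measurable_restrict _ (measurable_itv _) measurableT); rewrite setTI.
  exact: measurable_funTS.
have a0 x : (0 <= a x)%E by rewrite /a patchE; case: ifP.
have -> : (\int[leb]_(s in `[eps, (2 * eps)%R]) (\int[leb]_x (W x * m (x + s)%R)) =
    \int[leb]_s \int[leb]_x K (s, x))%E.
  rewrite integral_mkcond; apply: eq_integral => s _; rewrite patchE.
  case: ifPn => sI.
    apply: eq_integral => x _; rewrite /K patchE (mem_set (_ : II (s, x)))//.
    exact: (set_mem sI).
  rewrite integral0_eq// => x _; rewrite /K patchE (memNset (_ : ~ II (s, x)))//.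
  by move=> H; move/negP: sI; apply; exact/mem_set.
have -> : (\int[leb]_s \int[leb]_x K (s, x) = \int[leb]_x \int[leb]_s K (s, x))%E.
  transitivity (\int[leb2]_p K p)%E.
    by rewrite fubini_tonelli1.
  by rewrite fubini_tonelli2.
apply: (@le_trans _ _ (\int[leb]_x (W x * \int[leb]_t a t))%E).
  apply: ge0_le_integral => //.
  - by move=> x _; apply: integral_ge0.
  - by apply: measurable_fun_fubini_tonelli_G.
  - by apply: emeasurable_funM => //; exact: measurable_cst.
  move=> x _; rewrite -(ge0_integral_shift x ma a0) -ge0_integralZl//; last first.
    by apply: (measurableT_comp ma); exact: measurable_funD.
  apply: ge0_le_integral => //.
  - exact: (measurable_fun_pair1 (f := K)).
  - by apply: measurable_funeM; apply: (measurableT_comp ma); exact: measurable_funD.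
  move=> s _; rewrite /K patchE; case: ifPn => [|_]; last by rewrite mule_ge0.
  rewrite inE /II /I /= in_itv /= => /andP[es se].
  rewrite /K0 /= /W /vweight patchE; case: ifPn => [|_]; last by rewrite !mul0e.
  rewrite inE /= in_itv /= => /andP[x0 xe].
  rewrite lee_wpmul2l ?lee_fin ?powR_ge0// /a patchE addrC ifT//.
  by rewrite inE /= in_itv /=; apply/andP; split; lra.
rewrite ge0_integralZr//; last by apply: integral_ge0.
have -> : (\int[leb]_t a t = \int[leb]_(t in `[eps, (3 * eps)%R]) m t)%E.
  by rewrite [RHS]integral_mkcond.
apply: lee_wpmul2r; first by apply: integral_ge0.
apply: le_trans (integral_powR_le al e0).
by rewrite [leRHS]integral_mkcond.
Qed.

Lemma head_exists (eps : R) : 0 < eps -> exists2 s, eps <= s <= 2 * eps &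
  (\int[leb]_x (vweight alpha `]0%R, eps] x * m (x + s)%R) <=
   ((C * fine (near_mass alpha g eps) + eps) / (alpha + 1))%:E)%E.
Proof.
move=> e0; have al1 : 0 < alpha + 1 by rewrite -ltrBlDr sub0r.
have nmfin : near_mass alpha g eps \is a fin_num.
  by rewrite ge0_fin_numE ?near_mass_ge0 ?near_mass_lty.
have nm0 : 0 <= fine (near_mass alpha g eps) by rewrite fine_ge0 ?near_mass_ge0.
have := slice_mass_near_le e0; have := head_average e0.
rewrite -(fineK nmfin); set nm := fine _ in nm0 *.
have : (0 <= \int[leb]_(t in `[eps, (3 * eps)%R]) m t)%E.
  by apply: integral_ge0 => x _; exact: slice_mass_ge0.
case: (\int[leb]_(t in _) _)%E => [a||] //; last first.
  by move=> _ _; rewrite mulry gtr0_sg ?powR_gt0// mul1e leNgt ltry.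
rewrite lee_fin => a0; rewrite -!EFinM lee_fin => H1 H2.
(* The average is taken over an interval of length [eps]. The summand [eps] in the bound keeps the
   inequality strict even when the near mass is 0. *)
apply: (@pigeonhole _ (fun s => \int[leb]_x (vweight alpha `]0%R, eps] x * m (x + s)%R))%E
  _ _ (eps `^ (alpha + 1) / (alpha + 1) * a)%:E _ _ _ _ _ H1).
- lra.
- by rewrite lte_fin divr_gt0// ltr_wpDl// mulr_ge0// powR_ge0.
- pose F (p : R * R) := (vweight alpha `]0%R, eps] p.2 * m (p.2 + p.1)%R)%E.
  have mF : measurable_fun setT F.
    apply: emeasurable_funM.
      exact: (measurableT_comp (measurable_vweight _ (measurable_itv _)) measurable_snd).
    apply: (measurableT_comp (measurable_slice_mass cg)); apply: measurable_funD.
      exact: measurable_snd.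
    exact: measurable_fst.
  rewrite -[X in measurable_fun _ X]/(fubini_F leb F).
  apply: measurable_fun_fubini_tonelli_F => // p.
  by rewrite mule_ge0 ?vweight_ge0 ?slice_mass_ge0.
- by move=> s; apply: integral_ge0 => x _; rewrite mule_ge0 ?vweight_ge0 ?slice_mass_ge0.
rewrite -EFinM lte_fin (_ : 2 * eps - eps = eps); last by ring.
rewrite powRD; last by rewrite (gt_eqF e0) implybT.
rewrite powRr1 ?(ltW e0)//; move: H2.
set p := eps `^ alpha; move=> H2.
rewrite (_ : p * eps / (alpha + 1) * a = eps / (alpha + 1) * (p * a)); last by ring.
rewrite (_ : (C * nm + eps) / _ * eps = eps / (alpha + 1) * (C * nm + eps)); last by ring.
by rewrite ltr_pM2l ?divr_gt0//; apply: le_lt_trans H2 _; rewrite ltrDl.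
Qed.

(** Beyond [x = e n] the shift is at most twice the distance to the boundary, so the weights before
    and after it are comparable. Once the shift is moved from [g] to the weight, the integrands are
    dominated by [C * F0]. *)
Lemma tail_cvg (e s : R^nat) : (forall n, 0 < e n) -> (forall n, e n <= s n <= 2 * e n) ->
  e n @[n --> \oo] --> 0 ->
  (forall n, \int[leb2]_(p in rhp2 (e n))
    (cmod (g ((p.1 +i* p.2)%C + (s n)%:C%C)) ^+ 2 * p.1 `^ alpha)%:E < +oo)%E /\
  ((\int[leb2]_(p in rhp2 (e n))
    (cmod (g ((p.1 +i* p.2)%C + (s n)%:C%C)) ^+ 2 * p.1 `^ alpha)%:E)%E
    @[n --> \oo] --> nsq alpha g).
Proof.
move=> e0 es ce.
pose F n := (fun p : R * R => (cmod (g (p.1 +i* p.2)%C) ^+ 2 * (p.1 - s n) `^ alpha)%:E)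
   \_ (rhp2 (e n + s n)).
pose F0 := (fun p : R * R => (cmod (g (p.1 +i* p.2)%C) ^+ 2 * p.1 `^ alpha)%:E) \_ (rhp2 0).
have s0 n : 0 < s n by have /andP[h _] := es n; exact: lt_le_trans h.
have es0 n : 0 < e n + s n by rewrite addr_gt0.
have mcg r : 0 <= r -> measurable_fun (rhp2 r) (fun p : R * R => cmod (g (p.1 +i* p.2)%C) ^+ 2).
  by move=> r0; apply: measurable_cmod2 => z rz; apply: cg; exact: le_lt_trans rz.
have mF n : measurable_fun setT (F n).
  apply/(measurable_restrict _ (measurable_rhp2 _) measurableT); rewrite setTI.
  apply/measurable_EFinP; apply: measurable_funM; first by apply: mcg; exact: ltW.
  exact: measurable_powR_fst.
have mF0 : measurable_fun setT F0.
  apply/(measurable_restrict _ (measurable_rhp2 _) measurableT); rewrite setTI.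
  exact: measurable_nsq.
have F_ge0 n p : (0 <= F n p)%E.
  by rewrite /F patchE; case: ifP => // _; rewrite lee_fin mulr_ge0 ?powR_ge0 ?sqr_ge0.
have F0_ge0 p : (0 <= F0 p)%E.
  by rewrite /F0 patchE; case: ifP => // _; rewrite lee_fin mulr_ge0 ?powR_ge0 ?sqr_ge0.
have nsqE : nsq alpha g = (\int[leb2]_p F0 p)%E by rewrite /nsq integral_mkcond.
have FE n : (\int[leb2]_(p in rhp2 (e n))
    (cmod (g ((p.1 +i* p.2)%C + (s n)%:C%C)) ^+ 2 * p.1 `^ alpha)%:E = \int[leb2]_p F n p)%E.
  rewrite -(ge0_integral_shift1 (s n) (mF n) (F_ge0 n)) integral_mkcond.
  apply: eq_integral => p _; rewrite /F !patchE.
  have -> : ((p.1 + s n, p.2) \in rhp2 (e n + s n)) = (p \in rhp2 (e n)).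
    by apply/idP/idP => /set_mem H; apply/mem_set; move: H; rewrite /rhp2 /= ltrD2r.
  case: ifP => // _; rewrite addrK; congr ((cmod (g _) ^+ 2 * _)%:E).
  by apply: complex_ext => /=; rewrite ?addr0.
have F_le n p : (F n p <= C%:E * F0 p)%E.
  rewrite /F patchE; case: ifPn => [/set_mem|_]; last first.
    by rewrite mule_ge0 ?lee_fin ?powR_ge0.
  rewrite /rhp2 /= => ep; have /andP[h1 h2] := es n.
  have p0 : 0 < p.1 by exact: lt_trans ep.
  rewrite /F0 patchE (mem_set (_ : rhp2 0 p))// -EFinM lee_fin mulrCA.
  rewrite ler_wpM2l ?sqr_ge0//; have := e0 n; have := s0 n => sn en.
  by apply: powR_comparable => //; lra.
have CF0 : (\int[leb2]_p (C%:E * F0 p) < +oo)%E.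
  rewrite ge0_integralZl//; last by rewrite lee_fin powR_ge0.
  by rewrite lte_mul_pinfty ?lee_fin ?powR_ge0// -nsqE.
split.
  move=> n; rewrite FE; apply: le_lt_trans CF0; apply: ge0_le_integral => //.
  - exact: mF.
  - by apply: measurable_funeM; exact: mF0.
under eq_fun do rewrite FE.
rewrite nsqE.
have [] := @dominated_convergence _ _ _ leb2 setT measurableT F F0 (fun p => C%:E * F0 p)%E.
- exact: mF.
- exact: mF0.
- apply: aeW => p _; have [p0|p0] := leP p.1 0.
    apply: cvg_near_cst; apply: nearW => n; rewrite /F /F0 !patchE.
    rewrite !memNset//; rewrite /rhp2 /=; apply/negP; rewrite -leNgt//.
    by apply: le_trans p0 _; exact: ltW.
  have cs : s n @[n --> \oo] --> 0.
    apply: (@squeeze_cvgr _ _ _ _ (fun n => 0) (fun n => 2 * e n)).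
    - by apply: nearW => n; have /andP[_ ->] := es n; rewrite ltW.
    - exact: cvg_cst.
    - by rewrite -(mulr0 2); apply: cvgM => //; exact: cvg_cst.
  have ces : e n + s n @[n --> \oo] --> 0 by rewrite -(addr0 0); exact: cvgD.
  rewrite /F0 patchE (mem_set (_ : rhp2 0 p))//.
  have : (cmod (g (p.1 +i* p.2)%C) ^+ 2 * (p.1 - s n) `^ alpha)%:E @[n --> \oo] -->
      (cmod (g (p.1 +i* p.2)%C) ^+ 2 * p.1 `^ alpha)%:E.
    apply: cvg_EFin; first exact: nearW.
    apply: cvgM; first exact: cvg_cst.
    have cpow : {for p.1, continuous (fun x : R => x `^ alpha)}.
      apply: differentiable_continuous; apply/derivable1_diffP.
      by have D := @is_derive1_powR R alpha p.1 p0; exact: ex_derive.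
    have cps : p.1 - s n @[n --> \oo] --> p.1.
      by rewrite -[X in _ --> X]subr0; apply: cvgB => //; exact: cvg_cst.
    exact: (continuous_cvg _ cpow cps).
  apply: cvg_trans; apply: near_eq_cvg.
  have /cvgrPdist_lt/(_ _ p0)[n0 _ H] := ces.
  exists n0 => // n /H /=; rewrite sub0r normrN gtr0_norm// => pe.
  by rewrite /F patchE (mem_set (_ : rhp2 (e n + s n) p)).
- apply/integrableP; split; first by apply: measurable_funeM; exact: mF0.
  by under eq_integral do rewrite gee0_abs ?mule_ge0 ?lee_fin ?powR_ge0//.
- by apply: aeW => p n _; rewrite gee0_abs.
by [].
Qed.

Lemma hcont_shift (s : R) : 0 <= s -> hcont (fun z => g (z + s%:C%C)).
Proof.
move=> s0 z z0; have /cg cz : 0 < complex.Re (z + s%:C%C).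
  by rewrite ReD /= ltr_wpDr.
move=> e /cz[del del0 H]; exists del => // w wz; apply: H.
by rewrite (_ : _ - _ = w - z)//; ring.
Qed.

Lemma nsq_shift_split (s e : R) : 0 <= s -> 0 < e ->
  nsq alpha (fun z => g (z + s%:C%C)) =
  (\int[leb]_x (vweight alpha `]0%R, e] x * m (x + s)%R) +
   \int[leb2]_(p in rhp2 e)
    (cmod (g ((p.1 +i* p.2)%C + s%:C%C)) ^+ 2 * p.1 `^ alpha)%:E)%E.
Proof.
move=> s0 e0; pose I : set R := `]0%R, e]%classic.
pose S : set (R * R) := [set p | I p.1].
have mS : measurable S.
  rewrite -[S]setTI; apply: (@measurable_fst _ _ _ _) => //.
  exact: measurable_itv.
rewrite -weighted_integralE//; last first.
  by move=> x /=; rewrite !in_itv/= andbT => /andP[].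
have SU : rhp2 0 = S `|` rhp2 e.
  apply/seteqP; split => p; rewrite /rhp2 /S /I /= in_itv /=.
    by move=> p0; have [pe|pe] := leP p.1 e; [left|right]; rewrite ?p0.
  by move=> [/andP[]//|]; exact: lt_trans.
rewrite /nsq SU ge0_integral_setU//.
- exact: measurable_rhp2.
- by rewrite -SU; exact: (measurable_nsq alpha (hcont_shift s0)).
- by move=> p _; rewrite lee_fin mulr_ge0 ?powR_ge0 ?sqr_ge0.
- apply/disj_setPS => p [] /=; rewrite /rhp2 /S /I /= in_itv /= => /andP[_ pe].
  by rewrite ltNge pe.
Qed.

(** Along the chosen shifts the part near the boundary tends to 0 and the rest to [nsq alpha g], so
    the squared norms converge. Together with pointwise convergence this yields convergence in norm
    through [scheffe_dominated]. *)
Lemma shift_approx (c e : R) : 0 < c -> 0 < e -> exists s, [/\ 0 < s, s <= c,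
  (nsq alpha (fun z => g (z + s%:C%C)%R) < +oo)%E &
  (nsq alpha (fun z => g (z + s%:C%C) - g z)%R < e%:E)%E].
Proof.
move=> c0 e0; pose ep (n : nat) := c / 2 / n.+1%:R.
have ep0 n : 0 < ep n by rewrite /ep !divr_gt0.
have epc n : 2 * ep n <= c.
  rewrite /ep mulrA (mulrC 2) divfK// ler_pdivrMr// ler_peMr ?ler1n//; exact: ltW.
have cep : ep n @[n --> \oo] --> 0.
  rewrite -(mulr0 (c / 2)); apply: cvgM; first exact: cvg_cst.
  exact: cvg_harmonic.
pose H n (s : R) := (\int[leb]_x (vweight alpha `]0%R, ep n] x * m (x + s)%R))%E.
pose B n := (C * fine (near_mass alpha g (ep n)) + ep n) / (alpha + 1).
have /choice[s Hs] n : exists s, ep n <= s <= 2 * ep n /\ (H n s <= (B n)%:E)%E.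
  by have [s s1 s2] := head_exists (ep0 n); exists s.
have s_ep n : ep n <= s n <= 2 * ep n by case: (Hs n).
have s0 n : 0 < s n by have /andP[h _] := s_ep n; exact: lt_le_trans h.
have [T_lty T_cvg] := tail_cvg ep0 s_ep cep.
have H_ge0 n : (0 <= H n (s n))%E.
  by apply: integral_ge0 => x _; rewrite mule_ge0 ?vweight_ge0 ?slice_mass_ge0.
have cB : B n @[n --> \oo] --> 0.
  rewrite -(mul0r (alpha + 1)^-1); apply: cvgM; last exact: cvg_cst.
  rewrite -(addr0 0) -{1}(mulr0 C); apply: cvgD => //.
  apply: cvgM; first exact: cvg_cst.
  apply: fine_cvg; apply: near_mass_cvg0 => //; exact: divr_gt0.
have cH : H n (s n) @[n --> \oo] --> 0%E.
  apply: (@squeeze_cvge _ _ _ _ (fun n => 0%E) _ (fun n => (B n)%:E)).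
  - by apply: nearW => n; rewrite H_ge0 (proj2 (Hs n)).
  - exact: cvg_cst.
  - by apply: cvg_EFin => //; exact: nearW.
have nsE n := nsq_shift_split (ltW (s0 n)) (ep0 n).
have ns_lty n : (nsq alpha (fun z => g (z + (s n)%:C%C)%R) < +oo)%E.
  by rewrite nsE lte_add_pinfty// (le_lt_trans (proj2 (Hs n)))// ltry.
have cs : s n @[n --> \oo] --> 0.
  apply: (@squeeze_cvgr _ _ _ _ (fun n => 0) (fun n => 2 * ep n)).
  - by apply: nearW => n; have /andP[_ ->] := s_ep n; rewrite ltW.
  - exact: cvg_cst.
  - by rewrite -(mulr0 2); apply: cvgM => //; exact: cvg_cst.
have cz p : rhp2 0 p -> forall e', 0 < e' -> \forall n \near \oo,
    cmod (g ((p.1 +i* p.2)%C + (s n)%:C%C) - g (p.1 +i* p.2)%C) < e'.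
  move=> p0 e' /(cg (z := (p.1 +i* p.2)%C) p0)[del del0 K].
  have /cvgrPdist_lt/(_ _ del0)[n0 _ L] := cs.
  exists n0 => // n /L /=; rewrite sub0r normrN => sd; apply: K.
  by rewrite addrC addKr cmod_real.
have := @scheffe_dominated _ _ R leb2 (rhp2 0) (measurable_rhp2 0)
  (fun n p => cmod (g ((p.1 +i* p.2)%C + (s n)%:C%C)) ^+ 2 * p.1 `^ alpha)
  (fun n p => cmod (g ((p.1 +i* p.2)%C + (s n)%:C%C) - g (p.1 +i* p.2)%C) ^+ 2 * p.1 `^ alpha)
  (fun p => cmod (g (p.1 +i* p.2)%C) ^+ 2 * p.1 `^ alpha).
move=> S; have [] := S _ _ _ _ _ _ _ _ _ _ _ e e0.
- by move=> n; apply/measurable_EFinP; exact: (measurable_nsq alpha (hcont_shift (ltW (s0 n)))).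
- by apply/measurable_EFinP; exact: measurable_nsq.
- move=> n; apply/measurable_EFinP.
  exact: (measurable_nsq alpha (hcontB (hcont_shift (ltW (s0 n))) cg)).
- by move=> n p _; rewrite mulr_ge0 ?powR_ge0 ?sqr_ge0.
- by move=> p _; rewrite mulr_ge0 ?powR_ge0 ?sqr_ge0.
- move=> n p _; rewrite mulr_ge0 ?powR_ge0 ?sqr_ge0//= !mulrA -mulrDl ler_wpM2r ?powR_ge0//.
  set u := g _; set v := g _.
  have D : cmod (u - v) ^+ 2 <= (cmod u + cmod v) ^+ 2.
    by rewrite ler_pXn2r// ?nnegrE ?addr_ge0 ?cmod_ge0// -(cmodN v) cmodD.
  apply: le_trans D _.
  by rewrite -subr_ge0 (_ : _ - _ = (cmod u - cmod v) ^+ 2) ?sqr_ge0//; ring.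
- move=> p p0; apply: cvgM; last exact: cvg_cst.
  have cc : cmod (g ((p.1 +i* p.2)%C + (s n)%:C%C)) @[n --> \oo] --> cmod (g (p.1 +i* p.2)%C).
    apply/cvgrPdist_lt => e' /(cz p p0) [n0 _ L]; exists n0 => // n /L /=.
    by apply: le_lt_trans; rewrite distrC; exact: cmod_dist.
  by apply: cvgM.
- move=> p p0; rewrite -(mul0r (p.1 `^ alpha)); apply: cvgM; last exact: cvg_cst.
  have cc : cmod (g ((p.1 +i* p.2)%C + (s n)%:C%C) - g (p.1 +i* p.2)%C) @[n --> \oo] --> 0.
    apply/cvgr0Pnorm_lt => e' /(cz p p0) [n0 _ L]; exists n0 => // n /L /=.
    by rewrite ger0_norm ?cmod_ge0.
  by rewrite -(mul0r 0); apply: cvgM.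
- exact: ns_lty.
- exact: ng.
- rewrite -[X in _ --> X]/(nsq alpha g) -[nsq alpha g]add0e.
  under eq_fun do rewrite -/(nsq alpha (fun z => g (z + (s _)%:C%C))) nsE.
  by apply: cvgeD => //; rewrite fin_num_adde_defr.
move=> n Hn; exists (s n); split => //.
by have /andP[_ h] := s_ep n; apply: le_trans h _.
Qed.

End ShiftConvergence.

Definition hol {R : realType} (f : R[i] -> R[i]) z := exists d, cdiff f z d.

Section HolToolkit.
Context {R : realType}.
Implicit Types (f g : R[i] -> R[i]) (z : R[i]).

Lemma holM f g z : hol f z -> hol g z -> hol (fun w => f w * g w) z.
Proof. by move=> [d df] [d' dg]; exact: cdiffM df dg. Qed.

Lemma holB f g z : hol f z -> hol g z -> hol (fun w => f w - g w) z.
Proof. by move=> [d df] [d' dg]; exact: cdiffB df dg. Qed.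

Lemma holV f z : hol f z -> f z != 0 -> hol (fun w => (f w)^-1) z.
Proof. by move=> [d df]; exact: cdiffV df. Qed.

Lemma hol_cst k z : hol (fun=> k) z.
Proof.
exists 0; rewrite (_ : (fun=> k) = (fun w => 0 * w + k)); first exact: cdiff_lin.
by apply/funext => w; rewrite mul0r add0r.
Qed.

Lemma hol_id z : hol id z.
Proof.
exists 1; rewrite (_ : id = (fun w => 1 * w + 0)); first exact: cdiff_lin.
by apply/funext => w; rewrite mul1r addr0.
Qed.

Lemma holN f z : hol f z -> hol (fun w => - f w) z.
Proof.
move=> hf; have := holB (hol_cst 0 z) hf; congr hol.
by apply/funext => w; rewrite sub0r.
Qed.

Lemma holD f g z : hol f z -> hol g z -> hol (fun w => f w + g w) z.
Proof.
move=> hf hg; have := holB hf (holN hg); congr hol.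
by apply/funext => w; rewrite opprK.
Qed.

Lemma holX f z n : hol f z -> hol (fun w => f w ^+ n) z.
Proof.
move=> hf; elim: n => [|n IH]; first exact: hol_cst.
by have := holM hf IH; congr hol; apply/funext => w; rewrite exprS.
Qed.

Lemma hol_prod (F : nat -> R[i] -> R[i]) n z : (forall j, (j < n)%N -> hol (F j) z) ->
  hol (fun w => \prod_(j < n) F j w) z.
Proof.
elim: n => [|n IH] H.
  by have := hol_cst 1 z; congr hol; apply/funext => w; rewrite big_ord0.
have := holM (IH (fun j jn => H j (ltnW jn))) (H n (ltnSn n)); congr hol.
by apply/funext => w; rewrite big_ord_recr.
Qed.

Lemma hol_sum (F : nat -> R[i] -> R[i]) n z : (forall j, (j < n)%N -> hol (F j) z) ->
  hol (fun w => \sum_(j < n) F j w) z.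
Proof.
elim: n => [|n IH] H.
  by have := hol_cst 0 z; congr hol; apply/funext => w; rewrite big_ord0.
have := holD (IH (fun j jn => H j (ltnW jn))) (H n (ltnSn n)); congr hol.
by apply/funext => w; rewrite big_ord_recr.
Qed.

Lemma hol_shift f k z : hol f (z + k) -> hol (fun w => f (w + k)) z.
Proof. by move=> [d df]; exists d; exact: cdiff_comp_shift. Qed.

Lemma hol_ccont f z : hol f z -> ccont f z.
Proof. by move=> [d]; exact: cdiff_ccont. Qed.

End HolToolkit.

(** * Rational damping factors *)

Section Damping.
Context {R : realType}.
Implicit Types (z v : R[i]) (del : R) (m : nat).

(** The shift to [z + 1] keeps the factor holomorphic and bounded by 1 on [Re z >= -1], since it is
    also evaluated at [z - s], possibly left of the imaginary axis. *)
Definition damp del m z : R[i] := ((1 + del%:C%C * (z + 1))^-1) ^+ m.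

Lemma cmod_one_add del v : 0 <= del -> 0 <= complex.Re v ->
  1 <= cmod (1 + del%:C%C * v) /\ del * cmod v <= cmod (1 + del%:C%C * v).
Proof.
move=> d0 v0; have E : cmod (1 + del%:C%C * v) ^+ 2 =
    1 + 2 * del * complex.Re v + (del * cmod v) ^+ 2.
  by rewrite exprMn !cmodE; case: v {v0} => s t /=; ring.
have h : 0 <= del * complex.Re v by rewrite mulr_ge0.
split; rewrite -(@ler_pXn2r _ 2)// ?nnegrE ?cmod_ge0 ?mulr_ge0 ?cmod_ge0// E.
  by rewrite expr1n; have := sqr_ge0 (del * cmod v); lra.
by rewrite lerDr; lra.
Qed.

Lemma one_add_neq0 del v : 0 <= del -> 0 <= complex.Re v -> 1 + del%:C%C * v != 0.
Proof.
by move=> d0 v0; rewrite -cmod_gt0 (lt_le_trans ltr01) ?(cmod_one_add d0 v0).1.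
Qed.

Lemma hol_damp del m z : 0 <= del -> -1 <= complex.Re z -> hol (damp del m) z.
Proof.
move=> d0 z0; apply: holX; apply: holV.
  apply: holD; first exact: hol_cst.
  apply: holM; first exact: hol_cst.
  by apply: holD; [exact: hol_id|exact: hol_cst].
by apply: one_add_neq0 => //; rewrite ReD /=; lra.
Qed.

Lemma cmod_damp_le1 del m z : 0 <= del -> -1 <= complex.Re z -> cmod (damp del m z) <= 1.
Proof.
move=> d0 z0; rewrite cmodX cmodV exprn_ile1 ?invr_ge0 ?cmod_ge0//.
have h : 0 <= complex.Re (z + 1) by rewrite ReD /=; lra.
by rewrite invf_le1 ?(lt_le_trans ltr01)// (cmod_one_add d0 h).1.
Qed.

Lemma cmod_pow_sub1 (x : R[i]) m : cmod x <= 1 -> cmod (x ^+ m - 1) <= m%:R * cmod (x - 1).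
Proof.
move=> x1; elim: m => [|m IH]; first by rewrite expr0 subrr cmod0 mul0r.
rewrite exprS (_ : x * x ^+ m - 1 = x * (x ^+ m - 1) + (x - 1)); last by ring.
apply: le_trans (cmodD _ _) _; rewrite -natr1 mulrDl mul1r lerD2r cmodM.
by apply: le_trans IH; rewrite ler_piMl ?cmod_ge0.
Qed.

Lemma cmod_damp_sub1 del m z : 0 <= del -> -1 <= complex.Re z ->
  cmod (damp del m z - 1) <= m%:R * (del * cmod (z + 1)).
Proof.
move=> d0 z0; have h : 0 <= complex.Re (z + 1) by rewrite ReD /=; lra.
have n0 := one_add_neq0 d0 h.
have [h1 _] := cmod_one_add d0 h.
apply: le_trans (cmod_pow_sub1 _ _) _.
  by rewrite cmodV invf_le1 ?(lt_le_trans ltr01).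
rewrite ler_wpM2l// (_ : _ - 1 = - (del%:C%C * (z + 1)) / (1 + del%:C%C * (z + 1))); last by field.
rewrite cmodM cmodV cmodN cmodM cmod_real ger0_norm// ler_piMr ?mulr_ge0 ?cmod_ge0//.
by rewrite invf_le1 ?(lt_le_trans ltr01).
Qed.

(** Dominated convergence: [|damp - 1| <= 2] everywhere gives the majorant [4 |F|^2], and the bound
    proportional to [del] gives the pointwise limit. *)
Lemma damping_approx (alpha : R) (F : R[i] -> R[i]) m (e : R) :
  (forall z, 0 < complex.Re z -> hol F z) ->
  (nsq alpha F < +oo)%E -> 0 < e -> exists2 del, 0 < del &
  (nsq alpha (fun z => F z * damp del m z - F z)%R < e%:E)%E.
Proof.
move=> hF nF e0; have cF : hcont F by move=> z z0; exact/hol_ccont/hF.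
pose del n : R := n.+1%:R^-1.
have del0 n : 0 <= del n by rewrite invr_ge0.
have cG n : hcont (fun z => F z * damp (del n) m z - F z).
  move=> z z0; apply: hol_ccont; apply: holB; last exact: hF.
  by apply: holM; [exact: hF|apply: hol_damp => //; lra].
have bound n z : 0 < complex.Re z -> cmod (F z * damp (del n) m z - F z) <=
    cmod (F z) * Num.min 2 (m%:R * (del n * cmod (z + 1))).
  move=> z0; rewrite (_ : _ - _ = F z * (damp (del n) m z - 1)); last by ring.
  rewrite cmodM ler_wpM2l ?cmod_ge0// le_min; apply/andP; split.
    apply: le_trans (cmodD _ _) _; rewrite cmodN cmod1.
    by have := @cmod_damp_le1 (del n) m z (del0 n) ltac:(lra); lra.
  by apply: cmod_damp_sub1 => //; lra.
have [] := @dominated_convergence _ _ _ leb2 (rhp2 0) (measurable_rhp2 0)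
  (fun n p => (cmod (F (p.1 +i* p.2)%C * damp (del n) m (p.1 +i* p.2)%C - F (p.1 +i* p.2)%C) ^+ 2 * p.1 `^ alpha)%:E)
  (cst 0%E) (fun p => 4%:E * (cmod (F (p.1 +i* p.2)%C) ^+ 2 * p.1 `^ alpha)%:E)%E.
- by move=> n; exact: (measurable_nsq alpha (cG n)).
- exact: measurable_cst.
- apply: aeW => p p0; apply: cvg_EFin; first exact: nearW.
  set z := (p.1 +i* p.2)%C.
  rewrite -(mul0r (p.1 `^ alpha)); apply: cvgM; last exact: cvg_cst.
  have cc : cmod (F z * damp (del n) m z - F z) @[n --> \oo] --> 0.
    apply: (@squeeze_cvgr _ _ _ _ (fun n => 0) (fun n => cmod (F z) * (m%:R * (del n * cmod (z + 1))))).
    - apply: nearW => n; rewrite cmod_ge0 /=; apply: le_trans (bound n z p0) _.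
      by rewrite ler_wpM2l ?cmod_ge0// ge_min lexx orbT.
    - exact: cvg_cst.
    - rewrite -(mulr0 (cmod (F z))); apply: cvgM; first exact: cvg_cst.
      rewrite -(mulr0 m%:R); apply: cvgM; first exact: cvg_cst.
      rewrite -(mul0r (cmod (z + 1))); apply: cvgM; last exact: cvg_cst.
      exact: cvg_harmonic.
  by rewrite -(mul0r 0); apply: cvgM.
- apply/integrableP; split; first by apply: measurable_funeM; exact: measurable_nsq.
  have nn (p : R * R) : (0 <= 4%:E * (cmod (F (p.1 +i* p.2)%C) ^+ 2 * p.1 `^ alpha)%:E)%E.
    by rewrite -EFinM lee_fin mulr_ge0// mulr_ge0 ?powR_ge0 ?sqr_ge0.
  under eq_integral => p _ do rewrite (gee0_abs (nn p)).
  rewrite ge0_integralZl//.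
  + by rewrite lte_mul_pinfty// lee_fin.
  + exact: measurable_rhp2.
  + exact: measurable_nsq.
  + by move=> p _; rewrite lee_fin mulr_ge0 ?powR_ge0 ?sqr_ge0.
- apply: aeW => p n p0; rewrite gee0_abs; last first.
    by rewrite lee_fin mulr_ge0 ?powR_ge0 ?sqr_ge0.
  rewrite -EFinM lee_fin mulrA ler_wpM2r ?powR_ge0//.
  have h := bound n (p.1 +i* p.2)%C p0.
  have {}h : cmod (F (p.1 +i* p.2)%C * damp (del n) m (p.1 +i* p.2)%C - F (p.1 +i* p.2)%C) <= cmod (F (p.1 +i* p.2)%C) * 2.
    by apply: le_trans h _; rewrite ler_wpM2l ?cmod_ge0// ge_min lexx.
  rewrite (_ : 4 * _ = (cmod (F (p.1 +i* p.2)%C) * 2) ^+ 2); last by ring.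
  by rewrite ler_pXn2r// ?nnegrE ?mulr_ge0 ?cmod_ge0.
move=> _ _; rewrite integral0 => /fine_cvgP[[n1 _ F1]].
move=> /cvgrPdist_lt/(_ _ e0)[n2 _ F2].
exists (del (maxn n1 n2)); first by rewrite invr_gt0.
have f1 := F1 (maxn n1 n2) (leq_maxl _ _); have f2 := F2 (maxn n1 n2) (leq_maxr _ _).
rewrite -[nsq _ _](fineK f1) lte_fin; apply: le_lt_trans f2.
by rewrite sub0r normrN ler_norm.
Qed.

End Damping.

(** * Cyclicity when Re b > 0 *)

Definition cintegrable {R : realType} (F : R -> R[i]) :=
  leb.-integrable setT (EFin \o (fun y => complex.Re (F y))) /\
  leb.-integrable setT (EFin \o (fun y => complex.Im (F y))).

Section ComplexIntegral.
Context {R : realType}.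
Implicit Types (F G : R -> R[i]) (c : R[i]).

Lemma cintegrableD F G : cintegrable F -> cintegrable G ->
  cintegrable (fun y => F y + G y).
Proof.
move=> [F1 F2] [G1 G2]; split.
  have := @integrableD _ _ _ leb setT measurableT _ _ F1 G1.
  by apply: eq_integrable => // y _; rewrite /= ReD.
have := @integrableD _ _ _ leb setT measurableT _ _ F2 G2.
by apply: eq_integrable => // y _; rewrite /= ImD.
Qed.

Lemma cintD F G : cintegrable F -> cintegrable G ->
  cint (fun y => F y + G y) = cint F + cint G.
Proof.
move=> [F1 F2] [G1 G2]; apply: complex_ext => /=.
  by rewrite -RintegralD//; apply: eq_Rintegral => y _; rewrite ReD.
by rewrite -RintegralD//; apply: eq_Rintegral => y _; rewrite ImD.
Qed.

Lemma integrable_scale (k : R) (f : R -> R) : leb.-integrable setT (EFin \o f) ->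
  leb.-integrable setT (EFin \o (fun y => k * f y)).
Proof. by move=> fi; have := @integrableZl _ _ _ leb setT measurableT k _ fi. Qed.

Lemma cintegrableZ c F : cintegrable F -> cintegrable (fun y => c * F y).
Proof.
move=> [F1 F2]; split.
  have := @integrableB _ _ _ leb setT measurableT _ _
    (integrable_scale (complex.Re c) F1) (integrable_scale (complex.Im c) F2).
  by apply: eq_integrable => // y _; rewrite /= ReM.
have := @integrableD _ _ _ leb setT measurableT _ _
  (integrable_scale (complex.Re c) F2) (integrable_scale (complex.Im c) F1).
by apply: eq_integrable => // y _; rewrite /= ImM.
Qed.

Lemma cintZ c F : cintegrable F -> cint (fun y => c * F y) = c * cint F.
Proof.
move=> [F1 F2]; apply: complex_ext; rewrite ?ReM ?ImM /=.
  rewrite -!RintegralZl// -RintegralB//; [|exact: integrable_scale..].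
  by apply: eq_Rintegral => y _; rewrite ReM.
rewrite -!RintegralZl// -RintegralD//; [|exact: integrable_scale..].
by apply: eq_Rintegral => y _; rewrite ImM.
Qed.

Lemma cintegrable0 : cintegrable (fun=> 0 : R[i]).
Proof. by split; exact: (@integrable0 _ _ _ leb setT). Qed.

Lemma cint0 : cint (fun=> 0 : R[i]) = 0.
Proof. by apply: complex_ext; rewrite /= /Rintegral integral0. Qed.

Lemma cint_sum n (F : nat -> R -> R[i]) : (forall k, (k < n)%N -> cintegrable (F k)) ->
  cintegrable (fun y => \sum_(k < n) F k y) /\
  cint (fun y => \sum_(k < n) F k y) = \sum_(k < n) cint (F k).
Proof.
elim: n => [|n IH] H.
  rewrite (_ : (fun y => _) = fun=> 0); last by apply/funext => y; rewrite big_ord0.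
  by rewrite big_ord0; split; [exact: cintegrable0|exact: cint0].
have [I1 I2] := IH (fun k kn => H k (ltnW kn)).
rewrite (_ : (fun y => _) = fun y => \sum_(k < n) F k y + F n y); last first.
  by apply/funext => y; rewrite big_ord_recr.
rewrite big_ord_recr /= -I2; split; first by apply: cintegrableD => //; exact: H.
by rewrite cintD//; exact: H.
Qed.

Lemma cintegrable_dominated F (h : R -> R) :
  (forall y, cont1 (fun y => complex.Re (F y)) y) ->
  (forall y, cont1 (fun y => complex.Im (F y)) y) ->
  leb.-integrable setT (EFin \o h) -> (forall y, cmod (F y) <= h y) -> cintegrable F.
Proof.
move=> cR cI ih Fh; split; apply: (le_integrable _ _ _ ih) => //.
- by apply/measurable_EFinP; apply: continuous_measurable_fun => y; exact/cont1P/cR.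
- move=> y _ /=; rewrite lee_fin; apply: le_trans (ler_norm _).
  by apply: le_trans (Fh y); exact: normr_Re_le.
- by apply/measurable_EFinP; apply: continuous_measurable_fun => y; exact/cont1P/cI.
- move=> y _ /=; rewrite lee_fin; apply: le_trans (ler_norm _).
  by apply: le_trans (Fh y); exact: normr_Im_le.
Qed.

(** The factor 2 comes from bounding real and imaginary parts separately; it does no harm to the
    limits. *)
Lemma cmod_cint_le F (h : R -> R) : cintegrable F ->
  leb.-integrable setT (EFin \o h) -> (forall y, cmod (F y) <= h y) ->
  cmod (cint F) <= 2 * \int[leb]_y h y.
Proof.
move=> [F1 F2] ih Fh; apply: le_trans (cmod_le_ReIm _) _.
rewrite mulr_natl mulr2n; apply: lerD.
  apply: le_trans (le_normr_Rintegral _ F1) _ => //.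
  apply: le_Rintegral => //; first exact: integrable_norm.
  by move=> y _; apply: le_trans (Fh y); exact: normr_Re_le.
apply: le_trans (le_normr_Rintegral _ F2) _ => //.
apply: le_Rintegral => //; first exact: integrable_norm.
by move=> y _; apply: le_trans (Fh y); exact: normr_Im_le.
Qed.

Lemma hol_vline_cintegrable (F : R[i] -> R[i]) (r : R) (h : R -> R) :
  (forall y, hol F (r +i* y)%C) -> leb.-integrable setT (EFin \o h) ->
  (forall y, cmod (F (r +i* y)%C) <= h y) -> cintegrable (fun y => F (r +i* y)%C).
Proof.
move=> hF ih Fh; apply: cintegrable_dominated ih Fh => y.
  by have [] := ccont_vline (hol_ccont (hF y)).
by have [] := ccont_vline (hol_ccont (hF y)).
Qed.

End ComplexIntegral.

(** * Membership in the Bergman space and integrability over the plane *)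

Section BergmanMembership.
Context {R : realType}.
Variables (alpha : R) (b : R[i]) (K : nat).
Hypothesis al : -1 < alpha.
Hypothesis b0 : 0 < complex.Re b.
Hypothesis alK : `|alpha| <= K%:R.

Lemma cmod_node_ge (z : R[i]) j : 0 < complex.Re z -> 1 + complex.Re z <= cmod (z + node b j).
Proof.
move=> z0; apply: le_trans (normr_Re_le _); apply: le_trans (ler_norm _).
by rewrite ReD addrC lerD2l; exact: Re_node_ge1.
Qed.

Lemma inv_oneD_le (x : R) : 0 < x -> (1 + x) ^- 2 <= (1 + x ^+ 2)^-1.
Proof.
move=> x0; have h : 0 < x ^+ 2 by rewrite exprn_gt0.
by rewrite lef_pV2 ?posrE ?exprn_gt0//; lra.
Qed.

Lemma powR_mul_le (a x : R) : a <= K%:R -> 1 <= x ->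
  x `^ a * (1 + x) ^- (2 * K.+1) <= (1 + x ^+ 2)^-1.
Proof.
move=> aK x1; have x0 : 0 < 1 + x by lra.
have h : x `^ a <= (1 + x) ^+ K.
  apply: (@le_trans _ _ (x `^ K%:R)); first exact: ler_powR.
  by rewrite powR_mulrn; [apply: lerXn2r; rewrite ?nnegrE; lra|lra].
have hx : 0 < x by lra.
apply: le_trans (inv_oneD_le hx).
have -> : (1 + x) ^- 2 = (1 + x) ^+ K * (1 + x) ^- K.+2.
  by rewrite -[K.+2]addn2 exprD; field; rewrite expf_neq0// gt_eqF.
apply: ler_pM; rewrite ?powR_ge0 ?invr_ge0 ?exprn_ge0//; [lra|].
rewrite lef_pV2 ?posrE ?exprn_gt0//; apply: ler_weXn2l; first lra.
by rewrite mulnS mul2n -addnn; lia.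
Qed.

(** The factor [1 / (z + 1)] is spent on decay in [y], and each of the other [K + 1] factors is at
    most [1 / (1 + x)]. *)
Lemma cmod2_base_fun_le (z : R[i]) : 0 < complex.Re z ->
  cmod (base_fun b K.+2 z) ^+ 2 <=
  (1 + complex.Im z ^+ 2)^-1 * (1 + complex.Re z) ^- (2 * K.+1).
Proof.
case: z => x y x0; set z := (x +i* y)%C.
have nz j : 1 + x <= cmod (z + node b j) by exact: (@cmod_node_ge z).
rewrite /= in x0.
rewrite /base_fun big_ord_recl cmodM exprMn ler_pM ?sqr_ge0//.
  rewrite cmodV exprVn lef_pV2 ?posrE ?exprn_gt0//; last 2 first.
  - by apply: lt_le_trans (nz 0); lra.
  - by rewrite ltr_pwDl ?sqr_ge0.
  rewrite cmodE /node mul0r addr0 /= addr0.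
  have := sqr_ge0 x; rewrite !expr2; nra.
have P n : cmod (\prod_(j < n) (z + node b (lift ord0 j))^-1) <= ((1 + x) ^- n).
  elim: n => [|n IH]; first by rewrite big_ord0 cmod1 expr0 invr1.
  rewrite big_ord_recr /= cmodM exprSr invfM ler_pM ?cmod_ge0//.
  have p0 : 0 < 1 + x by lra.
  by rewrite cmodV lef_pV2 ?posrE ?(lt_le_trans p0)//.
rewrite mulnC exprM -exprVn; apply: lerXn2r; rewrite ?nnegrE ?cmod_ge0//.
by rewrite invr_ge0 exprn_ge0//=; lra.
Qed.

Let B (y : R) : \bar R := ((1 + y ^+ 2)^-1)%:E.

Let q0 (y : R) : 0 < 1 + y ^+ 2. Proof. by rewrite ltr_pwDl ?sqr_ge0. Qed.

Let mB : measurable_fun setT B.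
Proof.
apply/measurable_EFinP; apply: continuous_measurable_fun.
exact: (@continuous_oneDsqrV R).
Qed.

Let B0 y : (0 <= B y)%E. Proof. by rewrite lee_fin invr_ge0 ltW. Qed.

Let iB : (\int[leb]_y B y < +oo)%E. Proof. exact: integral_oneDsqr_lty. Qed.

(** The majorant is a product: [1 / (1 + y^2)] times the weight itself for [x <= 1], where
    [alpha > -1] is used, or times [1 / (1 + x^2)] for [x > 1]. *)
Lemma nsq_base_fun_lty : (nsq alpha (base_fun b K.+2) < +oo)%E.
Proof.
pose A (x : R) : \bar R := (vweight alpha `]0%R, 1%R] x + B x)%E.
have mA : measurable_fun setT A.
  by apply: emeasurable_funD => //; exact: measurable_vweight.
have A0 x : (0 <= A x)%E by rewrite adde_ge0 ?vweight_ge0 ?B0.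
have iA : (\int[leb]_x A x < +oo)%E.
  rewrite ge0_integralD//; last by exact: measurable_vweight.
    rewrite lte_add_pinfty//.
    have h := @integral_powR_le R alpha 1 al ltr01.
    rewrite integral_mkcond in h; exact: (le_lt_trans h (ltry _)).
  by move=> x _; exact: vweight_ge0.
have hAB := integral_prod_lty mA mB A0 B0 iA iB.
apply: le_lt_trans hAB.
rewrite /nsq integral_mkcond; apply: ge0_le_integral => //.
- by move=> p _; rewrite patchE; case: ifP => // _; rewrite lee_fin mulr_ge0 ?powR_ge0 ?sqr_ge0.
- apply/(measurable_restrict _ (measurable_rhp2 _) measurableT); rewrite setTI.
  apply: measurable_nsq => z z0; apply: hol_ccont.
  apply: (hol_prod (F := fun j w => (w + node b j)^-1)) => j _; apply: holV.
    by apply: holD; [exact: hol_id|exact: hol_cst].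
  by rewrite node_neq0// ltW.
- apply: emeasurable_funM.
    exact: (measurableT_comp mA measurable_fst).
  exact: (measurableT_comp mB measurable_snd).
move=> [x y] _; rewrite patchE; case: ifPn => [/set_mem|_]; last by rewrite mule_ge0.
rewrite /rhp2 /= => x0; have /= b1 := @cmod2_base_fun_le (x +i* y)%C x0.
have b2 : cmod (base_fun b K.+2 (x +i* y)%C) ^+ 2 * x `^ alpha <=
    (1 + y ^+ 2)^-1 * (1 + x) ^- (2 * K.+1) * x `^ alpha.
  by apply: ler_wpM2r b1; exact: powR_ge0.
have [x1|x1] := leP x 1.
  apply: (@le_trans _ _ (vweight alpha `]0%R, 1%R] x * B y)%E); last first.
    by apply: lee_wpmul2r => //; rewrite leeDl.
  rewrite /vweight patchE mem_set/= ?in_itv/= ?x0//.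
  rewrite -EFinM lee_fin (le_trans b2)// mulrAC [leRHS]mulrC ler_piMr ?mulr_ge0 ?powR_ge0 ?invr_ge0 ?(ltW (q0 _))//.
  rewrite invf_le1 ?exprn_gt0//; [|lra]; rewrite exprn_ege1//; lra.
apply: (@le_trans _ _ (B x * B y)%E); last first.
  by apply: lee_wpmul2r => //; rewrite leeDr ?vweight_ge0.
rewrite -EFinM lee_fin (le_trans b2)// -mulrA mulrC ler_wpM2r ?invr_ge0 ?(ltW (q0 _))//.
rewrite mulrC; apply: powR_mul_le; last exact: ltW.
exact: le_trans (ler_norm _) alK.
Qed.

(** From [s <= 1/2], the real part of [v] is at least [(1 + x) / 2], so [|v|^2] exceeds both
    [(1 + y^2) / 4] and [(1 + x)^2 / 4]. The first bound is used once and the second [K + 1]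
    times. *)
Lemma cmod_reciprocal_le (s : R) (z : R[i]) : 0 < complex.Re z -> s <= 2^-1 ->
  (cmod (z - s%:C%C + 1))^-1 ^+ (2 * K.+2) <=
  4 ^+ K.+2 * ((1 + complex.Im z ^+ 2)^-1 * (1 + complex.Re z) ^- (2 * K.+1)).
Proof.
case: z => x y /= x0 s1; set v := ((x +i* y)%C - s%:C%C + 1).
have v2 : cmod v ^+ 2 = (x - s + 1) ^+ 2 + y ^+ 2 by rewrite cmodE /= !oppr0 !addr0.
have h : (1 + x) / 2 <= x - s + 1 by lra.
have h2 : ((1 + x) / 2) ^+ 2 <= (x - s + 1) ^+ 2 by apply: lerXn2r; rewrite ?nnegrE; lra.
have y0 : 0 <= y ^+ 2 by rewrite sqr_ge0.
have v1 : (1 + y ^+ 2) / 4 <= cmod v ^+ 2.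
  have : 1 / 4 <= ((1 + x) / 2) ^+ 2 by (rewrite expr2; nra).
  by rewrite v2; lra.
have v3 : (1 + x) ^+ 2 / 4 <= cmod v ^+ 2.
  by rewrite v2; move: h2; rewrite exprMn exprVn -natrX /=; lra.
have yp := q0 y; have xp : 0 < (1 + x) ^+ 2 by rewrite exprn_gt0//; lra.
rewrite exprVn exprM exprS.
have -> : 4 ^+ K.+2 * ((1 + y ^+ 2)^-1 * (1 + x) ^- (2 * K.+1)) =
    (((1 + y ^+ 2) / 4) * ((1 + x) ^+ 2 / 4) ^+ K.+1)^-1.
  rewrite exprM (exprS 4) expr_div_n; field.
  by rewrite !expf_neq0// ?gt_eqF//; lra.
rewrite lef_pV2 ?posrE.
- by apply: ler_pM; rewrite ?exprn_ge0 ?divr_ge0 ?(ltW yp) ?(ltW xp)//; apply: lerXn2r;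
    rewrite ?nnegrE ?sqr_ge0 ?divr_ge0 ?(ltW xp).
- have vp : 0 < cmod v ^+ 2 by apply: lt_le_trans v1; rewrite divr_gt0.
  exact: mulr_gt0 vp (exprn_gt0 _ vp).
- by rewrite mulr_gt0 ?exprn_gt0 ?divr_gt0.
Qed.

(** For [x >= 1] the power of [1 + x] beats [x ^ (- alpha)]. For [r < x < 1] the latter is at most 1
    if [alpha < 0] and at most [r ^ (- alpha)] otherwise, a bound that depends on the distance [r]
    to the boundary. *)
Lemma powRN_mul_le (r x : R) : 0 < r -> r < x ->
  x `^ (- alpha) * (1 + x) ^- (2 * K.+1) <= (1 + r `^ (- `|alpha|)) * (1 + x ^+ 2)^-1.
Proof.
move=> r0 rx; have x0 : 0 < x by lra.
have u0 : 0 <= (1 + x ^+ 2)^-1 by rewrite invr_ge0 ltW.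
have w0 := powR_ge0 r (- `|alpha|).
have [x1|x1] := leP 1 x.
  have := @powR_mul_le (- alpha) x; rewrite (le_trans (ler_norm _)) ?normrN//.
  by move=> /(_ isT x1); nra.
have [a0|a0] := leP 0 alpha.
  have : x `^ (- alpha) <= r `^ (- `|alpha|).
    rewrite ger0_norm// !powRN lef_pV2 ?posrE ?powR_gt0//.
    by apply: ge0_ler_powR => //; rewrite ?nnegrE; lra.
  have : (1 + x) ^- (2 * K.+1) <= (1 + x ^+ 2)^-1.
    rewrite (le_trans _ (inv_oneD_le x0))// lef_pV2 ?posrE ?exprn_gt0//; [|lra..].
    by apply: ler_weXn2l; [lra|lia].
  have : 0 <= (1 + x) ^- (2 * K.+1) by rewrite invr_ge0 exprn_ge0//; lra.
  have := powR_ge0 x (- alpha).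
  by move: (x `^ _) (r `^ _) w0 ((1 + x) ^- _) ((1 + x ^+ 2)^-1) u0 => p t ? u w *; nra.
have : x `^ (- alpha) <= 1.
  have <- : 1 `^ (- alpha) = 1 :> R by rewrite powR1.
  by apply: ge0_ler_powR => //; rewrite ?nnegrE; lra.
have : (1 + x) ^- (2 * K.+1) <= (1 + x ^+ 2)^-1.
  rewrite (le_trans _ (inv_oneD_le x0))// lef_pV2 ?posrE ?exprn_gt0//; [|lra..].
  by apply: ler_weXn2l; [lra|lia].
have : 0 <= (1 + x) ^- (2 * K.+1) by rewrite invr_ge0 exprn_ge0//; lra.
have := powR_ge0 x (- alpha).
by move: (x `^ _) (r `^ _) w0 ((1 + x) ^- _) ((1 + x ^+ 2)^-1) u0 => p t ? u w *; nra.
Qed.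

(** In place of Cauchy-Schwarz, [|g| w <= |g|^2 x^alpha + w^2 x^(- alpha)] with [w] the power of the
    reciprocal. The first term integrates to at most [nsq alpha g]; on [x > r] the second is at most
    a multiple of [1 / ((1 + x^2) (1 + y^2))]. *)
Lemma area_lty (g P : R[i] -> R[i]) (s r C : R) : hcont g -> (nsq alpha g < +oo)%E ->
  s <= 2^-1 -> 0 < r -> 0 <= C -> (forall z, r < complex.Re z -> ccont P z) ->
  (forall z, r < complex.Re z ->
    cmod (P z) <= C * (cmod (g z) * (cmod (z - s%:C%C + 1))^-1 ^+ K.+2)) ->
  (\int[leb2]_(p in rhp2 r) (cmod (P (p.1 +i* p.2)%C))%:E < +oo)%E.
Proof.
move=> cg ng s1 r0 C0 cP bP.
pose D := 4 ^+ K.+2 * (1 + r `^ (- `|alpha|)).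
have D0 : 0 <= D by rewrite mulr_ge0 ?exprn_ge0 ?addr_ge0 ?powR_ge0.
pose f1 (p : R * R) := (cmod (g (p.1 +i* p.2)%C) ^+ 2 * p.1 `^ alpha)%:E.
pose f2 (p : R * R) := (B p.1 * B p.2)%E.
have sub : (rhp2 r : set (R * R)) `<=` rhp2 0 by move=> p; rewrite /rhp2 /=; lra.
have mf1 : measurable_fun (rhp2 r) f1.
  exact: (measurable_funS (measurable_rhp2 _) sub (measurable_nsq alpha cg)).
have mf2 : measurable_fun setT f2.
  apply: emeasurable_funM.
    exact: (measurableT_comp mB measurable_fst).
  exact: (measurableT_comp mB measurable_snd).
have mf2' : measurable_fun (rhp2 r) f2 by apply: measurable_funTS.
have f10 p : rhp2 r p -> (0 <= f1 p)%E by move=> _; rewrite lee_fin mulr_ge0 ?powR_ge0 ?sqr_ge0.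
have f20 p : (0 <= f2 p)%E by rewrite mule_ge0.
have i1 : (\int[leb2]_(p in rhp2 r) f1 p < +oo)%E.
  apply: le_lt_trans ng; apply: ge0_subset_integral => //; try exact: measurable_rhp2.
    exact: (measurable_nsq alpha cg).
  by move=> p _; rewrite lee_fin mulr_ge0 ?powR_ge0 ?sqr_ge0.
have i2 : (\int[leb2]_(p in rhp2 r) f2 p < +oo)%E.
  apply: le_lt_trans (integral_prod_lty mB mB B0 B0 iB iB).
  by apply: ge0_subset_integral => //; exact: measurable_rhp2.
have mr := @measurable_rhp2 R r.
apply: (@le_lt_trans _ _ (\int[leb2]_(p in rhp2 r) (C%:E * f1 p + (C * D)%:E * f2 p))%E).
  apply: ge0_le_integral => //.
  - by move=> p _; rewrite lee_fin cmod_ge0.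
  - by apply/measurable_EFinP; exact: measurable_cmod.
  - by apply: emeasurable_funD; exact: measurable_funeM.
  move=> [x y]; rewrite /rhp2 /= => rx; have x0 : 0 < x by lra.
  have /= := bP (x +i* y)%C rx.
  have /= := @cmod_reciprocal_le s (x +i* y)%C x0 s1.
  set u := _^-1; rewrite mulnC exprM; set w := u ^+ _; set t := cmod (g _) => w2 h.
  rewrite /f1 /f2 /B /= -!EFinM -EFinD lee_fin; apply: le_trans h _.
  rewrite -[X in _ + X]mulrA -mulrDr; apply: ler_wpM2l => //.
  have p0 : 0 < x `^ alpha by exact: powR_gt0.
  have A1 : w ^+ 2 * x `^ (- alpha) <= D * ((1 + x ^+ 2)^-1 * (1 + y ^+ 2)^-1).
    apply: le_trans (ler_wpM2r (powR_ge0 _ _) w2) _.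
    have := powRN_mul_le r0 rx; have := q0 y; rewrite -invr_gt0.
    have : 0 < 4 ^+ K.+2 :> R by rewrite exprn_gt0.
    rewrite /D; move: (4 ^+ _) (_ `^ _) (x `^ (- _)) ((1 + x ^+ 2)^-1) ((1 + y ^+ 2)^-1) ((1 + x) ^- _) => a1 a2 a3 a4 a5 a6 h1 h5 h.
    rewrite [leLHS](_ : _ = a1 * a5 * (a3 * a6)); last by ring.
    rewrite [leRHS](_ : _ = a1 * a5 * ((1 + a2) * a4)); last by ring.
    by rewrite ler_wpM2l// mulr_ge0// ltW.
  apply: le_trans (lerD (lexx _) A1).
  rewrite powRN; set c := x `^ alpha in p0 *.
  (* Completing the square in [t * c]. *)
  rewrite -subr_ge0 (_ : _ - _ = ((t * c - 2^-1 * w) ^+ 2 + (3 / 4) * w ^+ 2) / c); last first.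
    by rewrite -/t !expr2; field; rewrite gt_eqF.
  by rewrite divr_ge0 ?(ltW p0)// addr_ge0 ?sqr_ge0// mulr_ge0 ?sqr_ge0// divr_ge0.
rewrite ge0_integralD//.
- rewrite !ge0_integralZl//; last by rewrite lee_fin mulr_ge0.
  by apply: lte_add_pinfty; apply: lte_mul_pinfty => //; rewrite lee_fin mulr_ge0.
- by move=> p rp; rewrite mule_ge0 ?f10.
- exact: measurable_funeM.
- by move=> p rp; rewrite mule_ge0 ?f20// lee_fin mulr_ge0.
- exact: measurable_funeM.
Qed.

End BergmanMembership.

(** By Fubini the integrals over vertical lines have finite total [M], so some line in [[a, b]] has
    at most [(M + 1) / (b - a)]; the [+ 1] provides the strict inequality. *)
Lemma good_line {R : realType} (P : R[i] -> R[i]) (r0 a b : R) :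
  (forall z, r0 < complex.Re z -> ccont P z) -> r0 < a -> a < b ->
  (\int[leb2]_(p in rhp2 r0) (cmod (P (p.1 +i* p.2)%C))%:E < +oo)%E ->
  exists2 r, a <= r <= b & leb.-integrable setT (fun y => (cmod (P (r +i* y)%C))%:E).
Proof.
move=> cP ra ab area; rewrite integral_mkcond in area; set F := _ \_ _ in area.
have mF : measurable_fun setT F.
  apply/(measurable_restrict _ (measurable_rhp2 _) measurableT); rewrite setTI.
  by apply/measurable_EFinP; exact: measurable_cmod.
have F0 p : (0 <= F p)%E by rewrite /F patchE; case: ifP => // _; rewrite lee_fin cmod_ge0.
rewrite fubini_tonelli1// /fubini_F in area.
set k := fun x : R => _ in area.
have k0 x : (0 <= k x)%E by apply: integral_ge0.
have mk : measurable_fun setT k by exact: measurable_fun_fubini_tonelli_F.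
have Mfin : (\int[leb]_x k x)%E \is a fin_num.
  by rewrite ge0_fin_numE// integral_ge0.
pose M := fine (\int[leb]_x k x)%E.
have M0 : 0 <= M by rewrite fine_ge0// integral_ge0.
have ba : 0 < b - a by lra.
have N0 : (0 < ((M + 1) / (b - a))%:E)%E by rewrite lte_fin divr_gt0//; lra.
have kM : (\int[leb]_(x in `[a, b]) k x <= M%:E)%E.
  by rewrite fineK//; apply: ge0_subset_integral.
have MN : (M%:E < ((M + 1) / (b - a))%:E * (b - a)%:E)%E.
  by rewrite -EFinM lte_fin divfK ?gt_eqF//; lra.
have [r rab kr] := pigeonhole ab N0 mk k0 kM MN.
exists r => //; have r0r : r0 < r by move: rab; lra.
have E : (fun y => (cmod (P (r +i* y)%C))%:E) = (fun y => F (r, y)).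
  by apply/funext => y; rewrite /F patchE mem_set.
apply/integrableP; split.
  apply/measurable_EFinP; apply: continuous_measurable_fun => y; apply/cont1P.
  by have [] := @ccont_vline _ P r y (cP (r +i* y)%C r0r).
apply: le_lt_trans (_ : (k r < +oo)%E); last exact: le_lt_trans kr (ltry _).
by rewrite le_eqVlt; apply/orP; left; apply/eqP; apply: eq_integral => y _;
  rewrite gee0_abs; [exact: (congr1 (fun f => f y) E)|rewrite lee_fin cmod_ge0].
Qed.

Lemma nsqZ {R : realType} (alpha k : R) (F : R[i] -> R[i]) : hcont F ->
  nsq alpha (fun z => k%:C%C * F z) = ((k ^+ 2)%:E * nsq alpha F)%E.
Proof.
move=> cF; rewrite /nsq -ge0_integralZl//.
- apply: eq_integral => p _; rewrite -EFinM cmodM exprMn cmod_real real_normK ?num_real//; congr EFin; ring.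
- exact: measurable_rhp2.
- exact: measurable_nsq.
- by move=> p _; rewrite lee_fin mulr_ge0 ?powR_ge0 ?sqr_ge0.
- by rewrite lee_fin sqr_ge0.
Qed.

(** * The density on the line and its Malmquist remainder *)

Section ReproducingKernel.
Context {R : realType}.
Variables (b : R[i]) (M : nat).
Hypothesis b0 : 0 < complex.Re b.

(** This is [damp / base_fun] at [z - s], and [P] is [g] times it. Of the damping order [M + M], one
    half compensates the polynomial [1 / base_fun] and the other half yields decay. *)
Definition weight_kernel (s del : R) (z : R[i]) : R[i] :=
  damp del (M + M) (z - s%:C%C) * \prod_(j < M) (z - s%:C%C + node b j).

Lemma Re_subC (z : R[i]) (s : R) : complex.Re (z - s%:C%C) = complex.Re z - s.
Proof. by rewrite ReB. Qed.

Lemma cmod_weight_kernel_le s del : 0 < del -> s <= 2^-1 -> exists2 C, 0 <= C &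
  forall z, 0 < complex.Re z ->
  cmod (weight_kernel s del z) <= C * (cmod (z - s%:C%C + 1))^-1 ^+ M.
Proof.
(* Since [|v| >= 1/2], each factor satisfies [|v + j b| <= (1 + 2 M |b|) |v|]. *)
move=> d0 s1; pose L := 1 + 2 * M%:R * cmod b.
have L0 : 0 <= L by rewrite addr_ge0// !mulr_ge0// cmod_ge0.
exists (L ^+ M * del ^- (M + M)) => [|z z0].
  by rewrite mulr_ge0 ?invr_ge0 ?exprn_ge0// ltW.
set v := z - s%:C%C + 1.
have Rv : 2^-1 <= complex.Re v by rewrite ReD Re_subC /=; lra.
have v0 : 2^-1 <= cmod v by apply: le_trans (normr_Re_le _); exact: le_trans Rv (ler_norm _).
have vp : 0 < cmod v by lra.
have F j : (j < M)%N -> cmod (z - s%:C%C + node b j) <= L * cmod v.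
  move=> jM; have -> : z - s%:C%C + node b j = v + j%:R * b by rewrite /v /node; ring.
  apply: le_trans (cmodD _ _) _; rewrite /L mulrDl mul1r lerD2l cmodM.
  have -> : cmod (j%:R : R[i]) = j%:R.
    have -> : (j%:R : R[i]) = (j%:R : R)%:C%C by rewrite rmorph_nat.
    by rewrite cmod_real ger0_norm.
  have : j%:R * cmod b <= M%:R * cmod b by rewrite ler_wpM2r ?cmod_ge0// ler_nat ltnW.
  have : 0 <= M%:R * cmod b by rewrite mulr_ge0 ?cmod_ge0.
  by rewrite -(mulrA 2); move: (M%:R * _) (j%:R * _) => p q; nra.
have P n : (n <= M)%N -> cmod (\prod_(j < n) (z - s%:C%C + node b j)) <= (L * cmod v) ^+ n.
  elim: n => [|n IH] nM; first by rewrite big_ord0 cmod1.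
  rewrite big_ord_recr /= cmodM exprSr ler_pM ?cmod_ge0 ?F//; exact/IH/ltnW.
have [_ D1] := cmod_one_add (ltW d0) (le_trans (ltac:(lra) : 0 <= 2^-1) Rv).
have D : cmod (damp del (M + M) (z - s%:C%C)) <= (del * cmod v) ^- (M + M).
  rewrite cmodX cmodV -exprVn; apply: lerXn2r; rewrite ?nnegrE ?invr_ge0 ?cmod_ge0 ?mulr_ge0 ?cmod_ge0 ?(ltW d0)//.
  by rewrite lef_pV2 ?posrE// ?(lt_le_trans _ D1)// mulr_gt0.
rewrite cmodM; apply: le_trans (ler_pM (cmod_ge0 _) (cmod_ge0 _) D (P M (leqnn M))) _.
rewrite le_eqVlt; apply/orP; left; apply/eqP.
rewrite !exprMn !exprD exprVn; field.
by rewrite !expf_neq0 ?gt_eqF.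
Qed.

Lemma hol_weight_kernel s del z : 0 < del -> s <= 2^-1 -> 0 < complex.Re z ->
  hol (weight_kernel s del) z.
Proof.
move=> d0 s1 z0; apply: holM.
  apply: (hol_shift (f := damp del (M + M))); apply: hol_damp; first exact: ltW.
  by rewrite Re_subC; lra.
apply: (hol_prod (F := fun j w => w - s%:C%C + node b j)) => j _.
by apply: holD; [apply: holB; [exact: hol_id|exact: hol_cst]|exact: hol_cst].
Qed.

Lemma base_fun_weight_kernel s del z : 0 < complex.Re z ->
  base_fun b M z * weight_kernel s del (z + s%:C%C) = damp del (M + M) z.
Proof.
move=> z0; rewrite /weight_kernel addrK mulrCA /base_fun -big_split /= big1 ?mulr1// => j _.
by rewrite mulVf// node_neq0// ltW.
Qed.

Lemma hol_reflect (c k z : R[i]) : hol (fun w => c - w + k) z.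
Proof. by apply: holD; [apply: holB; [exact: hol_cst|exact: hol_id]|exact: hol_cst]. Qed.

Let reflect_pole_neq0 (c z : R[i]) n : complex.Re z < complex.Re c ->
  c - z + conjc (pole b M n) != 0.
Proof.
move=> zc; have p1 := Re_node_ge1 b0 (M + n).
have : 0 < complex.Re (c - z + conjc (pole b M n)).
  by rewrite ReD ReB; move: p1; rewrite /pole; case: (node _ _) => u v /=; lra.
by apply: contraTneq => ->; rewrite ltxx.
Qed.

Lemma hol_dual_blaschke_reflect n (c z : R[i]) : complex.Re z < complex.Re c ->
  hol (fun w => dual_blaschke b M n (c - w)) z.
Proof.
move=> zc.
apply: (hol_prod (F := fun j w => (c - w - pole b M j) / (c - w + conjc (pole b M j)))) => j _.
apply: holM; first exact: hol_reflect.
by apply: holV; [exact: hol_reflect|exact: reflect_pole_neq0].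
Qed.

Lemma hol_malmquist_coef_reflect n (c z : R[i]) : complex.Re z < complex.Re c ->
  hol (fun w => malmquist_coef b M n (c - w)) z.
Proof.
move=> zc; apply: holM; last exact: hol_dual_blaschke_reflect.
apply: holM; first exact: hol_cst.
by apply: holV; [exact: hol_reflect|exact: reflect_pole_neq0].
Qed.

Lemma cmod_malmquist_coef_le n w : 0 <= complex.Re w -> cmod (malmquist_coef b M n w) <= 2.
Proof.
move=> w0; rewrite cmodM -[leRHS]mulr1; apply: ler_pM; rewrite ?cmod_ge0//; last first.
  exact: cmod_dual_blaschke_le1.
have p1 := Re_node_ge1 b0 (M + n).
rewrite cmodM cmodV cmod_real.
have h : complex.Re (pole b M n) <= cmod (w + conjc (pole b M n)).
  apply: le_trans (normr_Re_le _); apply: le_trans (ler_norm _).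
  have -> : complex.Re (w + conjc (pole b M n)) = complex.Re w + complex.Re (pole b M n).
    by rewrite ReD; case: (pole _ _ _).
  by rewrite lerDr.
have p0 : 0 < complex.Re (pole b M n) by exact: lt_le_trans ltr01 p1.
rewrite ger0_norm; last by rewrite mulr_ge0// ltW.
by rewrite ler_pdivrMr ?(lt_le_trans p0)// ler_wpM2l.
Qed.

Lemma hol_base_fun z : 0 < complex.Re z -> hol (base_fun b M) z.
Proof.
move=> z0; apply: (hol_prod (F := fun j w => (w + node b j)^-1)) => j _; apply: holV.
  by apply: holD; [exact: hol_id|exact: hol_cst].
by rewrite node_neq0// ltW.
Qed.

Lemma hol_malmquist n z : 0 < complex.Re z -> hol (malmquist b M n) z.
Proof.
move=> z0; have N j : hol (fun w => (w + pole b M j)^-1) z.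
  apply: holV; first by apply: holD; [exact: hol_id|exact: hol_cst].
  by rewrite node_neq0// ltW.
apply: holM => //; apply: holM; first exact: hol_base_fun.
apply: (hol_prod (F := fun j w => (w - conjc (pole b M j)) / (w + pole b M j))) => j _.
by apply: holM => //; apply: holB; [exact: hol_id|exact: hol_cst].
Qed.

(** The products are at most 1 in modulus and tend to 0 pointwise on the line; [scheffe_dominated]
    with a constant sequence [A] acts here as dominated convergence. *)
Lemma dual_blaschke_remainder_small (P : R[i] -> R[i]) (s r e : R) :
  (forall z, complex.Re z = r -> hol P z) -> r < s -> 0 < e ->
  leb.-integrable setT (fun y => (cmod (P (r +i* y)%C))%:E) ->
  exists n, leb.-integrable setT (fun y => (cmod (P (r +i* y)%C) *
      cmod (dual_blaschke b M n (s%:C%C - (r +i* y)%C)))%:E) /\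
    \int[leb]_y (cmod (P (r +i* y)%C) *
      cmod (dual_blaschke b M n (s%:C%C - (r +i* y)%C))) < e.
Proof.
move=> hP rs e0 line.
pose A y := cmod (P (r +i* y)%C).
pose E n y := A y * cmod (dual_blaschke b M n (s%:C%C - (r +i* y)%C)).
have Rw y : complex.Re (s%:C%C - (r +i* y)%C) = s - r by rewrite ReB.
have E0 n y : 0 <= E n y by rewrite mulr_ge0 ?cmod_ge0.
have EA n y : E n y <= A y.
  rewrite /E ler_piMr ?cmod_ge0//; apply: cmod_dual_blaschke_le1 => //.
  by rewrite Rw subr_ge0 ltW.
have E2 n (y : R) : 0 <= E n y <= 2 * A y + 2 * A y.
  have A0 : 0 <= A y by exact: cmod_ge0.
  by rewrite E0 /=; have := EA n y; move: (E n y) (A y) A0 => u v; lra.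
have mA : measurable_fun setT A by apply/measurable_EFinP; exact: measurable_int line.
have mE n : measurable_fun setT (E n).
  rewrite (_ : E n = fun y => cmod (P (r +i* y)%C * dual_blaschke b M n (s%:C%C - (r +i* y)%C))).
    apply: continuous_measurable_fun => y; apply/cont1P.
    have := @ccont_vline _ (fun w => P w * dual_blaschke b M n (s%:C%C - w)) r y.
    case=> //; apply: hol_ccont; apply: holM; first exact: hP.
    exact: hol_dual_blaschke_reflect.
  by apply/funext => y; rewrite cmodM.
have Afin : (\int[leb]_y (A y)%:E < +oo)%E.
  have /integrableP[_] := line; congr (_ < _)%E; apply: eq_integral => y _.
  by rewrite gee0_abs// lee_fin cmod_ge0.
have := @scheffe_dominated _ _ R leb setT measurableT (fun=> A) E A.
move=> S; have [] := S _ _ _ _ _ _ _ _ _ _ _ e e0 => //.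
- by move=> n y _; exact: cmod_ge0.
- by move=> y _; exact: cmod_ge0.
- by move=> y yT; exact: cvg_cst.
- move=> y yT; rewrite -(mulr0 (A y)); apply: cvgM; first exact: cvg_cst.
  by apply: dual_blaschke_cvg0 => //; rewrite Rw subr_gt0.
- exact: cvg_cst.
move=> n En; exists n; have iE : leb.-integrable setT (EFin \o E n).
  apply/integrableP; split; first by apply/measurable_EFinP; exact: mE.
  apply: le_lt_trans (lt_trans En (ltry _)); rewrite le_eqVlt; apply/orP; left; apply/eqP.
  by apply: eq_integral => y _; rewrite gee0_abs// lee_fin.
split=> //; rewrite -lte_fin /Rintegral fineK//.
exact: integrable_fin_num iE.
Qed.

End ReproducingKernel.

(** * Approximation by translates of the cyclic vector *)

Section Sufficiency.
Context {R : realType}.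
Variables (alpha : R) (b : R[i]) (K : nat).
Hypothesis al : -1 < alpha.
Hypothesis b0 : 0 < complex.Re b.
Hypothesis alK : `|alpha| <= K%:R.
Let M := K.+2.

(** Integrating [cauchy_expansion] against [P] along the line turns the sum into a combination [h]
    of Malmquist functions. The remainder is at most [C1 * e'] times [|base_fun z|] for all [z] at
    once, hence small in norm. *)
Lemma newton_approx (g : R[i] -> R[i]) (s del e : R) :
  (forall z, 0 < complex.Re z -> hol g z) -> (nsq alpha g < +oo)%E ->
  0 < s -> s <= 2^-1 -> 0 < del -> 0 < e -> exists n h,
  [/\ newton_span b M n h, hcont h &
      (nsq alpha (fun z => h z - g (z + s%:C%C) * damp del (M + M) z)%R < e%:E)%E].
Proof.
move=> hg ng s0 s1 d0 e0.
pose P z := g z * weight_kernel b M s del z.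
have hP z : 0 < complex.Re z -> hol P z.
  by move=> z0; apply: holM; [exact: hg|exact: hol_weight_kernel].
have PE z : P z = g z * weight_kernel b M s del z by [].
clearbody P.
have cg : hcont g by move=> z z0; apply: hol_ccont; exact: hg.
have [C C0 HC] := cmod_weight_kernel_le b M d0 s1.
have area : (\int[leb2]_(p in rhp2 (s / 4)) (cmod (P (p.1 +i* p.2)%C))%:E < +oo)%E.
  have s4 : 0 < s / 4 by lra.
  apply: (area_lty al b0 alK cg ng s1 s4 C0).
  - by move=> z sz; apply: hol_ccont; apply: hP; lra.
  move=> z sz; rewrite PE cmodM mulrCA ler_wpM2l ?cmod_ge0//; apply: HC; lra.
have cP z : s / 4 < complex.Re z -> ccont P z.
  by move=> sz; apply: hol_ccont; apply: hP; lra.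
(* The line must lie strictly between [Re = 0], where control of [P] is lost, and [Re = s], so that
   [z + s] is to its right. The fractions of [s] only leave room for averaging. *)
have sa : s / 4 < s / 3 by lra.
have sb : s / 3 < 2 * s / 3 by lra.
have [r rs line] := good_line cP sa sb area.
have r0 : 0 < r by move: rs; lra.
have sr : 0 < s - r by move: rs; lra.
(* The Cauchy kernel at [z + s] is [1 / (z + W y)], and [Re (W y) > 0] as [cauchy_expansion]
   requires. *)
pose W y : R[i] := s%:C%C - (r +i* y)%C.
have ReW y : complex.Re (W y) = s - r by rewrite ReB.
have ReW0 y : 0 <= complex.Re (W y) by rewrite ReW ltW.
have Rline y : 0 < complex.Re (r +i* y)%C by [].
have Rlt y : complex.Re (r +i* y)%C < complex.Re (s%:C%C : R[i]) by rewrite /=; lra.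
have CL z : 0 < complex.Re z ->
    cint (fun y => P (r +i* y)%C / (z + W y)) = (2 * pi)%:C%C * P (z + s%:C%C).
  move=> z0; rewrite -(cauchy_line (r := r)) //; first 1 last.
  - by rewrite ReD /=; lra.
  - by move=> w rw; apply: hP; lra.
  - apply: le_lt_trans area; apply: ge0_subset_integral => //; try exact: measurable_rhp2.
    + apply/measurable_EFinP; apply: measurable_cmod => w sw.
      by apply: hol_ccont; apply: hP; lra.
    + by move=> p _; rewrite lee_fin cmod_ge0.
    + by move=> p; rewrite /rhp2 /=; move: rs; lra.
  by congr cint; apply/funext => y; rewrite /W addrA.
have nb : (nsq alpha (base_fun b M) < +oo)%E by exact: nsq_base_fun_lty.
have nbf : nsq alpha (base_fun b M) \is a fin_num by rewrite ge0_fin_numE ?nsq_ge0.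
pose N := fine (nsq alpha (base_fun b M)).
have N0 : 0 <= N by rewrite fine_ge0 ?nsq_ge0.
(* This is [2 / (2 * pi * (s - r))]: the numerator comes from [cmod_cint_le], [2 * pi] from Cauchy's
   formula, and [s - r] is the lower bound of [|z + W y|]. *)
pose C1 : R := (pi * (s - r))^-1.
have C10 : 0 < C1 by rewrite invr_gt0 mulr_gt0 ?pi_gt0.
have D0 : 0 < C1 ^+ 2 * N + 1 by rewrite ltr_wpDl// mulr_ge0 ?sqr_ge0.
(* The minimum with 1 gives [e' ^ 2 <= e'], so that the final [C1 ^ 2 * e' ^ 2 * N] is at most
   [e / 2]. *)
pose e' := Num.min 1 (e / (2 * (C1 ^+ 2 * N + 1))).
have e'0 : 0 < e' by rewrite lt_min ltr01 divr_gt0// mulr_gt0.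
have [n [iE En]] := @dual_blaschke_remainder_small _ b M b0 P s r e'
  (fun z zr => hP z (eq_ind_r (fun t => 0 < t) r0 zr)) (ltac:(lra) : r < s) e'0 line.
pose E (y : R) := cmod (P (r +i* y)%C) * cmod (dual_blaschke b M n (W y)).
rewrite -[X in integrable _ _ X]/(EFin \o E) in iE.
pose dlt := \int[leb]_y E y.
rewrite -/dlt in En.
have dlt0 : 0 <= dlt.
  by apply: Rintegral_ge0 => y _; rewrite mulr_ge0 ?cmod_ge0.
pose q k := ((2 * pi)^-1 : R)%:C%C * cint (fun y => P (r +i* y)%C * malmquist_coef b M k (W y)).
pose h z := \sum_(k < n) q k * malmquist b M k z.
have iC k : cintegrable (fun y => P (r +i* y)%C * malmquist_coef b M k (W y)).
  apply: (@hol_vline_cintegrable _ (fun w => P w * malmquist_coef b M k (s%:C%C - w)) r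
    (fun y => 2 * cmod (P (r +i* y)%C))).
  - by move=> y; apply: holM; [exact: hP|apply: hol_malmquist_coef_reflect].
  - exact: integrable_scale line.
  - by move=> y; rewrite cmodM mulrC ler_wpM2r ?cmod_ge0// cmod_malmquist_coef_le// -/(W y).
have two_pi : (2 * pi)%:C%C != 0 :> R[i].
  by rewrite -cmod_gt0 cmod_real ger0_norm ?mulr_gt0 ?mulr_ge0 ?pi_ge0 ?pi_gt0.
have bound z : 0 < complex.Re z ->
    cmod (h z - g (z + s%:C%C) * damp del (M + M) z) <=
    cmod ((C1 * e')%:C%C * base_fun b M z).
  (* At fixed [z], this is what the first [n] Malmquist terms leave of the integrand, as a
     holomorphic function of the point on the line. *)
  move=> z0; pose rem w := P w * (base_fun b M z * blaschke b M n z *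
    (dual_blaschke b M n (s%:C%C - w) / (z + (s%:C%C - w)))).
  have zW y : 0 < complex.Re (z + W y) by rewrite ReD ReW addr_gt0.
  have zW0 y : s - r <= cmod (z + W y).
    apply: le_trans (normr_Re_le _); apply: le_trans (ler_norm _).
    by rewrite ReD ReW lerDr ltW.
  pose k0 := cmod (base_fun b M z) / (s - r).
  have ir : leb.-integrable setT (EFin \o (fun y => k0 * E y)) by exact: integrable_scale iE.
  have br y : cmod (rem (r +i* y)%C) <= k0 * E y.
    rewrite /rem !cmodM cmodV -/(W y) /k0 /E -/(W y).
    have B1 : cmod (blaschke b M n z) <= 1 by apply: cmod_blaschke_le1 => //; exact: ltW.
    have Z1 : (cmod (z + W y))^-1 <= (s - r)^-1.
      by rewrite lef_pV2 ?posrE// (lt_le_trans sr).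
    have Z0 : 0 <= (cmod (z + W y))^-1 by rewrite invr_ge0 cmod_ge0.
    have X0 : 0 <= cmod (P (r +i* y)%C) * cmod (base_fun b M z) * cmod (dual_blaschke b M n (W y)).
      by rewrite !mulr_ge0 ?cmod_ge0.
    have BZ : cmod (blaschke b M n z) * (cmod (z + W y))^-1 <= 1 * (s - r)^-1.
      by apply: ler_pM => //; exact: cmod_ge0.
    have := ler_wpM2l X0 BZ; congr (_ <= _); ring.
  have hr y : hol rem (r +i* y)%C.
    apply: holM; first exact: hP.
    apply: holM; first exact: hol_cst.
    apply: holM; first exact: hol_dual_blaschke_reflect.
    apply: holV.
      apply: holD; first exact: hol_cst.
      by apply: holB; [exact: hol_cst|exact: hol_id].
    by rewrite -/(W y) -cmod_gt0 (lt_le_trans sr).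
  have irem := hol_vline_cintegrable hr ir br.
  have := cmod_cint_le irem ir br.
  have [iS cS] := @cint_sum _ n (fun k y => malmquist b M k z * (P (r +i* y)%C * malmquist_coef b M k (W y)))
    (fun k _ => cintegrableZ _ (iC k)).
  have split : cint (fun y => rem (r +i* y)%C) =
      (2 * pi)%:C%C * (g (z + s%:C%C) * damp del (M + M) z - h z).
    have -> : (2 * pi)%:C%C * (g (z + s%:C%C) * damp del (M + M) z - h z) =
        base_fun b M z * ((2 * pi)%:C%C * P (z + s%:C%C)) - (2 * pi)%:C%C * h z.
      by rewrite -(base_fun_weight_kernel M b0 s del z0) PE; ring.
    rewrite -(CL z z0).
    have iP : cintegrable (fun y => P (r +i* y)%C / (z + W y)).
      apply: (@hol_vline_cintegrable _ (fun w => P w / (z + (s%:C%C - w))) r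
        (fun y => (s - r)^-1 * cmod (P (r +i* y)%C))).
      - move=> y; apply: holM; first exact: hP.
        apply: holV.
          apply: holD; first exact: hol_cst.
          by apply: holB; [exact: hol_cst|exact: hol_id].
        by rewrite -/(W y) -cmod_gt0 (lt_le_trans sr).
      - exact: integrable_scale line.
      - move=> y; rewrite cmodM mulrC ler_wpM2r ?cmod_ge0// cmodV -/(W y).
        by rewrite lef_pV2 ?posrE// (lt_le_trans sr).
    rewrite -(cintZ _ iP).
    have -> : (fun y => base_fun b M z * (P (r +i* y)%C / (z + W y))) =
        (fun y => \sum_(k < n) malmquist b M k z * (P (r +i* y)%C * malmquist_coef b M k (W y)) +
          rem (r +i* y)%C).
      have RW y : 0 < complex.Re (W y) by rewrite ReW.
      apply/funext => y; rewrite mulrCA (@cauchy_expansion _ b M b0 n z (W y) z0 (RW y)).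
      rewrite mulrDr mulr_sumr; congr (_ + _); apply: eq_bigr => k _; ring.
    rewrite cintD// cS.
    have -> : (2 * pi)%:C%C * h z =
        \sum_(k < n) cint (fun y => malmquist b M k z * (P (r +i* y)%C * malmquist_coef b M k (W y))).
      rewrite /h mulr_sumr; apply: eq_bigr => k _; rewrite (cintZ _ (iC k)) /q.
      have -> : ((2 * pi)^-1 : R)%:C%C = ((2 * pi)%:C%C)^-1 :> R[i].
        by rewrite fmorphV.
      move: (cint _) (malmquist _ _ _ _) => u v.
      by rewrite -!mulrA mulVKf// mulrC.
    by rewrite addrC addKr.
  rewrite split cmodM cmod_real ger0_norm; last by rewrite mulr_ge0 ?pi_ge0.
  rewrite RintegralZl//.
  rewrite -/dlt -cmodN opprB => H.
  rewrite cmodM cmod_real ger0_norm; last by rewrite mulr_ge0// ltW.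
  have pi0 := pi_gt0 R.
  have -> : C1 * e' * cmod (base_fun b M z) = (2 * pi)^-1 * (2 * (k0 * e')).
    rewrite /C1 /k0; move: (pi : R) (gt_eqF pi0) => p p0; field.
    by rewrite p0 (gt_eqF sr).
  rewrite ler_pdivlMl ?mulr_gt0//; apply: le_trans H _.
  rewrite ler_pM2l// ler_wpM2l//; last exact: ltW.
  by rewrite /k0 divr_ge0 ?cmod_ge0// ltW.
have hh : hcont h.
  move=> z z0; apply: hol_ccont.
  apply: (hol_sum (F := fun k w => q k * malmquist b M k w)) => k _.
  by apply: holM; [exact: hol_cst|exact: hol_malmquist].
exists n, h; split => //.
  apply: (newton_span_sum (e := fun k w => q k * malmquist b M k w)) => k kn.
  by apply: newton_spanZ; apply: newton_span_leq kn _; exact: malmquist_span.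
have cb : hcont (base_fun b M) by move=> z z0; apply: hol_ccont; exact: hol_base_fun.
apply: (@le_lt_trans _ _ (nsq alpha (fun z => (C1 * e')%:C%C * base_fun b M z)%R)).
  apply: le_nsq => //.
  - apply: hcontB => // z z0; apply: hol_ccont; apply: holM.
      by apply: hol_shift; apply: hg; rewrite ReD /=; lra.
    by apply: hol_damp; [exact: ltW|lra].
  - by move=> z z0; apply: hol_ccont; apply: holM; [exact: hol_cst|exact: hol_base_fun].
rewrite nsqZ// -(fineK nbf) -/N -EFinM lte_fin exprMn.
have e1 : e' <= 1 by rewrite ge_min lexx.
have e2 : e' <= e / (2 * (C1 ^+ 2 * N + 1)) by rewrite ge_min lexx orbT.
apply: (@le_lt_trans _ _ (e' * (C1 ^+ 2 * N + 1))).
  have : e' ^+ 2 <= e' by rewrite expr2 ger_pMr.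
  have : 0 <= C1 ^+ 2 * N by rewrite mulr_ge0 ?sqr_ge0.
  by move: (e' ^+ 2) (C1 ^+ 2) => u v; nra.
apply: (@le_lt_trans _ _ (e / 2)); last by rewrite ltr_pdivrMr// ltr_pMr// ltr1n.
rewrite -ler_pdivlMr// (le_trans e2)// invfM mulrA.
exact: lexx.
Qed.

End Sufficiency.

Lemma iter_composition_operator {R : realType} (b : R[i]) (f : R[i] -> R[i]^o) k z :
  iter k (composition_operator (fun w : R[i] => w + b)) f z = f (z + k%:R * b).
Proof.
elim: k z => [|k IH] z; first by rewrite mul0r addr0.
by rewrite iterS /composition_operator /= IH -natr1 mulrDl mul1r addrA addrAC.
Qed.

Lemma cyclic_of_Re_gt0 {R : realType} (alpha : R) (b : R[i]) :
  -1 < alpha -> 0 < complex.Re b ->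
  bergman_cyclic alpha (composition_operator (fun w : R[i] => w + b)).
Proof.
move=> al b0; pose K := (Num.truncn `|alpha|).+1.
have alK : `|alpha| <= K%:R by exact/ltW/truncnS_gt.
pose M := K.+2; pose f : R[i] -> R[i]^o := newton_fun b M 0.
have holf z : 0 < complex.Re z -> hol f z.
  move=> z0; apply: (hol_prod (F := fun j w => (w + node b (0 + j))^-1)) => j _; apply: holV.
    by apply: holD; [exact: hol_id|exact: hol_cst].
  by rewrite node_neq0// ltW.
have cont_of_hol F : (forall z, 0 < complex.Re z -> hol F z) -> hcont F.
  by move=> hF z z0; apply: hol_ccont; exact: hF.
exists f; split.
- split; first by move=> z z0; have [d] := holf z z0; exact: cdiff_derivable.
  apply/bergman_norm_lty; apply: le_lt_trans (nsq_base_fun_lty al b0 alK).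
  apply: le_nsq; [exact: cont_of_hol|by apply: cont_of_hol => z; exact: hol_base_fun|].
  move=> z z0; rewrite /f /newton_fun big_ord_recr /= cmodM -[leRHS]mulr1 ler_pM ?cmod_ge0//.
  have nz := cmod_node_ge b0 M z0.
  by rewrite add0n cmodV invf_le1 ?(lt_le_trans _ nz)//; [apply: le_trans nz|]; rewrite ?lerDl ?ltr_pwDl// ltW.
- exists 1; first by rewrite /right_half_plane /= ltr01.
  by apply/prodf_neq0 => j _; rewrite invr_eq0 node_neq0//= ler01.
move=> g [holg ng] e e0.
have hg z : 0 < complex.Re z -> hol g z.
  by move=> z0; have [d] := derivable_cdiff (holg z z0); exists d.
have {}ng := (bergman_norm_lty alpha g).1 ng.
(* [nsqD_lt] is chained: the Newton and damping errors, each below [e^2 / 16], combine to less than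
   [e^2 / 4] and are then joined to the shift error. *)
have e4 : 0 < e ^+ 2 / 4 by rewrite divr_gt0// exprn_gt0.
have e16 : 0 < e ^+ 2 / 4 / 4 by rewrite divr_gt0.
have cg : hcont g by exact: cont_of_hol.
have [s [s0 s1 ngs As]] := shift_approx al cg ng (ltac:(by rewrite invr_gt0) : 0 < 2^-1) e4.
have hgs z : 0 < complex.Re z -> hol (fun w => g (w + s%:C%C)) z.
  by move=> z0; apply: hol_shift; apply: hg; rewrite ReD addr_gt0.
have [del d0 Ad] := damping_approx (M + M) hgs ngs e16.
have [n [h [[c hc] ch Ah]]] := newton_approx al b0 alK hg ng s0 s1 d0 e16.
pose T := composition_operator (fun w : R[i] => w + b).
exists (\sum_(k < n) c k *: iter k T f); first by exists n, (fun k : 'I_n => c k).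
apply/bergman_norm_lt => //.
have hE z : 0 < complex.Re z -> (\sum_(k < n) c k *: iter k T f) z = h z.
  move=> z0; rewrite hc// fct_sumE; apply: eq_bigr => k _.
  by rewrite newton_fun_shift -/f -(iter_composition_operator b f).
pose G z := g (z + s%:C%C); pose D z := G z * damp del (M + M) z.
have cG : hcont G by exact: cont_of_hol.
have cD : hcont D.
  apply: cont_of_hol => z z0; apply: holM; first exact: hgs.
  by apply: hol_damp; [exact: ltW|apply: le_trans (ltW z0); rewrite oppr_le0].
have S := nsqD_lt (hcontB cD cG) (hcontB cG cg).
have S2 := nsqD_lt (hcontB ch cD) (hcontB cD cG) Ah Ad.
have S1 := nsqD_lt (hcontD (hcontB ch cD) (hcontB cD cG)) (hcontB cG cg) S2 As.
apply: le_lt_trans S1; rewrite le_eqVlt; apply/orP; left; apply/eqP.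
apply: eq_integral => p; rewrite inE => p0; congr ((_ ^+ 2 * _)%:E).
have -> : (g - \sum_(k < n) c k *: iter k T f) (p.1 +i* p.2)%C =
  g (p.1 +i* p.2)%C - (\sum_(k < n) c k *: iter k T f) (p.1 +i* p.2)%C by [].
by rewrite hE// -cmodN opprB; congr cmod; ring.
Qed.

(** * Non-cyclicity when Re b = 0 *)

Section ExponentialWeight.
Context {R : realType}.
Implicit Types (z w : R[i]) (tau : R).

Lemma derive0_approx (f : R -> R) (a e : R) : is_derive (0 : R) 1 f a -> 0 < e ->
  exists2 del : R, 0 < del & forall x, `|x| < del -> `|f x - f 0 - a * x| <= e * `|x|.
Proof.
move=> /is_derive1_caratheodory[g [fE /cont1P gc g0]] /gc[del d0 H]; exists del => // x xd.
have := H x; rewrite subr0 g0 => /(_ xd)/ltW gx.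
by rewrite fE subr0 -mulrBl normrM ler_wpM2r.
Qed.

(** The function [exp (- z)] in real coordinates; the sign makes it bounded by 1 on the right
    half-plane. *)
Definition exp_opp z : R[i] :=
  (expR (- complex.Re z) * cos (complex.Im z) +i*
   (- (expR (- complex.Re z) * sin (complex.Im z))))%C.

Lemma exp_oppD z w : exp_opp (z + w) = exp_opp z * exp_opp w.
Proof.
apply: complex_ext; rewrite ?ReM ?ImM /exp_opp /= ReD ImD opprD expRD ?cosD ?sinD; ring.
Qed.

Lemma exp_opp0 : exp_opp 0 = 1.
Proof. by apply: complex_ext; rewrite /exp_opp /= oppr0 expR0 ?cos0 ?sin0 ?mulr0 ?oppr0 ?mulr1. Qed.

Lemma exp_opp_conj z : exp_opp (conjc z) = conjc (exp_opp z).
Proof.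
by case: z => x y; apply: complex_ext; rewrite /exp_opp /= ?cosN ?sinN// mulrN.
Qed.

Lemma cmod_exp_opp_le1 z : 0 <= complex.Re z -> cmod (exp_opp z) <= 1.
Proof.
move=> z0; rewrite -(@ler_pXn2r _ 2) ?nnegrE ?cmod_ge0// expr1n cmodE /=.
rewrite sqrrN !exprMn -mulrDr cos2Dsin2 mulr1.
by rewrite exprn_ile1 ?expR_ge0// -expR0 ler_expR oppr_le0.
Qed.

Lemma cdiff_exp_opp0 : cdiff exp_opp 0 (-1).
Proof.
(* Real and imaginary parts each err by at most [3 * e' * |w|]. The minimum with 1 keeps
   [expR (- x)] below 2. *)
move=> e e0; pose e' := Num.min 1 e / 6.
have e'0 : 0 < e' by rewrite divr_gt0// lt_min ltr01.
have [e'1 e'e] : e' <= 1 / 6 /\ 6 * e' <= e.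
  have : Num.min 1 e <= 1 by rewrite ge_min lexx.
  have : Num.min 1 e <= e by rewrite ge_min lexx orbT.
  by rewrite /e'; move: (Num.min 1 e) => m; lra.
have [d1 d10 H1] := derive0_approx (is_derive_expR 0) e'0.
have [d2 d20 H2] := derive0_approx (is_derive_cos 0) e'0.
have [d3 d30 H3] := derive0_approx (is_derive_sin 0) e'0.
exists (Num.min (e' / 2) (Num.min d1 (Num.min d2 d3))); first by rewrite !lt_min d10 d20 d30 divr_gt0.
move=> w; rewrite subr0 !lt_min => /and4P[w0 w1 w2 w3].
rewrite exp_opp0 mulNr mul1r opprK; apply: le_trans (cmod_le_ReIm _) _.
have := normr_Re_le w; have := normr_Im_le w; move: w0 w1 w2 w3; move: (cmod w) => c.
case: w => x y /= c0 c1 c2 c3 yc xc.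
have {}H1 := H1 (- x) ltac:(by rewrite normrN; lra).
have {}H2 := H2 y ltac:(by lra).
have {}H3 := H3 y ltac:(by lra).
move: H1 H2 H3; rewrite expR0 cos0 sin0 oppr0 mul0r !subr0 !mul1r opprK normrN addr0 => H1 H2 H3.
rewrite addr0; set E := expR (- x) in H1 *; set Co := cos y in H2 *; set Si := sin y in H3 *.
have E0 : 0 <= E by exact: expR_ge0.
have E1 : `|E - 1| <= e'.
  rewrite (_ : E - 1 = (E - 1 + x) + (- x)); last by ring.
  apply: le_trans (ler_normD _ _) _; rewrite normrN; nra.
have E2 : E <= 2 by move: E1; rewrite ler_norml => /andP[_]; lra.
have A1 : `|E * Co - 1 + x| <= e' * c + 2 * (e' * c).
  rewrite (_ : _ + x = (E - 1 + x) + E * (Co - 1)); last by ring.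
  apply: le_trans (ler_normD _ _) _; rewrite normrM (ger0_norm E0); apply: lerD.
    by apply: le_trans H1 _; rewrite ler_wpM2l// ltW.
  have C1 : `|Co - 1| <= e' * c by apply: le_trans H2 _; rewrite ler_wpM2l// ltW.
  by apply: ler_pM.
have A2 : `|- (E * Si) + y| <= e' * c + e' * (2 * c).
  rewrite (_ : _ + y = - (Si - y) - (E - 1) * Si); last by ring.
  apply: le_trans (ler_normB _ _) _; rewrite normrN normrM; apply: lerD.
    by apply: le_trans H3 _; rewrite ler_wpM2l// ltW.
  have S1 : `|Si| <= 2 * c.
    rewrite (_ : Si = (Si - y) + y); last by ring.
    apply: le_trans (ler_normD _ _) _; have := normr_ge0 y; nra.
  by apply: ler_pM.
apply: le_trans (lerD A1 A2) _; have := normr_ge0 y; nra.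
Qed.

(** The functional equation carries the derivative at 0 to every point. *)
Lemma hol_exp_opp z : hol exp_opp z.
Proof.
have -> : exp_opp = fun w => exp_opp z * exp_opp (w - z).
  by apply/funext => w; rewrite -exp_oppD addrC subrK.
apply: holM; first exact: hol_cst.
by apply: hol_shift; rewrite subrr; exists (-1); exact: cdiff_exp_opp0.
Qed.

Lemma hol_scale (f : R[i] -> R[i]) tau z : 0 < tau -> hol f (tau%:C%C * z) ->
  hol (fun w => f (tau%:C%C * w)) z.
Proof.
move=> t0 [d df]; exists (d * tau%:C%C) => e e0.
have et : 0 < e / tau by rewrite divr_gt0.
have [del d0 H] := df _ et; exists (del / tau); first by rewrite divr_gt0.
move=> w wz; have E : cmod (tau%:C%C * w - tau%:C%C * z) = tau * cmod (w - z).
  by rewrite -mulrBr cmodM cmod_real gtr0_norm.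
have := H (tau%:C%C * w); rewrite E -ltr_pdivlMl// mulrC => /(_ wz).
rewrite -mulrBr !mulrA divfK ?gt_eqF//.
Qed.

Lemma exp_opp_period (b : R) : exists2 tau, 0 < tau &
  exp_opp (tau%:C%C * (0 +i* b)%C) = 1.
Proof.
have E (t : R) : exp_opp (t%:C%C * (0 +i* b)%C) = (cos (t * b) +i* (- sin (t * b)))%C.
  rewrite /exp_opp /= !mul0r mulr0 subr0 oppr0 expR0 !mul1r.
  by rewrite addr0.
(* For [b = 0] any [tau] works; otherwise [tau = 2 pi / |b|]. *)
have [b00|b0] := eqVneq b 0.
  by exists 1 => //; rewrite E b00 mulr0 cos0 sin0 oppr0.
have pi2 : 0 < pi *+ 2 :> R by rewrite mulrn_wgt0// pi_gt0.
exists (pi *+ 2 / `|b|); first by rewrite divr_gt0// normr_gt0.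
rewrite E; apply: complex_ext => /=.
  case: (ltgtP b 0) => [bn|bp|bE]; last by rewrite bE eqxx in b0.
    by rewrite ltr0_norm// invrN mulrN mulNr divfK// cosN cos2pi.
  by rewrite gtr0_norm// divfK// cos2pi.
case: (ltgtP b 0) => [bn|bp|bE]; last by rewrite bE eqxx in b0.
  by rewrite ltr0_norm// invrN mulrN mulNr divfK// sinN sin2pi !oppr0.
by rewrite gtr0_norm// divfK// sin2pi oppr0.
Qed.

End ExponentialWeight.

(** The measure-preserving reflection exchanges the positive and negative parts of [u]. *)
Lemma odd_integral0 {R : realType} (u : R * R -> \bar R) (c : R) :
  leb2.-integrable setT u -> (forall p, u (p.1, (- p.2 + c)%R) = - u p)%E ->
  (\int[leb2]_p u p = 0)%E.
Proof.
move=> ui uo; have /measurable_int mu := ui.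
have mp : measurable_fun setT u^\+%E by exact: measurable_funepos.
have up : (\int[leb2]_p u^\+%E p)%E \is a fin_num by exact: integrable_pos_fin_num.
rewrite integralE.
have -> : (\int[leb2]_p u^\-%E p = \int[leb2]_p u^\+%E p)%E.
  rewrite -(ge0_integral_reflect c mp) => [|p]; last exact: funepos_ge0.
  by apply: eq_integral => p _; rewrite funenegE funeposE uo.
by rewrite subee.
Qed.

Section Reflection.
Context {R : realType}.
Variable alpha : R.
Implicit Types F : R[i] -> R[i].

Lemma hcont_reflect F (c : R) : hcont F -> hcont (fun z => F (conjc z + (0 +i* c)%C)).
Proof.
move=> cF z z0 e e0.
have /cF/(_ _ e0)[del d0 H] : 0 < complex.Re (conjc z + (0 +i* c)%C).
  by case: z z0 => x y; rewrite /= addr0.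
exists del => // w wz; apply: H.
by rewrite opprD addrACA subrr addr0 -rmorphB cmod_conj.
Qed.

Lemma nsq_reflect F (c : R) : hcont F ->
  nsq alpha (fun z => F (conjc z + (0 +i* c)%C)) = nsq alpha F.
Proof.
move=> cF; rewrite /nsq.
pose G : R * R -> \bar R :=
  (fun p => (cmod (F (p.1 +i* p.2)%C) ^+ 2 * p.1 `^ alpha)%:E) \_ (rhp2 0).
transitivity (\int[leb2]_p G p)%E; last by rewrite [RHS]integral_mkcond.
rewrite integral_mkcond.
have mG : measurable_fun setT G.
  apply/(measurable_restrict _ (measurable_rhp2 _) measurableT); rewrite setTI.
  exact: measurable_nsq.
have G0 p : (0 <= G p)%E.
  by rewrite /G patchE; case: ifP => // _; rewrite lee_fin mulr_ge0 ?powR_ge0 ?sqr_ge0.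
rewrite -(ge0_integral_reflect c mG G0); apply: eq_integral => -[x y] _.
rewrite /G !patchE /=.
have [x0|x0] := ltP 0 x.
  rewrite (mem_set (_ : rhp2 0 (x, y)))// (mem_set (_ : rhp2 0 (x, - y + c)))//.
  by congr ((cmod (F _) ^+ 2 * _)%:E); apply: complex_ext; rewrite /= ?addr0.
by rewrite !memNset//; rewrite /rhp2 /=; apply/negP; rewrite -leNgt.
Qed.

(** A vertical translation is the composite of two reflections. *)
Lemma hcont_vshift F (c : R) : hcont F -> hcont (fun z => F (z + (0 +i* c)%C)).
Proof.
move=> cF; have := hcont_reflect 0 (hcont_reflect c cF); congr hcont.
by apply/funext => z; congr F; apply: complex_ext; case: z => x y; rewrite /= ?addr0 ?opprK.
Qed.

Lemma nsq_vshift F (c : R) : hcont F ->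
  nsq alpha (fun z => F (z + (0 +i* c)%C)) = nsq alpha F.
Proof.
move=> cF; rewrite -(nsq_reflect c cF) -(nsq_reflect 0 (hcont_reflect c cF)).
by apply: eq_nsq => z _; congr F; apply: complex_ext; case: z => x y; rewrite /= ?addr0 ?opprK.
Qed.

Lemma hcontZ (c : R[i]) F : hcont F -> hcont (fun z => c * F z).
Proof.
move=> cF z z0 e e0; have c1 : 0 < cmod c + 1 by rewrite ltr_wpDl ?cmod_ge0.
have [del d0 H] := cF z z0 (e / (cmod c + 1)) (divr_gt0 e0 c1).
exists del => // w /H; rewrite -mulrBr cmodM ltr_pdivlMr// => h.
apply: le_lt_trans h; rewrite mulrC; apply: ler_wpM2l; first exact: cmod_ge0.
by rewrite lerDl.
Qed.

Lemma nsqZ_lty (c : R[i]) F : hcont F -> (nsq alpha F < +oo)%E ->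
  (nsq alpha (fun z => c * F z)%R < +oo)%E.
Proof.
move=> cF nF.
apply: (@le_lt_trans _ _ (nsq alpha (fun z => (cmod c)%:C%C * F z)%R)).
  apply: le_nsq; [exact: hcontZ|exact: hcontZ|].
  by move=> z _; rewrite !cmodM cmod_real ger0_norm ?cmod_ge0.
rewrite nsqZ//; apply: lte_mul_pinfty => //; rewrite lee_fin sqr_ge0//.
Qed.

End Reflection.

(** * The annihilating functional *)

Section Pairing.
Context {R : realType}.
Variables (alpha : R) (f E : R[i] -> R[i]).
Hypothesis cf : hcont f.
Hypothesis nf : (nsq alpha f < +oo)%E.
Hypothesis cE : hcont E.
Hypothesis E1 : forall z, 0 < complex.Re z -> cmod (E z) <= 1.

Let fr z := f (conjc z).

Let frE : fr = fun z => f (conjc z + (0 +i* 0)%C).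
Proof. by apply/funext => z; rewrite addr0. Qed.

Lemma hcont_fr : hcont fr. Proof. by rewrite frE; exact: hcont_reflect. Qed.

Lemma nsq_fr : nsq alpha fr = nsq alpha f.
Proof. by rewrite frE; exact: nsq_reflect. Qed.

(** Taking [Im] makes this only real linear in [F]; complex coefficients are covered by the factor
    [c] in [annihilated_vshift]. *)
Definition pairing (F : R[i] -> R[i]) (p : R * R) : \bar R :=
  (complex.Im (F (p.1 +i* p.2)%C * f (conjc (p.1 +i* p.2)%C)) *
   complex.Im (E (p.1 +i* p.2)%C) * p.1 `^ alpha)%:E.

Lemma measurable_pairing F : hcont F -> measurable_fun (rhp2 0) (pairing F).
Proof.
move=> cF; apply/measurable_EFinP; apply: measurable_funM; last first.
  have := @measurable_powR_fst R 0 alpha (rhp2 0).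
  by apply: eq_measurable_fun => p _; rewrite addr0.
apply: measurable_funM; last exact: measurable_Im.
rewrite (_ : (fun p => _) = fun p : R * R =>
    complex.Re (F (p.1 +i* p.2)%C) * complex.Im (fr (p.1 +i* p.2)%C) +
    complex.Im (F (p.1 +i* p.2)%C) * complex.Re (fr (p.1 +i* p.2)%C)); last first.
  by apply/funext => p; rewrite ImM; ring.
have c := hcont_fr.
by apply: measurable_funD; apply: measurable_funM; (exact: measurable_Re || exact: measurable_Im).
Qed.

(** AM-GM with a free parameter [e]: when [nsq alpha F < e ^ 2], the integrated bound is of order
    [e]. *)
Lemma abse_pairing_le F (e : R) p : 0 < e -> rhp2 0 p ->
  (`|pairing F p| <= (e^-1)%:E * (cmod (F (p.1 +i* p.2)%C) ^+ 2 * p.1 `^ alpha)%:E +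
   e%:E * (cmod (fr (p.1 +i* p.2)%C) ^+ 2 * p.1 `^ alpha)%:E)%E.
Proof.
move=> e0 p0; rewrite /pairing abse_EFin -!EFinM -EFinD lee_fin.
set z := (p.1 +i* p.2)%C; have x0 := powR_ge0 p.1 alpha.
rewrite !mulrA -mulrDl normrM (ger0_norm x0) ler_wpM2r// normrM.
apply: (@le_trans _ _ (cmod (F z) * cmod (fr z) * 1)).
  apply: ler_pM => //; first by rewrite -cmodM; exact: normr_Im_le.
  by apply: le_trans (normr_Im_le _) _; exact: E1.
rewrite mulr1; have := cmod_ge0 (F z); have := cmod_ge0 (fr z).
move: (cmod (F z)) (cmod (fr z)) => u v v0 u0.
rewrite -subr_ge0 (_ : _ - _ = ((u - 2^-1 * (e * v)) ^+ 2 + 3 / 4 * (e * v) ^+ 2) / e).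
  by rewrite divr_ge0 ?(ltW e0)// addr_ge0 ?sqr_ge0// mulr_ge0 ?sqr_ge0// divr_ge0.
by rewrite !expr2; field; rewrite gt_eqF.
Qed.

Lemma integral_abse_pairing_le F (e : R) : hcont F -> 0 < e ->
  (\int[leb2]_(p in rhp2 0) `|pairing F p| <=
   (e^-1)%:E * nsq alpha F + e%:E * nsq alpha f)%E.
Proof.
move=> cF e0; have mr := @measurable_rhp2 R 0; rewrite -nsq_fr /nsq.
have mF := measurable_nsq alpha cF; have mfr := measurable_nsq alpha hcont_fr.
have nn (H : R[i] -> R[i]) (p : R * R) : rhp2 0 p ->
    (0 <= (cmod (H (p.1 +i* p.2)%C) ^+ 2 * p.1 `^ alpha)%:E)%E.
  by move=> _; rewrite lee_fin mulr_ge0 ?powR_ge0 ?sqr_ge0.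
have ei0 : (0 <= (e^-1)%:E)%E by rewrite lee_fin invr_ge0 ltW.
have ee0 : (0 <= e%:E)%E by rewrite lee_fin ltW.
pose a (H : R[i] -> R[i]) (p : R * R) := (cmod (H (p.1 +i* p.2)%C) ^+ 2 * p.1 `^ alpha)%:E.
apply: (@le_trans _ _ (\int[leb2]_(p in rhp2 0) ((e^-1)%:E * a F p + e%:E * a fr p))%E).
  apply: ge0_le_integral => //.
  - by apply: measurableT_comp => //; exact: measurable_pairing.
  - by apply: emeasurable_funD; exact: measurable_funeM.
  - by move=> p p0; exact: abse_pairing_le.
rewrite ge0_integralD//.
- by rewrite !ge0_integralZl//; move=> p p0; exact: nn.
- by move=> p p0; rewrite mule_ge0 ?(nn F).
- exact: measurable_funeM.
- by move=> p p0; rewrite mule_ge0 ?(nn fr).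
- exact: measurable_funeM.
Qed.

Lemma pairing_integrable F : hcont F -> (nsq alpha F < +oo)%E ->
  leb2.-integrable (rhp2 0) (pairing F).
Proof.
move=> cF nF; apply/integrableP; split; first exact: measurable_pairing.
apply: le_lt_trans (integral_abse_pairing_le cF ltr01) _.
by rewrite invr1 !mul1e lte_add_pinfty.
Qed.

Definition annihilated F := [/\ hcont F, (nsq alpha F < +oo)%E &
  (\int[leb2]_(p in rhp2 0) pairing F p = 0)%E].

Lemma pairing_integralD F G : hcont F -> (nsq alpha F < +oo)%E ->
  hcont G -> (nsq alpha G < +oo)%E ->
  (\int[leb2]_(p in rhp2 0) pairing (fun z => F z + G z)%R p =
   \int[leb2]_(p in rhp2 0) pairing F p + \int[leb2]_(p in rhp2 0) pairing G p)%E.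
Proof.
move=> cF nF cG nG; rewrite -integralD; first last.
- exact: pairing_integrable.
- exact: pairing_integrable.
- exact: measurable_rhp2.
by apply: eq_integral => p _; rewrite /pairing -EFinD !mulrDl ImD !mulrDl.
Qed.

Lemma annihilatedD F G : annihilated F -> annihilated G -> annihilated (fun z => F z + G z).
Proof.
move=> [cF nF iF] [cG nG iG]; split; first exact: hcontD.
  apply: le_lt_trans (nsqD alpha cF cG) _.
  by apply: lte_add_pinfty; apply: lte_mul_pinfty.
by rewrite pairing_integralD// iF iG adde0.
Qed.

Lemma annihilated_sum (F : nat -> R[i] -> R[i]) n : (forall k, annihilated (F k)) ->
  annihilated (fun z => \sum_(k < n) F k z).
Proof.
move=> H; elim: n => [|n IH].
  have E0 : (fun z => \sum_(k < 0) F k z) = fun z => F 0%N z - F 0%N z.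
    by apply/funext => z; rewrite big_ord0 subrr.
  have c0 : hcont (fun z => \sum_(k < 0) F k z).
    by rewrite E0; apply: hcontB; have [] := H 0%N.
  split => //; last first.
    by apply: integral0_eq => p _; rewrite /pairing big_ord0 mul0r !mul0r.
  by rewrite /nsq integral0_eq ?ltry// => p _; rewrite big_ord0 cmod0 expr0n mul0r.
have := annihilatedD IH (H n); congr annihilated.
by apply/funext => z; rewrite big_ord_recr.
Qed.

(* The reflection y |-> - y - beta exchanges f(z + i beta) and f(conj z) and changes the sign of Im E. *)
Lemma annihilated_vshift (c : R[i]) (beta : R) :
  (forall z, complex.Im (E (conjc z - (0 +i* beta)%C)) = - complex.Im (E z)) ->
  annihilated (fun z => c * f (z + (0 +i* beta)%C)).
Proof.
move=> Eodd; have cF : hcont (fun z => c * f (z + (0 +i* beta)%C)).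
  by apply: hcontZ; exact: hcont_vshift.
have nF : (nsq alpha (fun z => c * f (z + (0 +i* beta)%C))%R < +oo)%E.
  by apply: nsqZ_lty; [exact: hcont_vshift|rewrite nsq_vshift].
split => //; rewrite integral_mkcond; apply: (@odd_integral0 _ _ (- beta)).
  have := pairing_integrable cF nF; move/integrable_mkcond; apply.
  exact: measurable_rhp2.
move=> [x y]; rewrite !patchE /=; have [x0|x0] := ltP 0 x; last first.
  by rewrite !memNset ?oppe0//; rewrite /rhp2 /=; apply/negP; rewrite -leNgt.
rewrite (mem_set (_ : rhp2 0 (x, y)))// (mem_set (_ : rhp2 0 (x, - y - beta)))//.
rewrite /pairing /=.
have -> : (x +i* (- y - beta))%C = conjc (x +i* y)%C - (0 +i* beta)%C.
  by apply: complex_ext; rewrite /= ?oppr0 ?addr0.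
rewrite Eodd subrK.
have -> : (x -i* (- y - beta))%C = (x +i* y)%C + (0 +i* beta)%C.
  by apply: complex_ext; rewrite /= ?addr0 ?opprD ?opprK.
by rewrite mulrN mulNr; congr (- (complex.Im _ * _ * _))%:E; ring.
Qed.

End Pairing.

Lemma negligible_box_contra {R : realType} (x y d : R) (A : set (R * R)) : 0 < d ->
  (forall q, `|q.1 - x| < d -> `|q.2 - y| < d -> A q) -> ~ leb2.-negligible A.
Proof.
move=> d0 HA nA.
pose I : set (measurableTypeR R) := `]x - d, x + d[%classic.
pose J : set (measurableTypeR R) := `]y - d, y + d[%classic.
have sub : I `*` J `<=` A.
  move=> [u v] [/=]; rewrite /I /J /= !in_itv /= => /andP[u1 u2] /andP[v1 v2].
  by apply: HA; rewrite /= ltr_norml; apply/andP; split; lra.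
have mI : measurable I by exact: measurable_itv.
have mJ : measurable J by exact: measurable_itv.
have mIJ : measurable (I `*` J) by exact: measurableX.
have : leb2 (I `*` J) = 0%E.
  exact: (measure_negligible mIJ (negligibleS sub nA)).
have dd (c : R) : lebesgue_measure `]c - d, c + d[%classic = (2 * d)%:E.
  rewrite lebesgue_measure_itv /= lte_fin (_ : c - d < c + d); last by lra.
  by rewrite -EFinB; congr EFin; ring.
have dI : leb I = (2 * d)%:E := dd x.
have dJ : leb J = (2 * d)%:E := dd y.
have -> : leb2 (I `*` J) = ((2 * d)%:E * (2 * d)%:E)%E.
  by rewrite -{1}dI -dJ; exact: product_measure1E.
rewrite -EFinM => -[] /eqP.
by rewrite gt_eqF// !mulr_gt0.
Qed.

Lemma Re_gt0_of_cyclic {R : realType} (alpha : R) (b : R[i]) : 0 <= complex.Re b ->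
  bergman_cyclic alpha (composition_operator (fun w : R[i] => w + b)) -> 0 < complex.Re b.
Proof.
move=> b0 [f [[holf nf'] [z1 z10 fz1] dense]].
rewrite lt_neqAle b0 andbT; apply/negP => /eqP Rb.
pose be := complex.Im b.
have kbE (k : nat) : k%:R * b = (0 +i* (k%:R * be))%C.
  have -> : (k%:R : R[i]) = (k%:R : R)%:C%C by rewrite rmorph_nat.
  by apply: complex_ext; rewrite ?ReM ?ImM /= -?Rb /be; ring.
have nf := (bergman_norm_lty alpha f).1 nf'.
have cf : hcont f := holomorphic_hcont holf.
have [tau t0 per] := exp_opp_period be.
pose E z := exp_opp (tau%:C%C * z).
have ED z w : E (z + w) = E z * E w by rewrite /E mulrDr exp_oppD.
have holE z : hol E z by apply: hol_scale => //; exact: hol_exp_opp.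
have cE : hcont E by move=> z _; exact/hol_ccont/holE.
have E1 z : 0 < complex.Re z -> cmod (E z) <= 1.
  by move=> z0; apply: cmod_exp_opp_le1; rewrite ReM /= mul0r subr0 mulr_ge0// ltW.
have Econj z : E (conjc z) = conjc (E z).
  rewrite /E -exp_opp_conj; congr exp_opp.
  by apply: complex_ext; case: z => x y; rewrite /=; ring.
have Ek (k : nat) : E (0 +i* (k%:R * be))%C = 1.
  rewrite -kbE; elim: k => [|k IH]; first by rewrite mul0r /E mulr0 exp_opp0.
  rewrite -natr1 mulrDl ED IH mul1r mul1r /E.
  by rewrite (_ : b = (0 +i* be)%C)//; apply: complex_ext.
(* [E (conj z) = conj (E z)] makes [Im E] odd in [y], and the period absorbs the shift by [k b]. *)
have Eodd (k : nat) z :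
    complex.Im (E (conjc z - (0 +i* (k%:R * be))%C)) = - complex.Im (E z).
  rewrite -[E (_ - _)]mulr1 -(Ek k) -ED subrK Econj.
  by case: (E z).
pose fr z := f (conjc z).
(* The first factor is the Schwarz reflection of [f], hence holomorphic; its product with
   [f (conj z)] is real, so [Im] reaches only [E]. *)
pose h0 z : R[i] := conjc (fr z) * E z.
have hol0 z : 0 < complex.Re z -> hol h0 z.
  move=> z0; apply: holM => //.
  have /holf/derivable_cdiff[d df] : right_half_plane (conjc z) by case: z z0 => x y.
  by exists (conjc d); exact: cdiff_conj.
have c0 : hcont h0 by move=> z z0; exact/hol_ccont/hol0.
have n0 : (nsq alpha h0 < +oo)%E.
  rewrite -(nsq_fr alpha cf) in nf; apply: le_lt_trans nf.
  apply: le_nsq => //; first exact: hcont_fr.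
  move=> z z0; rewrite cmodM cmod_conj -[leRHS]mulr1; apply: ler_wpM2l; first exact: cmod_ge0.
  exact: E1.
have bh0 : bergman alpha h0.
  split; last exact/bergman_norm_lty.
  by move=> z z0; have [d] := hol0 z z0; exact: cdiff_derivable.
have nff : nsq alpha f \is a fin_num by rewrite ge0_fin_numE ?nsq_ge0.
pose N := fine (nsq alpha f); have N0 : 0 <= N by rewrite fine_ge0 ?nsq_ge0.
pose D := @rhp2 R 0.
have pE p : pairing alpha f E h0 p =
    (cmod (fr (p.1 +i* p.2)%C) ^+ 2 * complex.Im (E (p.1 +i* p.2)%C) ^+ 2 * p.1 `^ alpha)%:E.
  rewrite /pairing /h0 -/(fr _); congr ((_ * _)%:E); rewrite cmodE.
  case: (fr _) => u v; case: (E _) => s t /=; ring.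
have p0 p : (0 <= pairing alpha f E h0 p)%E.
  by rewrite pE lee_fin; apply: mulr_ge0; [apply: mulr_ge0; exact: sqr_ge0|exact: powR_ge0].
(* A combination [h] within [e] of [h0] is annihilated, so only [h0 - h] contributes, at most
   [e^-1 * e ^ 2 + e * N]. *)
have small (e : R) : 0 < e ->
    (\int[leb2]_(p in D) pairing alpha f E h0 p <= (e * (1 + N))%:E)%E.
  move=> e0; have [h [n [c hc]] he] := dense h0 bh0 e e0.
  have hE : h = fun z => \sum_(k < n) c k * f (z + k%:R * b).
    apply/funext => z; rewrite hc fct_sumE; apply: eq_bigr => k _.
    by rewrite -(iter_composition_operator b f).
  (* The coefficients are extended by 0 to all of [nat], the index type of [annihilated_sum]. *)
  pose c' (k : nat) : R[i] := if insub k is Some i then c i else 0.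
  have A : annihilated alpha f E h.
    have -> : h = fun z => \sum_(k < n) c' k * f (z + (0 +i* (k%:R * be))%C).
      rewrite hE; apply/funext => z; apply: eq_bigr => k _; rewrite kbE /c'.
      by rewrite valK.
    apply: (annihilated_sum cf nf cE E1 (F := fun k z => c' k * f (z + (0 +i* (k%:R * be))%C))) => k.
    by apply: annihilated_vshift => //; exact: Eodd.
  have [ch nh ih] := A.
  have nd := (bergman_norm_lt alpha _ e0).1 he.
  have cd : hcont (fun z => h0 z - h z) by exact: hcontB.
  have ndf : (nsq alpha (fun z => h0 z - h z)%R < +oo)%E.
    exact: lt_trans nd (ltry _).
  have := pairing_integralD cf nf cE E1 cd ndf ch nh.
  rewrite ih adde0 (_ : (fun z => _) = h0); last by apply/funext => z; rewrite subrK.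
  move=> ->; apply: (le_trans (lee_abs _)).
  apply: (@le_trans _ _ (\int[leb2]_(p in D) `|pairing alpha f E (fun z => h0 z - h z)%R p|)%E).
    apply: le_abse_integral; first exact: measurable_rhp2.
    exact: measurable_pairing.
  apply: le_trans (integral_abse_pairing_le alpha cf cE E1 cd e0) _.
  rewrite -(fineK nff) -/N mulrDr mulr1 EFinD EFinM; apply: leeD => //.
  apply: le_trans (lee_wpmul2l _ (ltW nd)) _; first by rewrite lee_fin invr_ge0 ltW.
  by rewrite -EFinM lee_fin expr2 mulKf// gt_eqF.
have int0 : (\int[leb2]_(p in D) `|pairing alpha f E h0 p| = 0)%E.
  under eq_integral do rewrite gee0_abs//.
  apply/eqP; rewrite eq_le integral_ge0// andbT.
  apply/lee_addgt0Pr => e e0; rewrite add0e.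
  have N1 : 0 < 1 + N by rewrite ltr_pwDl.
  by have := small (e / (1 + N)) (divr_gt0 e0 N1); rewrite divfK ?gt_eqF.
have ae0 : ae_eq leb2 D (pairing alpha f E h0) (cst 0%E).
  apply/(ae_eq_integral_abs leb2 (@measurable_rhp2 R 0)); last exact: int0.
  exact: (measurable_pairing alpha cf cE c0).
have cfr : hcont fr by exact: hcont_fr.
have [z [Rz fz Iz]] : exists z, [/\ 0 < complex.Re z, fr z != 0 & complex.Im (E z) != 0].
  pose z := conjc z1; have Rz : 0 < complex.Re z by rewrite /z; case: (z1) z10.
  have fz : fr z = f z1 by rewrite /fr /z conjcK.
  have [Iz|Iz] := eqVneq (complex.Im (E z)) 0; last by exists z; rewrite fz.
  have fz0 : 0 < cmod (fr z) by rewrite cmod_gt0 fz.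
  have [del del0 H] := cfr z Rz _ fz0.
  (* If [Im (E z) = 0], then [E z] is a nonzero real, and moving up by [t] makes [Im E] nonzero,
     because [0 < tau * t <= 1 < pi]. The bound [del / 2] keeps [fr] nonzero. *)
  pose t := Num.min (del / 2) tau^-1.
  have tp : 0 < t by rewrite lt_min divr_gt0// invr_gt0.
  exists (z + (0 +i* t)%C); split; first by rewrite ReD /= addr0.
    have : cmod (fr (z + (0 +i* t)%C) - fr z) < cmod (fr z).
      apply: H; rewrite addrC addKr; have -> : cmod (0 +i* t)%C = t.
        by rewrite /cmod /= expr0n add0r sqrtr_sqr gtr0_norm.
      by rewrite gt_min (_ : del / 2 < del) ?orbT//; lra.
    by apply: contraTneq => ->; rewrite sub0r cmodN ltxx.
  rewrite ED ImM Iz mul0r addr0 mulf_neq0//.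
    have : E z * E (- z) != 0 by rewrite -ED subrr /E mulr0 exp_opp0 oner_neq0.
    apply: contraNneq => Re0; rewrite (_ : E z = 0) ?mul0r//; exact: complex_ext.
  rewrite /E /exp_opp /= mul0r !mulr0 subr0 oppr0 expR0 mul1r addr0 oppr_eq0 gt_eqF//.
  rewrite sin_gt0_pi// mulr_gt0//=.
  apply: (@le_lt_trans _ _ 1); last by apply: lt_le_trans (pi_ge2 R); rewrite ltr1n.
  by rewrite -(@mulfV _ tau) ?gt_eqF// ler_pM2l// ge_min lexx orbT.
have fz0 : 0 < cmod (fr z) by rewrite cmod_gt0.
have [d1 d10 H1] := cfr z Rz _ fz0.
have Iz0 : 0 < `|complex.Im (E z)| by rewrite normr_gt0.
have [d2 d20 H2] := ccont_Im (hol_ccont (holE z)) Iz0.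
pose d := Num.min (complex.Re z) (Num.min (d1 / 2) (d2 / 2)).
have d0 : 0 < d by rewrite !lt_min Rz !divr_gt0.
(* By continuity the integrand is positive on a whole box around [z], which is not negligible. *)
apply: (negligible_box_contra (x := complex.Re z) (y := complex.Im z) d0 _ ae0) => q q1 q2.
rewrite /= => Hq.
have Q0 : rhp2 0 q.
  have : d <= complex.Re z by rewrite ge_min lexx.
  by rewrite /rhp2 /=; move: q1; rewrite ltr_norml => /andP[]; lra.
have dd1 : d <= d1 / 2 by rewrite !ge_min lexx orbT.
have dd2 : d <= d2 / 2 by rewrite !ge_min lexx !orbT.
have fq : fr (q.1 +i* q.2)%C != 0.
  have : cmod (fr (q.1 +i* q.2)%C - fr z) < cmod (fr z).
    by apply/H1/near_complex => //; [exact: lt_le_trans dd1|exact: lt_le_trans dd1].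
  by apply: contraTneq => ->; rewrite sub0r cmodN ltxx.
have Iq : complex.Im (E (q.1 +i* q.2)%C) != 0.
  have : `|complex.Im (E (q.1 +i* q.2)%C) - complex.Im (E z)| < `|complex.Im (E z)|.
    by apply/H2/near_complex => //; [exact: lt_le_trans dd2|exact: lt_le_trans dd2].
  by apply: contraTneq => ->; rewrite sub0r normrN ltxx.
have := Hq Q0; rewrite pE => -[] /eqP; apply/negP.
rewrite gt_eqF//; apply: mulr_gt0; last exact: powR_gt0.
by apply: mulr_gt0; [rewrite exprn_gt0// cmod_gt0|rewrite exprn_even_gt0].
Qed.

Theorem proposition13 (R : realType) (alpha : R) (b : R[i])
    (halpha : -1 < alpha) (hb : 0 <= complex.Re b) :
  bergman_cyclic alpha (composition_operator (fun w : R[i] => w + b)) <->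
  0 < complex.Re b.
Proof. by split; [exact: Re_gt0_of_cyclic|exact: cyclic_of_Re_gt0]. Qed.
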